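(* Let $\Lambda$ be a finite dimensional algebra over an algebraically closed field $\mathbb{K}$. With the sets and maps $$\mathsf{s}\tau\text{-}\mathsf{tilt}\,\Lambda\subset\tau\text{-}\mathsf{rigid}\,\Lambda,\quad \mathsf{f}\text{-}\mathsf{tors}\,\Lambda\subset\mathsf{f_L}2\text{-}\mathsf{tors}^{*}\Lambda,\quad \mathsf{cok}_1\colon\tau\text{-}\mathsf{rigid}\,\Lambda\to\mathsf{f_L}2\text{-}\mathsf{tors}^{*}\Lambda,$$ $$\mathsf{Fac}\colon\mathsf{s}\tau\text{-}\mathsf{tilt}\,\Lambda\to\mathsf{f}\text{-}\mathsf{tors}\,\Lambda,\quad \mathsf{Fac}\colon\tau\text{-}\mathsf{rigid}\,\Lambda\to\mathsf{f}\text{-}\mathsf{tors}\,\Lambda,\quad \overline{(-)}\colon\tau\text{-}\mathsf{rigid}\,\Lambda\to\mathsf{s}\tau\text{-}\mathsf{tilt}\,\Lambda,\quad T_1(-)\colon\mathsf{f_L}2\text{-}\mathsf{tors}^{*}\Lambda\to\mathsf{f}\text{-}\mathsf{tors}\,\Lambda$$ defined in the context, the diagram they form commutes, that is: (1) $\mathsf{cok}_1 T=\mathsf{Fac}\,T$ for every $T\in\mathsf{s}\tau\text{-}\mathsf{tilt}\,\Lambda$; (2) $\overline{T}\cong T$ for every $T\in\mathsf{s}\tau\text{-}\mathsf{tilt}\,\Lambda$; (3) $T_1(\mathcal{T})=\mathcal{T}$ for every $\mathcal{T}\in\mathsf{f}\text{-}\mathsf{tors}\,\Lambda$; (4) $\mathsf{Fac}\,\overline{U}=\mathsf{Fac}\,U=T_1(\mathsf{cok}_1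 U)$ for every $U\in\tau\text{-}\mathsf{rigid}\,\Lambda$.
   Context: $\mathsf{mod}\,\Lambda$ is the category of finitely generated right $\Lambda$-modules; all subcategories are full and closed under isomorphisms. $\tau$ is the Auslander-Reiten translation; $M$ is $\tau$-rigid if $\mathrm{Hom}_\Lambda(M,\tau M)=0$; $M$ is $\tau$-tilting if it is $\tau$-rigid and $|M|=|\Lambda|$, where $|M|$ is the number of isomorphism classes of indecomposable direct summands; $M$ is support $\tau$-tilting if it is a $\tau$-tilting $\Lambda/\langle e\rangle$-module for some idempotent $e$ of $\Lambda$. $M$ is basic if it has no direct summand $N\oplus N$ with $N$ indecomposable. $\tau\text{-}\mathsf{rigid}\,\Lambda$ (resp. $\mathsf{s}\tau\text{-}\mathsf{tilt}\,\Lambda$) is the set of isomorphism classes of basic $\tau$-rigid (resp. basic support $\tau$-tilting) modules. $\mathsf{add}\,M$ is the subcategory of finite direct sums of direct summands of $M$; $\mathsf{Fac}\,M$ is the subcategory of all quotients of modules in $\mathsf{add}\,M$; $\mathsf{cok}_1M$ is the subcategory of all $C$ admitting an exact sequence $M_1\to M_0\to C\to0$ with $M_0,M_1\in\mathsf{add}\,M$. A conflation in an extension-closed subcategory $\mathcal{E}$ of $\mathsf{mod}\,\Lambda$ is a short exact sequence with all three terms in $\mathcal{E}$; $\mathcal{S}\subset\mathcal{E}$ is a torsion class of $\mathcal{E}$ if for every conflation $0\to A\to B\to C\to0$ in $\mathcal{E}$: $A,C\in\mathcal{S}$ implies $B\in\mathcal{S}$, and $B\in\mathcal{S}$ implies $C\in\mathcal{S}$.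 A $2$-fold torsion class of $\mathsf{mod}\,\Lambda$ is a torsion class of some torsion class of $\mathsf{mod}\,\Lambda$. $T_1(\mathcal{C})$ is the smallest torsion class of $\mathsf{mod}\,\Lambda$ containing $\mathcal{C}$. A subcategory is functorially finite if every module has a left and a right approximation by it. $\mathsf{f}\text{-}\mathsf{tors}\,\Lambda$ is the set of functorially finite torsion classes of $\mathsf{mod}\,\Lambda$. An Ext-progenerator of an extension-closed $\mathcal{X}$ is an object $P\in\mathcal{X}$ with $\mathrm{Ext}^1_\Lambda(P,X)=0$ for all $X\in\mathcal{X}$ and such that every $X\in\mathcal{X}$ admits a conflation $0\to T\to P'\to X\to0$ in $\mathcal{X}$ with $P'\in\mathsf{add}\,P$. Every $\mathcal{T}\in\mathsf{f}\text{-}\mathsf{tors}\,\Lambda$ has a basic Ext-progenerator $P(\mathcal{T})$, unique up to isomorphism; and $\mathsf{Fac}\,U\in\mathsf{f}\text{-}\mathsf{tors}\,\Lambda$ for $U$ $\tau$-rigid. The co-Bongartz completion of $U\in\tau\text{-}\mathsf{rigid}\,\Lambda$ is $\overline{U}:=P(\mathsf{Fac}\,U)$. $\mathsf{f_L}2\text{-}\mathsf{tors}^{*}\Lambda$ is the set of $2$-fold torsion classes $\mathcal{C}$ of $\mathsf{mod}\,\Lambda$ with $T_1(\mathcal{C})\in\mathsf{f}\text{-}\mathsf{tors}\,\Lambda$ such that for every $C\in\mathcal{C}$ and the right minimal $(\mathsf{add}\,P(T_1(\mathcal{C})))$-approximation $P_C\to C$, one has $P_C\in\mathcal{C}$. (A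 right $\mathcal{X}$-approximation of $M$ is a morphism $f\colon X\to M$ with $X\in\mathcal{X}$ through which every morphism from an object of $\mathcal{X}$ to $M$ factors; it is right minimal if every $g\in\mathrm{End}(X)$ with $fg=f$ is an isomorphism; left versions are dual.) *)

(* Defs.v *)
From HB Require Import structures.
From mathcomp Require Import all_boot all_algebra all_field.
From Stdlib Require Import ClassicalEpsilon.

Set Implicit Arguments.
Unset Strict Implicit.
Unset Printing Implicit Defensive.

Import GRing.Theory.
Local Open Scope ring_scope.

(** * Finite dimensional algebras *)

(* MathComp's falgType requires 1 != 0.  The zero algebra has to be allowed
   here, since the quotient of an algebra by <e> vanishes for e = 1. *)
Record fdalg (K : fieldType) := FdAlg {
  acar :> vectType K;
  amul : acar -> acar -> acar;
  aone : acar;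
  amul_addl : forall x y z, amul (x + y) z = amul x z + amul y z;
  amul_addr : forall x y z, amul x (y + z) = amul x y + amul x z;
  amul_scalel : forall k x y, amul (k *: x) y = k *: amul x y;
  amul_scaler : forall k x y, amul x (k *: y) = k *: amul x y;
  amul_assoc : forall x y z, amul x (amul y z) = amul (amul x y) z;
  amul_1l : forall x, amul aone x = x;
  amul_1r : forall x, amul x aone = x
}.

Arguments aone {K f}.
Infix "**" := amul (at level 40, left associativity) : ring_scope.

Definition fdalg_of_falgType (K : fieldType) (A : falgType K) : fdalg K :=
  @FdAlg K A *%R 1 (@mulrDl A) (@mulrDr A)
    (fun k x y => esym (scalerAl k x y)) (fun k x y => esym (scalerAr k x y))
    (@mulrA A) (@mul1r A) (@mulr1 A).

Definition aopp (K : fieldType) (A : fdalg K) : fdalg K :=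
  @FdAlg K A (fun x y => y ** x) aone
    (fun x y z => amul_addr z x y) (fun x y z => amul_addl y z x)
    (fun k x y => amul_scaler k y x) (fun k x y => amul_scalel k y x)
    (fun x y z => esym (amul_assoc z y x)) (@amul_1r K A) (@amul_1l K A).

(* x belongs to <e> = A e A *)
Definition in_ideal_gen (K : fieldType) (A : fdalg K) (e x : A) : Prop :=
  exists s : seq (A * A), x = \sum_(p <- s) p.1 ** e ** p.2.

Record alg_hom (K : fieldType) (A B : fdalg K) := AlgHom {
  alg_fun :> 'Hom(A, B);
  alg_hom1 : alg_fun aone = aone;
  alg_homM : forall x y, alg_fun (x ** y) = alg_fun x ** alg_fun y
}.

(* (B, p) is a model of the quotient algebra A / <e> *)
Definition is_quotient_by (K : fieldType) (A B : fdalg K) (e : A)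
    (p : alg_hom A B) : Prop :=
  limg p = fullv /\ forall x, p x = 0 <-> in_ideal_gen e x.

(** * Finitely generated right modules *)

(* Over a finite dimensional algebra, finitely generated means finite
   dimensional over K; the scaling axioms say that the K-structure of the
   module is the one induced by K -> A. *)
Record rmod (K : fieldType) (A : fdalg K) := RMod {
  mcar :> vectType K;
  mact : mcar -> A -> mcar;
  mact_addl : forall u v a, mact (u + v) a = mact u a + mact v a;
  mact_addr : forall u a b, mact u (a + b) = mact u a + mact u b;
  mact_scalel : forall k u a, mact (k *: u) a = k *: mact u a;
  mact_scaler : forall k u a, mact u (k *: a) = k *: mact u a;
  mact_assoc : forall u a b, mact u (a ** b) = mact (mact u a) b;
  mact_1 : forall u, mact u aone = u
}.

Infix "*>" := mact (at level 40, left associativity) : ring_scope.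

Section Modules.
Variables (K : fieldType) (A : fdalg K).
Implicit Types M N X Y P : rmod A.

Definition is_hom M N (f : 'Hom(M, N)) : Prop :=
  forall v a, f (v *> a) = f v *> a.

Definition hom_zero M N : Prop := forall f : 'Hom(M, N), is_hom f -> f = 0.

Definition iso M N : Prop := exists2 f : 'Hom(M, N), is_hom f & bijective f.

Definition ses M N P (f : 'Hom(M, N)) (g : 'Hom(N, P)) : Prop :=
  [/\ is_hom f, is_hom g, lker f = 0%VS, limg f = lker g & limg g = fullv].

Definition rmod0 : rmod A.
Proof.
by apply: (@RMod K A 'rV[K]_0 (fun v _ => v)) => // *;
  rewrite [LHS]thinmx0 [RHS]thinmx0.
Defined.

Definition rmod_reg : rmod A :=
  @RMod K A A (@amul K A) (@amul_addl K A) (@amul_addr K A)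
    (@amul_scalel K A) (@amul_scaler K A) (@amul_assoc K A) (@amul_1r K A).

Definition dsum M N : rmod A.
Proof.
apply: (@RMod K A (M * N)%type (fun v a => (v.1 *> a, v.2 *> a))).
- by move=> u v a; rewrite /= !mact_addl.
- by move=> u a b; rewrite /= !mact_addr.
- by move=> k u a; rewrite /= !mact_scalel.
- by move=> k u a; rewrite /= !mact_scaler.
- by move=> u a b; rewrite /= !mact_assoc.
- by case=> u v; rewrite /= !mact_1.
Defined.

Definition summand X M : Prop := exists Y, iso M (dsum X Y).

Definition indecomposable M : Prop :=
  ~ iso M rmod0 /\
  forall X Y, iso M (dsum X Y) -> iso X rmod0 \/ iso Y rmod0.

Definition basic M : Prop :=
  ~ exists2 N, indecomposable N & summand (dsum N N) M.

(* |M| = n *)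
Definition num_indec M (n : nat) : Prop :=
  exists N : 'I_n -> rmod A,
    [/\ forall i, indecomposable (N i) /\ summand (N i) M,
        forall i j, iso (N i) (N j) -> i = j
      & forall X, indecomposable X -> summand X M -> exists i, iso X (N i)].

(** ** Projective presentations *)

Definition projective P : Prop :=
  forall X Y (g : 'Hom(X, Y)) (h : 'Hom(P, Y)),
    is_hom g -> limg g = fullv -> is_hom h ->
    exists2 l : 'Hom(P, X), is_hom l & (g \o l)%VF = h.

(* The corestriction of p to its image is an essential epimorphism; for P
   projective, this makes it a projective cover of the image. *)
Definition essential P X (p : 'Hom(P, X)) : Prop :=
  forall Y (h : 'Hom(Y, P)),
    is_hom h -> limg (p \o h)%VF = limg p -> limg h = fullv.

Definition min_proj_presentation P1 P0 M
    (p1 : 'Hom(P1, P0)) (p0 : 'Hom(P0, M)) : Prop :=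
  [/\ projective P1 /\ projective P0, is_hom p1 /\ is_hom p0,
      limg p1 = lker p0, limg p0 = fullv & essential p1 /\ essential p0].

(** ** The space of homomorphisms *)

Definition mact_lin M (a : A) : 'End(M) := linfun (fun v : M => v *> a).

Lemma mact_linE M a v : mact_lin M a v = v *> a.
Proof.
pose h := GRing.isLinear.Build K M M *:%R (fun v : M => v *> a)
  (fun k u w => eq_trans (mact_addl _ _ _)
                         (congr1 (+%R^~ _) (mact_scalel _ _ _))).
pose f : {linear M -> M} := HB.pack (fun v : M => v *> a) h.
exact: (lfunE f).
Qed.

Definition hom_defect M N (a : A) (f : 'Hom(M, N)) : 'Hom(M, N) :=
  (f \o mact_lin M a)%VF - (mact_lin N a \o f)%VF.

Fact hom_defect_is_linear M N a : linear (@hom_defect M N a).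
Proof.
move=> k f g; apply/lfunP => v.
rewrite /hom_defect !(add_lfunE, opp_lfunE, scale_lfunE, comp_lfunE).
rewrite !mact_linE mact_addl mact_scalel.
by rewrite scalerBr opprD addrACA.
Qed.

HB.instance Definition _ M N a :=
  GRing.isLinear.Build K 'Hom(M, N) 'Hom(M, N) *:%R (@hom_defect M N a)
    (@hom_defect_is_linear M N a).

Definition homs M N : {vspace 'Hom(M, N)} :=
  (\bigcap_(i < \dim {:A}) lker (linfun (@hom_defect M N (vbasis {:A})`_i)))%VS.

Lemma homsP M N (f : 'Hom(M, N)) : f \in homs M N <-> is_hom f.
Proof.
have defectE a v : hom_defect a f v = f (v *> a) - f v *> a.
  by rewrite /hom_defect !(add_lfunE, opp_lfunE, comp_lfunE) !mact_linE.
split=> [fH v a | fH].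
  have fb (i : 'I_(\dim {:A})) w :
      f (w *> (vbasis {:A})`_i) = f w *> (vbasis {:A})`_i.
    have := fH; rewrite memvE => /subv_bigcapP/(_ i isT).
    rewrite -memvE memv_ker lfunE /= => /eqP/lfunP/(_ w).
    by rewrite defectE zero_lfunE => /eqP; rewrite subr_eq0 => /eqP.
  rewrite (coord_vbasis (memvf a)).
  elim/big_ind: _ => [|x y IHx IHy|i _].
  - have act0 X (w : X) : w *> (0 : A) = 0.
      by rewrite -(scale0r (0 : A)) mact_scaler scale0r.
    by rewrite !act0 linear0.
  - by rewrite !mact_addr linearD /= IHx IHy.
  - by rewrite !mact_scaler linearZ /= fb.
rewrite memvE; apply/subv_bigcapP => i _; rewrite -memvE memv_ker lfunE /=; apply/eqP/lfunP => v.
by rewrite defectE zero_lfunE fH subrr.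
Qed.

End Modules.

(** * Auslander-Reiten translation *)

Section Star.
Variables (K : fieldType) (A : fdalg K).
Implicit Types M N : rmod A.

Definition lmul (a : A) : 'End(A) := linfun (fun x : A => a ** x).

Lemma lmulE a x : lmul a x = a ** x.
Proof.
pose h := GRing.isLinear.Build K A A *:%R (fun x : A => a ** x)
  (fun k u w => eq_trans (amul_addr _ _ _)
                         (congr1 (+%R^~ _) (amul_scaler _ _ _))).
pose f : {linear A -> A} := HB.pack (fun x : A => a ** x) h.
exact: (lfunE f).
Qed.

Definition star_space M := subvs_of (homs M (rmod_reg A)).

Definition star_act M (f : star_space M) (a : A) : star_space M :=
  vsproj (homs M (rmod_reg A)) (lmul a \o vsval f)%VF.

Lemma star_actE M (f : star_space M) a v :
  vsval (star_act f a) v = a ** vsval f v.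
Proof.
rewrite /star_act vsprojK ?comp_lfunE ?lmulE //; apply/homsP => u b.
have /homsP fH := valP f.
by rewrite !comp_lfunE !lmulE fH /= amul_assoc.
Qed.

(* Hom_A(M, A), with (f a)(v) = a f(v): a left A-module, that is, a right
   module over the opposite algebra *)
Definition star M : rmod (aopp A).
Proof.
apply: (@RMod K (aopp A) (star_space M) (@star_act M)).
- move=> f g a; apply/val_inj/lfunP => v.
  by rewrite /= add_lfunE !star_actE add_lfunE amul_addr.
- move=> f a b; apply/val_inj/lfunP => v.
  by rewrite /= add_lfunE !star_actE amul_addl.
- move=> k f a; apply/val_inj/lfunP => v.
  by rewrite /= scale_lfunE !star_actE scale_lfunE amul_scaler.
- move=> k f a; apply/val_inj/lfunP => v.
  by rewrite /= scale_lfunE !star_actE amul_scalel.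
- move=> f a b; apply/val_inj/lfunP => v.
  by rewrite /= !star_actE amul_assoc.
- move=> f; apply/val_inj/lfunP => v.
  by rewrite /= !star_actE amul_1l.
Defined.

Definition precomp M N (p : 'Hom(M, N)) (g : star N) : star M :=
  vsproj (homs M (rmod_reg A)) (vsval g \o p)%VF.

Fact precomp_is_linear M N (p : 'Hom(M, N)) : linear (precomp p).
Proof.
move=> k f g; rewrite /precomp (linearP (@vsval K _ (homs N (rmod_reg A)))).
by rewrite comp_lfunDl -comp_lfunZl linearP.
Qed.

HB.instance Definition _ M N (p : 'Hom(M, N)) :=
  GRing.isLinear.Build K (star N) (star M) *:%R (precomp p)
    (precomp_is_linear p).

Definition star_map M N (p : 'Hom(M, N)) : 'Hom(star N, star M) :=
  linfun (precomp p).

Lemma star_mapE M N (p : 'Hom(M, N)) (g : star N) v :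
  is_hom p -> vsval (star_map p g) v = vsval g (p v).
Proof.
move=> pH; rewrite lfunE /= /precomp vsprojK ?comp_lfunE //.
apply/(@homsP _ _ M (rmod_reg A)) => u a.
by have /homsP gH := subvsP (g : star_space N); rewrite !comp_lfunE pH gH.
Qed.

(* The K-dual of a left A-module, with (phi a)(v) = phi(a v) *)
Definition dual (N : rmod (aopp A)) : rmod A.
Proof.
apply: (@RMod K A 'Hom(N, K^o) (fun phi a => (phi \o mact_lin N a)%VF)).
- by move=> f g a; apply/lfunP => v; rewrite !(add_lfunE, comp_lfunE).
- move=> f a b; apply/lfunP => v.
  by rewrite !(add_lfunE, comp_lfunE) !mact_linE mact_addr linearD.
- by move=> k f a; apply/lfunP => v; rewrite !(scale_lfunE, comp_lfunE).
- move=> k f a; apply/lfunP => v.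
  by rewrite !(scale_lfunE, comp_lfunE) !mact_linE mact_scaler linearZ.
- move=> f a b; apply/lfunP => v.
  by rewrite !comp_lfunE !mact_linE -mact_assoc.
- by move=> f; apply/lfunP => v; rewrite !comp_lfunE !mact_linE mact_1.
Defined.

(* N is the transpose of M: for a minimal projective presentation p1 of M, the
   sequence star P0 -> star P1 -> N -> 0 is exact. *)
Definition is_transpose M (N : rmod (aopp A)) : Prop :=
  exists (P1 P0 : rmod A) (p1 : 'Hom(P1, P0)) (p0 : 'Hom(P0, M))
         (q : 'Hom(star P1, N)),
    min_proj_presentation p1 p0 /\
    [/\ is_hom q, limg (star_map p1) = lker q & limg q = fullv].

(* The transpose is unique up to isomorphism. *)
Definition tr M : rmod (aopp A) :=
  epsilon (inhabits (rmod0 (aopp A))) (is_transpose M).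

Definition tau M : rmod A := dual (tr M).

Definition is_tau_rigid M : Prop := hom_zero M (tau M).

Definition is_tau_tilting M : Prop :=
  is_tau_rigid M /\ exists n, num_indec M n /\ num_indec (rmod_reg A) n.

End Star.

(* The A-module underlying a B-module, along p : A -> B *)
Definition restrict (K : fieldType) (A B : fdalg K) (p : alg_hom A B)
    (N : rmod B) : rmod A.
Proof.
apply: (@RMod K A N (fun v a => v *> p a)).
- by move=> *; rewrite mact_addl.
- by move=> *; rewrite linearD mact_addr.
- by move=> *; rewrite mact_scalel.
- by move=> *; rewrite linearZ mact_scaler.
- by move=> *; rewrite alg_homM mact_assoc.
- by move=> *; rewrite alg_hom1 mact_1.
Defined.

Definition is_support_tau_tilting (K : fieldType) (A : fdalg K)
    (M : rmod A) : Prop :=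
  exists2 e : A, e ** e = e &
    exists (B : fdalg K) (p : alg_hom A B) (N : rmod B),
      [/\ is_quotient_by e p, is_tau_tilting N & iso M (restrict p N)].

(** * Subcategories of mod A *)

(* A full subcategory is given by its class of objects. *)
Definition subcat (K : fieldType) (A : fdalg K) := rmod A -> Prop.

Section Subcategories.
Variables (K : fieldType) (A : fdalg K).
Implicit Types (M X Y P U : rmod A) (C D E S T : subcat A).

Definition sub_subcat C D : Prop := forall X, C X -> D X.

Definition eq_subcat C D : Prop := forall X, C X <-> D X.

Definition iso_closed C : Prop := forall X Y, iso X Y -> C X -> C Y.

Definition mod_all : subcat A := fun _ => True.

Inductive add M : subcat A :=
| add_nil X : iso X (rmod0 A) -> add M X
| add_cons X Y Z : summand X M -> add M Y -> iso Z (dsum X Y) -> add M Z.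

Definition Fac M : subcat A := fun X =>
  exists Y (f : 'Hom(Y, X)), [/\ add M Y, is_hom f & limg f = fullv].

Definition cok1 M : subcat A := fun X =>
  exists M1 M0 (f : 'Hom(M1, M0)) (g : 'Hom(M0, X)),
    [/\ add M M1 /\ add M M0, is_hom f /\ is_hom g,
        limg f = lker g & limg g = fullv].

(** ** Approximations *)

Definition right_approx C X M (f : 'Hom(X, M)) : Prop :=
  [/\ C X, is_hom f &
      forall X' (f' : 'Hom(X', M)), C X' -> is_hom f' ->
        exists2 h : 'Hom(X', X), is_hom h & (f \o h)%VF = f'].

Definition left_approx C M X (f : 'Hom(M, X)) : Prop :=
  [/\ C X, is_hom f &
      forall X' (f' : 'Hom(M, X')), C X' -> is_hom f' ->
        exists2 h : 'Hom(X, X'), is_hom h & (h \o f)%VF = f'].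

Definition right_minimal X M (f : 'Hom(X, M)) : Prop :=
  forall g : 'End(X), is_hom g -> (f \o g)%VF = f -> bijective g.

Definition functorially_finite C : Prop :=
  forall M, (exists X (f : 'Hom(X, M)), right_approx C f) /\
            (exists X (f : 'Hom(M, X)), left_approx C f).

(** ** Torsion classes *)

Definition conflation E X Y M (f : 'Hom(X, Y)) (g : 'Hom(Y, M)) : Prop :=
  [/\ E X, E Y, E M & ses f g].

Definition torsion_class_in E S : Prop :=
  [/\ iso_closed S, sub_subcat S E
    & forall X Y M (f : 'Hom(X, Y)) (g : 'Hom(Y, M)), conflation E f g ->
        (S X -> S M -> S Y) /\ (S Y -> S M)].

Definition torsion_class S : Prop := torsion_class_in mod_all S.

Definition twofold_torsion_class C : Prop :=
  exists2 T, torsion_class T & torsion_class_in T C.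

Definition T1 C : subcat A := fun X =>
  forall T, torsion_class T -> sub_subcat C T -> T X.

Definition f_tors T : Prop := torsion_class T /\ functorially_finite T.

(** ** Ext-progenerators *)

(* Ext^1(P, X) = 0, in Yoneda's description: every extension of P by X is
   equivalent to the split one. *)
Definition ext1_zero P X : Prop :=
  forall Y (f : 'Hom(X, Y)) (g : 'Hom(Y, P)), ses f g ->
    exists2 phi : 'Hom(Y, dsum X P), is_hom phi &
      (forall x, phi (f x) = (x, 0)) /\ (forall y, (phi y).2 = g y).

Definition ext_progenerator C P : Prop :=
  [/\ C P, forall X, C X -> ext1_zero P X
    & forall X, C X ->
        exists Y P' (f : 'Hom(Y, P')) (g : 'Hom(P', X)),
          add P P' /\ conflation C f g].

(* The basic Ext-progenerator P(C), unique up to isomorphism; it exists for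
   every functorially finite torsion class. *)
Definition progen C : rmod A :=
  epsilon (inhabits (rmod0 A)) (fun P => basic P /\ ext_progenerator C P).

Definition co_bongartz U : rmod A := progen (Fac U).

(** ** The sets in the diagram *)

Definition tau_rigid U : Prop := basic U /\ is_tau_rigid U.

Definition stau_tilt U : Prop := basic U /\ is_support_tau_tilting U.

Definition fL2_tors_star C : Prop :=
  [/\ twofold_torsion_class C, f_tors (T1 C)
    & forall X P (f : 'Hom(P, X)), C X ->
        right_approx (add (progen (T1 C))) f -> right_minimal f -> C P].

End Subcategories.

(* Main.v *)
(** A module M is tau-rigid iff Ext^1(M, Fac M) = 0.  Indeed, for a minimal
    presentation P1 -> P0 -> M, Hom(X, tau M) is dual to the cokernel of
    Hom(P0, X) -> Hom(P1, X), and if Ext^1(M, -) vanishes on the quotients of X,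
    then any P1 -> X is extended to P0 by successive approximation.  So Fac U is
    a functorially finite torsion class for U tau-rigid.  A functorially finite
    torsion class T has the Ext-progenerator T0 + T1, where A -> T0 is the minimal
    left T-approximation of the regular module and T1 is its cokernel.

    The link with support tau-tilting modules is a count of indecomposable
    summands.  On T = Fac M with M tau-rigid, hom(M_i, -) is the combination
    hom(P0, -) - hom(P1, -) of the hom(Q_j, -), with Q_j the indecomposable
    projectives, and radical maps show that the functions hom(M_i, -) are
    linearly independent on T, whence |M| <= |A|.  If M is an Ext-progenerator of
    T, a left approximation Q_j -> Y -> C -> 0 has Y and C in add M, so the
    hom(Q_j, -) are in turn combinations of the hom(M_i, -); they are independent
    when M is sincere, whence |M| = |A|.  For P = P(Fac U), sincerity is reached
    over A/<e> by taking e with Pe = 0 and <e> maximal. *)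

From HB Require Import structures.
From mathcomp Require Import all_boot all_algebra.
From Stdlib Require Import Classical ClassicalEpsilon.
From Stdlib Require Import FunctionalExtensionality PropExtensionality.
Require Import Defs.

Set Implicit Arguments.
Unset Strict Implicit.
Unset Printing Implicit Defensive.

Import GRing.Theory.
Local Open Scope ring_scope.

(** * Linear algebra and homomorphisms *)

(** The translate [tau] matters only up to [tau_rigidP]; everything after it speaks of Ext^1 and
    [Fac]. The obstacle is that support tau-tilting is defined by a number of summands, whereas cok1
    T = Fac T and the isomorphism of T with its completion both need T to be an Ext-progenerator of
    Fac T: the former because kernels of suitable covers by add T must stay in Fac T, the latter
    because basic Ext-progenerators are unique. The upper bound on the number of summands leads from
    the count to the progenerator; both bounds together lead back. Independence of the functions
    hom(M_i, -) is tested on pairs X, Y of the torsion class that are told apart by exactly one of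
    them, so that a rank over the rationals takes the place of Grothendieck groups. Idempotence of e
    makes the modules killed by e closed under extensions, and hence Ext^1 over A and over A/<e>
    agree on them. *)

Lemma nat_max (P : nat -> Prop) b :
  (exists n, P n) -> (forall n, P n -> (n <= b)%N) ->
  exists n, P n /\ forall m, P m -> (m <= n)%N.
Proof.
case=> n Pn Pb; suff: forall k n, P n -> (b <= n + k)%N ->
    exists n, P n /\ forall m, P m -> (m <= n)%N.
  by move/(_ b n Pn); apply; exact: leq_addl.
elim=> [|k IH] {Pn}n Pn len.
  by exists n; split=> // m /Pb lem; apply: leq_trans lem _; rewrite addn0 in len.
have [mx|/not_all_ex_not [m]] := classic (forall m, P m -> (m <= n)%N).
  by exists n.
case/(imply_to_and (P m)) => Pm /negP; rewrite -ltnNge => lnm.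
by apply: IH Pm _; apply: leq_trans len _; rewrite addnS -addSn leq_add2r.
Qed.

Lemma nat_min (P : nat -> Prop) :
  (exists n, P n) -> exists n, P n /\ forall m, P m -> (n <= m)%N.
Proof.
case=> n; elim/ltn_ind: n => n IH Pn.
have [mn|/not_all_ex_not [m]] := classic (forall m, P m -> (n <= m)%N).
  by exists n.
by case/(imply_to_and (P m)) => Pm /negP; rewrite -ltnNge => /IH; apply.
Qed.

Section LinearAlgebra.
Variable K : fieldType.
Implicit Types U V W : vectType K.

Lemma linfun_linearE V W (f : V -> W) : linear f -> linfun f =1 f.
Proof.
move=> fL; pose h := GRing.isLinear.Build K V W *:%R f fL.
pose f' : {linear V -> W} := HB.pack f h.
exact: (lfunE f').
Qed.

Lemma lfun_of_linear V W (f : V -> W) :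
  linear f -> exists g : 'Hom(V, W), forall v, g v = f v.
Proof.
by move=> fL; exists (linfun f); apply: linfun_linearE.
Qed.

Lemma limg_fullP V W (f : 'Hom(V, W)) :
  limg f = fullv <-> forall w, exists v, f v = w.
Proof.
split=> [fS w | fS].
  have: w \in limg f by rewrite fS memvf.
  by case/memv_imgP=> v _ ->; exists v.
apply/eqP; rewrite eqEsubv subvf; apply/subvP=> w _.
by have [v <-] := fS w; rewrite memv_img ?memvf.
Qed.

Lemma lker0_injP V W (f : 'Hom(V, W)) : lker f = 0%VS <-> injective f.
Proof. by split=> [/eqP/lker0P | /lker0P/eqP]. Qed.

Lemma lker0_eq0 V W (f : 'Hom(V, W)) :
  (forall v, f v = 0 -> v = 0) -> lker f = 0%VS.
Proof.
move=> f0; apply/eqP; rewrite -subv0; apply/subvP=> v.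
by rewrite memv_ker memv0 => /eqP/f0/eqP.
Qed.

Lemma lker0_endo_bij V (f : 'End(V)) : lker f = 0%VS -> bijective f.
Proof.
move=> /eqP f0; exists (f^-1)%VF; first exact: lker0_lfunK.
exact: lker0_lfunVK.
Qed.

Lemma limg_full_endo_bij V (f : 'End(V)) : limg f = fullv -> bijective f.
Proof.
move=> fS; apply: lker0_endo_bij; apply/eqP; rewrite -dimv_eq0.
have := limg_ker_dim f fullv; rewrite fS capfv => /eqP.
by rewrite -[X in _ == X]add0n eqn_add2r.
Qed.

Lemma lker0_dim_bij V W (f : 'Hom(V, W)) :
  lker f = 0%VS -> (dim W <= dim V)%N -> bijective f.
Proof.
move=> f0 dWV.
have fS : limg f = fullv.
  apply/eqP; rewrite eqEdim subvf limg_dim_eq ?f0 ?capv0 //.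
  by rewrite !dimvf.
exists (f^-1)%VF => [|w]; first by apply: lker0_lfunK; apply/eqP.
by apply: limg_lfunVK; rewrite fS memvf.
Qed.

Lemma lker0_dim_leq V W (f : 'Hom(V, W)) : lker f = 0%VS -> (dim V <= dim W)%N.
Proof.
move=> f0; rewrite -[X in (X <= _)%N]dimvf -[X in (_ <= X)%N]dimvf.
by rewrite -(limg_dim_eq (f := f)) ?f0 ?capv0 // dimvS ?subvf.
Qed.

Lemma limg_full_dim_leq V W (f : 'Hom(V, W)) : limg f = fullv -> (dim W <= dim V)%N.
Proof.
move=> fS; rewrite -[X in (X <= _)%N]dimvf -[X in (_ <= X)%N]dimvf -fS.
by rewrite -(limg_ker_dim f fullv) leq_addl.
Qed.

Lemma limg_full_dim_bij V W (f : 'Hom(V, W)) :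
  limg f = fullv -> (dim V <= dim W)%N -> bijective f.
Proof.
move=> fS dVW; apply: lker0_dim_bij; last exact: limg_full_dim_leq fS.
apply/eqP; rewrite -dimv_eq0; have := limg_ker_dim f fullv.
rewrite fS capfv !dimvf => dE.
have := limg_full_dim_leq fS; rewrite -dE => _.
by move: dVW; rewrite -dE -[X in (_ <= X)%N]add0n leq_add2r leqn0.
Qed.

Lemma bij_lker0 V W (f : 'Hom(V, W)) : bijective f -> lker f = 0%VS.
Proof. by move=> /bij_inj/lker0_injP. Qed.

Lemma bij_limg V W (f : 'Hom(V, W)) : bijective f -> limg f = fullv.
Proof. by case=> g _ gK; apply/limg_fullP=> w; exists (g w). Qed.

(** A subspace of maximal dimension among those contained in [P] exhausts [P], since otherwise a
    line could be added to it. This turns a condition in Prop into a [vspace]. *)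
Lemma vspace_of_pred V (P : V -> Prop) :
  P 0 -> (forall k u v, P u -> P v -> P (k *: u + v)) ->
  exists W : {vspace V}, forall v, v \in W <-> P v.
Proof.
move=> P0 PL.
pose S n := exists2 W : {vspace V}, \dim W = n & forall v, v \in W -> P v.
have [|_ [W <- _]|n [[W dW WP] nmax]] := @nat_max S (\dim {:V}).
- by exists 0%N, 0%VS => [|v]; rewrite ?dimv0 // memv0 => /eqP->.
- exact: dimvS (subvf W).
exists W => v; split=> [/WP // | Pv].
have: (\dim (<[v]> + W) <= n)%N.
  apply: nmax; exists (<[v]> + W)%VS => // x /memv_addP[_ /vlineP[k ->]].
  by case=> w /WP Pw ->; apply: PL.
rewrite -dW => dle; have/eqP-> : W == (<[v]> + W)%VS.
  by rewrite eqEdim addvSr.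
by rewrite memvE addvSl.
Qed.

(** The complement of [W] serves as the quotient, so the projection comes with a linear section [s];
    module actions and products are transported to quotients along [s]. *)
Lemma quotient_space V (W : {vspace V}) :
  exists (Q : vectType K) (p : 'Hom(V, Q)) (s : 'Hom(Q, V)),
    (forall q, p (s q) = q) /\ forall v, p v = 0 <-> v \in W.
Proof.
have vvL (U : {vspace V}) : linear (@vsval _ _ U) by move=> k u v; rewrite linearP.
have [s sE] := lfun_of_linear (vvL (W^C)%VS).
have piL : linear (fun v => vsproj (W^C)%VS (v - projv W v)).
  move=> k u v; rewrite -linearP; congr vsproj.
  by rewrite linearP opprD addrACA scalerBr.
have [p pE] := lfun_of_linear piL.
exists (subvs_of (W^C)%VS : vectType K), p, s; split=> [q | v].
  rewrite pE sE; have -> : projv W (vsval q) = 0.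
    by apply/eqP; rewrite -memv_ker lker_proj subvsP.
  by rewrite subr0 vsvalK.
rewrite pE; split=> [/(congr1 (@vsval _ _ _)) | vW].
  rewrite vsprojK ?memv_projC // => /eqP; rewrite [vsval 0]/= subr_eq0.
  by move=> /eqP->; rewrite memv_proj.
by rewrite projv_id // subrr linear0.
Qed.

Lemma separating_functional V (W : {vspace V}) v : v \notin W ->
  exists2 b : 'Hom(V, K^o), b v != 0 & forall w, w \in W -> b w = 0.
Proof.
move=> vW; have [Q [p [s [_ p0]]]] := quotient_space W.
have pv : p v != 0 by apply/eqP => /p0; apply/negP.
have [i ci] : exists i, coord (vbasis {:Q}) i (p v) != 0.
  apply: NNPP => nex; case/eqP: pv.
  rewrite (coord_vbasis (memvf (p v))) big1 // => i _.
  have [->|ci] := eqVneq (coord (vbasis {:Q}) i (p v)) 0; first by rewrite scale0r.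
  by case: nex; exists i.
have [|b bE] := @lfun_of_linear V K^o (fun w => coord (vbasis {:Q}) i (p w)).
  by move=> k u w; rewrite !linearP.
by exists b => [|w /p0 pw]; rewrite bE // pw linear0.
Qed.

End LinearAlgebra.

(** * Submodules, quotients, short exact sequences and direct sums of modules *)

Section Homs.
Variables (K : fieldType) (A : fdalg K).
Implicit Types M N X Y Z P U W : rmod A.

Lemma mact0l M (a : A) : (0 : M) *> a = 0.
Proof. by rewrite -{1}(scale0r (0 : M)) mact_scalel scale0r. Qed.

Lemma mact0r M (v : M) : v *> (0 : A) = 0.
Proof. by rewrite -{1}(scale0r (0 : A)) mact_scaler scale0r. Qed.

Lemma mactN M (v : M) (a : A) : (- v) *> a = - (v *> a).
Proof. by rewrite -scaleN1r mact_scalel scaleN1r. Qed.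

Lemma mactB M (u v : M) (a : A) : (u - v) *> a = u *> a - v *> a.
Proof. by rewrite mact_addl mactN. Qed.

Lemma mact_sum M I (r : seq I) (Q : pred I) (F : I -> M) (a : A) :
  (\sum_(i <- r | Q i) F i) *> a = \sum_(i <- r | Q i) (F i *> a).
Proof.
by apply: (big_morph (fun v => v *> a)) => [u v|]; rewrite ?mact_addl ?mact0l.
Qed.

Lemma hom_id M : @is_hom K A M M \1%VF.
Proof. by move=> v a; rewrite !id_lfunE. Qed.

Lemma hom_comp M N P (f : 'Hom(M, N)) (g : 'Hom(N, P)) :
  is_hom f -> is_hom g -> is_hom (g \o f)%VF.
Proof. by move=> fH gH v a; rewrite !comp_lfunE fH gH. Qed.

Lemma hom_0 M N : @is_hom K A M N 0.
Proof. by move=> v a; rewrite !zero_lfunE mact0l. Qed.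

Lemma hom_add M N (f g : 'Hom(M, N)) : is_hom f -> is_hom g -> is_hom (f + g).
Proof. by move=> fH gH v a; rewrite !add_lfunE fH gH mact_addl. Qed.

Lemma hom_opp M N (f : 'Hom(M, N)) : is_hom f -> is_hom (- f).
Proof. by move=> fH v a; rewrite !opp_lfunE fH mactN. Qed.

Lemma hom_sub M N (f g : 'Hom(M, N)) : is_hom f -> is_hom g -> is_hom (f - g).
Proof. by move=> fH gH; apply: hom_add => //; apply: hom_opp. Qed.

Lemma hom_scale M N k (f : 'Hom(M, N)) : is_hom f -> is_hom (k *: f).
Proof. by move=> fH v a; rewrite !scale_lfunE fH mact_scalel. Qed.

Lemma hom_sum M N I (r : seq I) (Q : pred I) (F : I -> 'Hom(M, N)) :
  (forall i, is_hom (F i)) -> is_hom (\sum_(i <- r | Q i) F i).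
Proof.
move=> FH; elim/big_ind: _ => [|f g fH gH|i _]; [exact: hom_0 | | exact: FH].
exact: hom_add.
Qed.

Lemma hom_inv M N (f : 'Hom(M, N)) : is_hom f -> bijective f ->
  exists g : 'Hom(N, M), [/\ is_hom g, cancel f g & cancel g f].
Proof.
move=> fH fB; exists (f^-1)%VF; have f0 := bij_lker0 fB.
have fK : cancel f (f^-1)%VF by apply: lker0_lfunK; apply/eqP.
have gK : cancel (f^-1)%VF f.
  by move=> w; apply: limg_lfunVK; rewrite bij_limg ?memvf.
by split=> // w a; apply: (can_inj fK); rewrite fH !gK.
Qed.

Lemma submodule M (V : {vspace M}) :
  (forall v (a : A), v \in V -> v *> a \in V) ->
  exists (S : rmod A) (i : 'Hom(S, M)), [/\ is_hom i, lker i = 0%VS & limg i = V].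
Proof.
move=> VA; have vvL : linear (@vsval _ _ V) by move=> k u v; rewrite linearP.
have [i iE] := lfun_of_linear vvL.
pose act (u : subvs_of V) (a : A) := vsproj V (vsval u *> a).
have actE u a : vsval (act u a) = vsval u *> a by rewrite vsprojK ?VA ?subvsP.
have actDl u v a : act (u + v) a = act u a + act v a.
  by apply/val_inj; rewrite /= !actE mact_addl.
have actDr u a b : act u (a + b) = act u a + act u b.
  by apply/val_inj; rewrite /= !actE mact_addr.
have actZl k u a : act (k *: u) a = k *: act u a.
  by apply/val_inj; rewrite /= !actE mact_scalel.
have actZr k u a : act u (k *: a) = k *: act u a.
  by apply/val_inj; rewrite /= !actE mact_scaler.
have actA u a b : act u (a ** b) = act (act u a) b.
  by apply/val_inj; rewrite /= !actE mact_assoc.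
have act1 u : act u aone = u by apply/val_inj; rewrite /= !actE mact_1.
pose S := @RMod K A (subvs_of V) act actDl actDr actZl actZr actA act1.
exists S, i; split.
- by move=> u a; rewrite !iE actE.
- by apply/lker0_injP=> u v; rewrite !iE => /val_inj.
- apply/vspaceP=> v; apply/memv_imgP/idP=> [[u _ ->] | vV].
    by rewrite iE subvsP.
  by exists (vsproj V v); rewrite ?memvf // iE vsprojK.
Qed.

Lemma quotient_module M (V : {vspace M}) :
  (forall v (a : A), v \in V -> v *> a \in V) ->
  exists (Q : rmod A) (p : 'Hom(M, Q)), [/\ is_hom p, limg p = fullv & lker p = V].
Proof.
move=> VA; have [Q [p [s [sK p0]]]] := quotient_space V.
have kerp v : p v = 0 -> v \in V by move/p0.
have pact v a : p (s (p v) *> a) = p (v *> a).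
  apply/eqP; rewrite -subr_eq0 -linearB -mactB; apply/eqP/p0/VA/p0.
  by rewrite linearB /= sK subrr.
pose act q (a : A) := p (s q *> a).
have actDl u v a : act (u + v) a = act u a + act v a.
  by rewrite /act linearD mact_addl linearD.
have actDr u a b : act u (a + b) = act u a + act u b.
  by rewrite /act mact_addr linearD.
have actZl k u a : act (k *: u) a = k *: act u a.
  by rewrite /act linearZ mact_scalel linearZ.
have actZr k u a : act u (k *: a) = k *: act u a.
  by rewrite /act mact_scaler linearZ.
have actA u a b : act u (a ** b) = act (act u a) b.
  by rewrite /act pact mact_assoc.
have act1 u : act u aone = u by rewrite /act mact_1 sK.
pose R := @RMod K A Q act actDl actDr actZl actZr actA act1.
exists R, p; split.
- by move=> v a; apply/esym/pact.
- by apply/limg_fullP=> q; exists (s q); rewrite sK.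
- apply/vspaceP=> v; rewrite memv_ker.
  by apply/eqP/idP=> [/p0 | /p0].
Qed.

Lemma hom_factor X Y Z (p : 'Hom(X, Y)) (g : 'Hom(X, Z)) :
  is_hom p -> is_hom g -> limg p = fullv -> (forall x, p x = 0 -> g x = 0) ->
  exists2 h : 'Hom(Y, Z), is_hom h & forall x, h (p x) = g x.
Proof.
move=> pH gH pS pg; have pK y : p (p^-1%VF y) = y.
  by apply: limg_lfunVK; rewrite pS memvf.
have eg x y : p x = p y -> g x = g y.
  move=> /eqP; rewrite -subr_eq0 -linearB => /eqP/pg/eqP.
  by rewrite linearB subr_eq0 => /eqP.
exists (g \o p^-1)%VF => [y a | x]; rewrite !comp_lfunE; last by apply: eg; rewrite pK.
by rewrite -gH; apply: eg; rewrite pH !pK.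
Qed.

Lemma hom_corestrict X Y Z (i : 'Hom(X, Y)) (g : 'Hom(Z, Y)) :
  is_hom i -> is_hom g -> lker i = 0%VS -> (limg g <= limg i)%VS ->
  exists2 h : 'Hom(Z, X), is_hom h & forall z, i (h z) = g z.
Proof.
move=> iH gH /lker0_injP iI gi.
have iK z : i (i^-1%VF (g z)) = g z.
  by apply: limg_lfunVK; rewrite (subvP gi) // memv_img ?memvf.
exists (i^-1 \o g)%VF => [z a | z]; rewrite !comp_lfunE //.
by apply: iI; rewrite iH !iK gH.
Qed.

Lemma limg_stable M N (f : 'Hom(M, N)) : is_hom f ->
  forall v (a : A), v \in limg f -> v *> a \in limg f.
Proof. by move=> fH _ a /memv_imgP[u _ ->]; rewrite -fH memv_img ?memvf. Qed.

Lemma lker_stable M N (f : 'Hom(M, N)) : is_hom f ->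
  forall v (a : A), v \in lker f -> v *> a \in lker f.
Proof. by move=> fH v a; rewrite !memv_ker fH => /eqP->; rewrite mact0l. Qed.

Lemma limg_comp_stable M N (f : 'Hom(M, N)) (V : {vspace M}) : is_hom f ->
  (forall v (a : A), v \in V -> v *> a \in V) ->
  forall v (a : A), v \in (f @: V)%VS -> v *> a \in (f @: V)%VS.
Proof. by move=> fH VA _ a /memv_imgP[u uV ->]; rewrite -fH memv_img ?VA. Qed.

Lemma kernel_ses Y Z (g : 'Hom(Y, Z)) : is_hom g -> limg g = fullv ->
  exists (X : rmod A) (f : 'Hom(X, Y)), ses f g.
Proof.
move=> gH gS; have [X [f [fH f0 fI]]] := submodule (lker_stable gH).
by exists X, f.
Qed.

Lemma image_factor X Y (f : 'Hom(X, Y)) : is_hom f ->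
  exists (Z : rmod A) (p : 'Hom(X, Z)) (i : 'Hom(Z, Y)),
    [/\ is_hom p, is_hom i, limg p = fullv, lker i = 0%VS
      & limg i = limg f /\ forall x, i (p x) = f x].
Proof.
move=> fH; have [Z [i [iH i0 iI]]] := submodule (limg_stable fH).
have [|p pH pE] := @hom_corestrict _ _ _ i f iH fH i0; first by rewrite iI.
exists Z, p, i; split=> //; apply/limg_fullP=> z.
have: i z \in limg f by rewrite -iI memv_img ?memvf.
case/memv_imgP=> x _ e; exists x; apply: (proj1 (lker0_injP i) i0).
by rewrite pE.
Qed.

Lemma ses_comp0 X Y Z (f : 'Hom(X, Y)) (g : 'Hom(Y, Z)) x :
  ses f g -> g (f x) = 0.
Proof.
by case=> _ _ _ e _; apply/eqP; rewrite -memv_ker -e memv_img ?memvf.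
Qed.

Lemma ses_lift X Y Z (f : 'Hom(X, Y)) (g : 'Hom(Y, Z)) W (h : 'Hom(W, Y)) :
  ses f g -> is_hom h -> (forall w, g (h w) = 0) ->
  exists2 l : 'Hom(W, X), is_hom l & forall w, f (l w) = h w.
Proof.
case=> fH gH f0 e _ hH gh; apply: hom_corestrict => //.
by rewrite e; apply/subvP=> _ /memv_imgP[w _ ->]; rewrite memv_ker gh.
Qed.

Lemma ses_ker X Y Z (f : 'Hom(X, Y)) (g : 'Hom(Y, Z)) y :
  ses f g -> g y = 0 -> exists x, f x = y.
Proof.
case=> _ _ _ e _ gy; have: y \in limg f by rewrite e memv_ker gy.
by case/memv_imgP=> x _ ->; exists x.
Qed.

Lemma ses_inj X Y Z (f : 'Hom(X, Y)) (g : 'Hom(Y, Z)) : ses f g -> injective f.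
Proof. by case=> _ _ /lker0_injP. Qed.

Lemma ses_surj X Y Z (f : 'Hom(X, Y)) (g : 'Hom(Y, Z)) z :
  ses f g -> exists y, g y = z.
Proof. by case=> _ _ _ _ /limg_fullP/(_ z). Qed.

Lemma iso_refl M : iso M M.
Proof. by exists \1%VF; [exact: hom_id | exists id => v; rewrite id_lfunE]. Qed.

Lemma iso_sym M N : iso M N -> iso N M.
Proof.
by case=> f fH /(hom_inv fH)[g [gH fK gK]]; exists g => //; exists f.
Qed.

Lemma iso_trans M N P : iso M N -> iso N P -> iso M P.
Proof.
case=> f fH /(hom_inv fH)[f' [f'H fK f'K]] [g gH /(hom_inv gH)[g' [g'H gK g'K]]].
exists (g \o f)%VF; first exact: hom_comp.
by exists (f' \o g')%VF => v; rewrite !comp_lfunE ?gK ?fK ?f'K ?g'K.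
Qed.

Lemma iso_dim M N : iso M N -> dim M = dim N.
Proof.
case=> f _ fB; apply/eqP; rewrite eqn_leq (lker0_dim_leq (bij_lker0 fB)).
by rewrite (limg_full_dim_leq (bij_limg fB)).
Qed.

Lemma dim0_iso M : dim M = 0%N -> iso M (rmod0 A).
Proof.
move=> d0; exists 0; first exact: hom_0.
apply: lker0_dim_bij; last by rewrite d0.
apply/eqP; rewrite -dimv_eq0 -leqn0 -d0 -dimvf; exact: dimvS (subvf _).
Qed.

Lemma iso0_dim M : iso M (rmod0 A) -> dim M = 0%N.
Proof. by move/iso_dim=> ->; rewrite /dim. Qed.

Lemma dim0_eq0 M (v : M) : dim M = 0%N -> v = 0.
Proof.
move=> d0; apply/eqP; rewrite -memv0.
have/eqP <- : (fullv : {vspace M}) == 0%VS by rewrite -dimv_eq0 dimvf d0.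
exact: memvf.
Qed.

Lemma dsum_maps M N :
  exists (i : 'Hom(M, dsum M N)) (j : 'Hom(N, dsum M N))
         (p : 'Hom(dsum M N, M)) (q : 'Hom(dsum M N, N)),
    [/\ is_hom i /\ is_hom j, is_hom p /\ is_hom q,
        (forall x, i x = (x, 0)) /\ (forall y, j y = (0, y)) &
        (forall z, p z = z.1) /\ (forall z, q z = z.2)].
Proof.
have [|i iE] := @lfun_of_linear _ M (dsum M N) (fun x => (x, 0)).
  by move=> k u v; congr (_, _); rewrite /= ?scaler0 ?addr0.
have [|j jE] := @lfun_of_linear _ N (dsum M N) (fun x => (0, x)).
  by move=> k u v; congr (_, _); rewrite /= ?scaler0 ?addr0.
have [|p pE] := @lfun_of_linear _ (dsum M N) M (fun z => z.1) => //.
have [|q qE] := @lfun_of_linear _ (dsum M N) N (fun z => z.2) => //.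
exists i, j, p, q; split=> //; split=> v a.
- by rewrite !iE /= mact0l.
- by rewrite !jE /= mact0l.
- by rewrite !pE.
- by rewrite !qE.
Qed.

Lemma hom_row M N X (f : 'Hom(M, X)) (g : 'Hom(N, X)) : is_hom f -> is_hom g ->
  exists2 h : 'Hom(dsum M N, X), is_hom h & forall z, h z = f z.1 + g z.2.
Proof.
have [i [j [p [q [_ [pH qH] _ [pE qE]]]]]] := dsum_maps M N.
move=> fH gH; exists ((f \o p)%VF + (g \o q)%VF).
  by apply: hom_add; apply: hom_comp.
by move=> z; rewrite add_lfunE !comp_lfunE pE qE.
Qed.

Lemma hom_col M N X (f : 'Hom(X, M)) (g : 'Hom(X, N)) : is_hom f -> is_hom g ->
  exists2 h : 'Hom(X, dsum M N), is_hom h & forall x, h x = (f x, g x).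
Proof.
have [i [j [p [q [[iH jH] _ [iE jE] _]]]]] := dsum_maps M N.
move=> fH gH; exists ((i \o f)%VF + (j \o g)%VF).
  by apply: hom_add; apply: hom_comp.
move=> z; rewrite add_lfunE !comp_lfunE iE jE.
by congr (_, _); rewrite /= ?addr0 ?add0r.
Qed.

Lemma dim_dsum M N : dim (dsum M N) = (dim M + dim N)%N.
Proof. by []. Qed.

Lemma retract_split X M (f : 'Hom(X, M)) (g : 'Hom(M, X)) :
  is_hom f -> is_hom g -> (forall x, g (f x) = x) ->
  exists (Z : rmod A) (j : 'Hom(Z, M)), ses j g /\ iso M (dsum X Z).
Proof.
move=> fH gH gf.
have gS : limg g = fullv by apply/limg_fullP=> x; exists (f x).
have [Z [j js]] := kernel_ses gH gS; exists Z, j; split=> //.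
have [jH _ j0 jI _] := js.
have [h hH hE] := hom_row fH jH.
apply: iso_sym; exists h => //; apply: lker0_dim_bij.
  apply: lker0_eq0 => -[x z]; rewrite hE /= => e.
  have x0 : x = 0.
    move/(congr1 g): e; rewrite linearD /= gf (ses_comp0 _ js) addr0.
    by rewrite linear0.
  have := e; rewrite x0 linear0 add0r => jz.
  by congr (_, _); apply: (ses_inj js); rewrite jz linear0.
rewrite dim_dsum -[dim M]dimvf -(limg_ker_dim g fullv) gS capfv -jI.
by rewrite limg_dim_eq ?j0 ?capv0 // !dimvf addnC.
Qed.

(** Summands are handled below as retracts, without naming a complement. *)
Lemma summandP X M : summand X M <->
  exists (f : 'Hom(X, M)) (g : 'Hom(M, X)),
    [/\ is_hom f, is_hom g & forall x, g (f x) = x].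
Proof.
split=> [[Y [h hH hB]] | [f [g [fH gH gf]]]].
  have [h' [h'H hK h'K]] := hom_inv hH hB.
  have [i [j [p [q [[iH jH] [pH qH] [iE jE] [pE qE]]]]]] := dsum_maps X Y.
  exists (h' \o i)%VF, (p \o h)%VF; split; try exact: hom_comp.
  by move=> x; rewrite !comp_lfunE h'K pE iE.
by have [Z [j [_ MXZ]]] := retract_split fH gH gf; exists Z.
Qed.

Lemma summand_dim X M : summand X M -> (dim X <= dim M)%N.
Proof. by case=> Y /iso_dim->; rewrite dim_dsum leq_addr. Qed.

Lemma iso_summand M N : iso M N -> summand M N.
Proof.
by case=> f fH /(hom_inv fH)[g [gH fK gK]]; apply/summandP; exists f, g.
Qed.

Lemma summand_trans X Y Z : summand X Y -> summand Y Z -> summand X Z.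
Proof.
move=> /summandP[f [g [fH gH gf]]] /summandP[f' [g' [f'H g'H gf']]].
apply/summandP; exists (f' \o f)%VF, (g \o g')%VF; split; try exact: hom_comp.
by move=> x; rewrite !comp_lfunE gf' gf.
Qed.

Lemma summand_dim_iso X M : summand X M -> (dim M <= dim X)%N -> iso X M.
Proof.
move=> /summandP[f [g [fH gH gf]]] dMX; exists f => //.
by apply: lker0_dim_bij => //; apply/lker0_injP; apply: can_inj gf.
Qed.

Lemma summand_dsuml M N : summand M (dsum M N).
Proof. by exists N; apply: iso_refl. Qed.

Lemma dsumC M N : iso (dsum M N) (dsum N M).
Proof.
have [i [j [p [q [_ [pH qH] _ [pE qE]]]]]] := dsum_maps M N.
have [h hH hE] := hom_col qH pH; exists h => //.
apply: lker0_dim_bij; last by rewrite !dim_dsum addnC.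
apply: lker0_eq0 => -[x y]; rewrite hE pE qE /= => -[-> ->] //.
Qed.

Lemma summand_dsumr M N : summand N (dsum M N).
Proof. exact: summand_trans (summand_dsuml N M) (iso_summand (dsumC _ _)). Qed.

Lemma dsum_summand M N M' N' : summand M M' -> summand N N' ->
  summand (dsum M N) (dsum M' N').
Proof.
move=> /summandP[f [g [fH gH gf]]] /summandP[f' [g' [f'H g'H gf']]].
have [i [j [p [q [[iH jH] [pH qH] [iE jE] [pE qE]]]]]] := dsum_maps M N.
have [i' [j' [p' [q' [_ [p'H q'H] _ [p'E q'E]]]]]] := dsum_maps M' N'.
have [h hH hE] := hom_col (hom_comp pH fH) (hom_comp qH f'H).
have [k kH kE] := hom_col (hom_comp p'H gH) (hom_comp q'H g'H).
apply/summandP; exists h, k; split=> // -[x y].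
by rewrite kE !comp_lfunE p'E q'E hE !comp_lfunE pE qE /= gf gf'.
Qed.

Lemma dsum_iso M N M' N' : iso M M' -> iso N N' -> iso (dsum M N) (dsum M' N').
Proof.
move=> iM iN; apply: summand_dim_iso.
  by apply: dsum_summand; apply: iso_summand.
by rewrite !dim_dsum (iso_dim iM) (iso_dim iN).
Qed.

Lemma dsumA M N P : iso (dsum M (dsum N P)) (dsum (dsum M N) P).
Proof.
have [i [j [p [q [_ [pH qH] _ [pE qE]]]]]] := dsum_maps M (dsum N P).
have [i' [j' [p' [q' [_ [p'H q'H] _ [p'E q'E]]]]]] := dsum_maps N P.
have [h hH hE] := hom_col pH (hom_comp qH p'H).
have [k kH kE] := hom_col hH (hom_comp qH q'H).
exists k => //; apply: lker0_dim_bij; last by rewrite !dim_dsum addnA.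
apply: lker0_eq0 => -[x [y z]].
by rewrite kE hE !comp_lfunE pE qE p'E q'E /= => -[-> -> ->].
Qed.

End Homs.

(** * Krull-Schmidt theory *)

Section KrullSchmidt.
Variables (K : fieldType) (A : fdalg K).
Implicit Types M N X Y Z P U W : rmod A.

Lemma hom_iter M (u : 'End(M)) n : is_hom u ->
  exists2 w : 'End(M), is_hom w & forall v, w v = iter n u v.
Proof.
move=> uH; elim: n => [|n [w wH wE]].
  by exists \1%VF => [|v]; [exact: hom_id | rewrite id_lfunE].
by exists (u \o w)%VF => [|v]; [exact: hom_comp | rewrite comp_lfunE wE].
Qed.

(** Fitting's lemma. Among the positive powers of [u] one is taken whose kernel has maximal
    dimension; it is injective on its image [Z], which therefore splits off. The exponent is written
    [n.+1] so that every element of [Z] is visibly in the image of [u]. *)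
Lemma fitting M (u : 'End(M)) : is_hom u ->
  exists n Z (i : 'Hom(Z, M)) (r : 'Hom(M, Z)),
    [/\ is_hom i, is_hom r, forall z, r (i z) = z
      & (forall v, exists z, iter n.+1 u v = i z) /\
        (forall z, exists v, i z = iter n.+1 u v)].
Proof.
move=> uH.
pose S d := exists n (w : 'End(M)),
  (forall v, w v = iter n.+1 u v) /\ \dim (lker w) = d.
have [||d [[n [w [wE dw]]] dmax]] := @nat_max S (\dim {:M}).
- by exists (\dim (lker u)), 0%N, u.
- by move=> _ [n [w [_ <-]]]; apply: dimvS (subvf _).
have [w1 w1H w1E] := hom_iter n.+1 uH.
have [w2 w2H w2E] := hom_iter (n.+1 + n.+1) uH.
have wH : is_hom w by move=> v a; rewrite !wE -!w1E w1H.
have ww v : w (w v) = 0 -> w v = 0.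
  have e : lker w = lker w2.
    apply/eqP; rewrite eqEdim; apply/andP; split.
      apply/subvP=> x; rewrite !memv_ker w2E iterD -!wE => /eqP->.
      by rewrite linear0.
    by rewrite dw; apply: dmax; exists (n + n.+1)%N, w2; split.
  move/eqP; rewrite !wE -iterD -w2E -memv_ker -e memv_ker wE.
  by move/eqP.
have [Z [p [i [pH iH pS i0 [iI ip]]]]] := image_factor wH.
(* [q] is the restriction of [w] to its image; its inverse turns [p] into a retraction of [i]. *)
have [|q qH qE] := hom_corestrict iH (hom_comp iH wH) i0.
  by rewrite iI limg_comp; apply: limgS; apply: subvf.
have iinj := proj1 (lker0_injP i) i0.
have iw z : exists v, i z = w v.
  have: i z \in limg w by rewrite -iI memv_img ?memvf.
  by case/memv_imgP=> x _ ->; exists x.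
have qB : bijective q.
  apply/lker0_endo_bij/lker0_eq0 => z qz; apply: iinj; rewrite linear0.
  have [x e] := iw z; rewrite e ww // -e.
  by have := qE z; rewrite qz linear0 comp_lfunE.
have [q' [q'H qK q'K]] := hom_inv qH qB.
exists n, Z, i, (q' \o p)%VF; split=> // [|z|].
- exact: hom_comp.
- rewrite comp_lfunE; have -> : p (i z) = q z; last by rewrite qK.
  by apply: iinj; rewrite ip qE comp_lfunE.
- split=> [v|z]; first by exists (p v); rewrite ip wE.
  by have [x e] := iw z; exists x; rewrite -wE.
Qed.

Lemma indec_nonzero M : indecomposable M -> (0 < dim M)%N.
Proof. by case=> M0 _; rewrite lt0n; apply/eqP=> /dim0_iso. Qed.

Lemma indec_summand_iso X M : indecomposable M -> (0 < dim X)%N ->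
  summand X M -> iso X M.
Proof.
move=> [_ Mdec] X0 XM; apply: summand_dim_iso => //.
case: XM => Y MXY; case: (Mdec _ _ MXY) => [/iso0_dim X0' | /iso0_dim Y0].
  by rewrite X0' in X0.
by rewrite (iso_dim MXY) dim_dsum Y0 addn0.
Qed.

Lemma indec_endo M (u : 'End(M)) : indecomposable M -> is_hom u ->
  bijective u \/ exists n, forall v, iter n u v = 0.
Proof.
move=> Mi uH; have [n [Z [i [r [iH rH ri [iterZ Ziter]]]]]] := fitting uH.
have Zsum : summand Z M by apply/summandP; exists i, r.
have [Z0 | Z0] := posnP (dim Z).
  right; exists n.+1 => v; have [z ->] := iterZ v.
  by rewrite (dim0_eq0 z Z0) linear0.
left; apply/limg_full_endo_bij/limg_fullP => v.
have [h hH hB] := indec_summand_iso Mi Z0 Zsum.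
have dZ := iso_dim (ex_intro2 _ _ h hH hB).
have iB : bijective i.
  by apply: lker0_dim_bij; rewrite ?dZ //; apply/lker0_injP; apply: can_inj ri.
have [i' _ i'K] := iB; have [x e] := Ziter (i' v).
by exists (iter n u x); rewrite -[RHS]i'K e.
Qed.

Lemma indec_local M (u v : 'End(M)) : indecomposable M -> is_hom u -> is_hom v ->
  bijective (u + v) -> bijective u \/ bijective v.
Proof.
move=> Mi uH vH uvB; have [s [sH sK s'K]] := hom_inv (hom_add uH vH) uvB.
have [suB | [n nil]] := indec_endo Mi (hom_comp uH sH).
  left; apply/lker0_endo_bij/lker0_eq0 => x ux; apply: (bij_inj suB).
  by rewrite comp_lfunE ux !linear0.
(* A vector killed by [v] is fixed by the nilpotent map s u, hence is zero. *)
right; apply/lker0_endo_bij/lker0_eq0 => x vx.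
have sux : (s \o u)%VF x = x.
  by have := sK x; rewrite add_lfunE vx addr0 comp_lfunE.
by rewrite -(nil x); elim: n {nil} => //= n <-; rewrite sux.
Qed.

Lemma indec_local_sum M I (r : seq I) (F : I -> 'End(M)) : indecomposable M ->
  (forall i, is_hom (F i)) -> bijective (\sum_(i <- r) F i) ->
  exists i, bijective (F i).
Proof.
move=> Mi FH; elim: r => [|i r IH]; last first.
  rewrite big_cons => /(indec_local Mi (FH i) (hom_sum _ _ FH)).
  by case=> [| /IH //]; exists i.
rewrite big_nil => /bij_inj inj0; have := indec_nonzero Mi.
rewrite -dimvf lt0n => /negP[]; rewrite dimv_eq0 -subv0.
by apply/subvP=> v _; rewrite memv0; apply/eqP/inj0; rewrite !zero_lfunE.
Qed.

Lemma bij_comp_summand X M (f : 'Hom(X, M)) (g : 'Hom(M, X)) :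
  is_hom f -> is_hom g -> bijective (g \o f)%VF -> summand X M.
Proof.
move=> fH gH gfB; have [s [sH sK s'K]] := hom_inv (hom_comp fH gH) gfB.
apply/summandP; exists f, (s \o g)%VF; split=> // [|x]; first exact: hom_comp.
by have := sK x; rewrite !comp_lfunE.
Qed.

Lemma bij_comp_indec X M (f : 'Hom(X, M)) (g : 'Hom(M, X)) :
  indecomposable X -> indecomposable M ->
  is_hom f -> is_hom g -> bijective (g \o f)%VF ->
  [/\ iso X M, bijective f & bijective g].
Proof.
move=> Xi Mi fH gH gfB; have XM := bij_comp_summand fH gH gfB.
have isoXM := indec_summand_iso Mi (indec_nonzero Xi) XM.
split=> //.
  apply: lker0_dim_bij; last by rewrite (iso_dim isoXM).
  apply: lker0_eq0 => x fx; apply: (bij_inj gfB).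
  by rewrite comp_lfunE fx !linear0.
apply: limg_full_dim_bij; last by rewrite (iso_dim isoXM).
have [h _ hK] := gfB; apply/limg_fullP=> x; exists (f (h x)).
by have := hK x; rewrite comp_lfunE.
Qed.

Lemma exists_indec_summand M : (0 < dim M)%N ->
  exists2 X, indecomposable X & summand X M.
Proof.
have [n] := ubnP (dim M); elim: n M => // n IH M ltn M0.
have [Mi|Mni] := classic (indecomposable M).
  by exists M => //; apply/iso_summand/iso_refl.
have [X [Y [MXY X0 Y0]]] : exists X Y,
    [/\ iso M (dsum X Y), (0 < dim X)%N & (0 < dim Y)%N].
  apply: NNPP => nex; apply: Mni; split=> [/iso0_dim d0|X Y MXY].
    by rewrite d0 in M0.
  apply: NNPP => /not_or_and[X0 Y0]; apply: nex; exists X, Y.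
  by split=> //; rewrite lt0n; apply/eqP => /dim0_iso.
have [||Z Zi ZX] := IH X => //.
  rewrite ltnS in ltn; apply: leq_trans ltn.
  by rewrite (iso_dim MXY) dim_dsum -addn1 leq_add2l.
by exists Z => //; apply: summand_trans ZX _; exists Y.
Qed.

Lemma indec_summand_dsum X M N : indecomposable X -> summand X (dsum M N) ->
  summand X M \/ summand X N.
Proof.
move=> Xi /summandP[f [g [fH gH gf]]].
have [i [j [p [q [[iH jH] [pH qH] [iE jE] [pE qE]]]]]] := dsum_maps M N.
have B : bijective (((g \o i) \o (p \o f))%VF + ((g \o j) \o (q \o f))%VF).
  exists id => x; rewrite add_lfunE !comp_lfunE -linearD /= iE jE pE qE;
    by rewrite /= -[X in g X]/(_, _) /= addr0 add0r -[RHS]gf; case: (f x).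
have [||b|b] := indec_local Xi _ _ B; try by do !apply: hom_comp.
  by left; apply: bij_comp_summand b; apply: hom_comp.
by right; apply: bij_comp_summand b; apply: hom_comp.
Qed.

(** The identity of X factors through a finite power of M. In this form, closure under retracts and
    transitivity need no decomposition into indecomposables; [addP] compares it with [add]. *)
Definition in_add M X : Prop :=
  exists (I : finType) (f : I -> 'Hom(X, M)) (g : I -> 'Hom(M, X)),
    [/\ forall i, is_hom (f i), forall i, is_hom (g i)
      & forall x, \sum_i g i (f i x) = x].

Lemma in_add_refl M : in_add M M.
Proof.
exists unit, (fun=> \1%VF), (fun=> \1%VF); split=> [_|_|x]; try exact: hom_id.
by rewrite big_const card_unit /= addr0 !id_lfunE.
Qed.

Lemma in_add_summand M X Y : summand X Y -> in_add M Y -> in_add M X.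
Proof.
move=> /summandP[s [r [sH rH rs]]] [I [f [g [fH gH gf]]]].
exists I, (fun i => f i \o s)%VF, (fun i => r \o g i)%VF.
split=> [i|i|x]; try exact: hom_comp.
rewrite -[RHS]rs -[s x]gf linear_sum; apply: eq_bigr => i _.
by rewrite !comp_lfunE.
Qed.

Lemma summand_in_add M X : summand X M -> in_add M X.
Proof. by move/in_add_summand; apply; apply: in_add_refl. Qed.

Lemma in_add_iso M X Y : iso X Y -> in_add M X -> in_add M Y.
Proof. by move=> /iso_sym/iso_summand; apply: in_add_summand. Qed.

Lemma in_add0 M X : dim X = 0%N -> in_add M X.
Proof.
move=> d0; exists void, (fun=> 0), (fun=> 0); split=> [[]|[]|x].
by rewrite [RHS](dim0_eq0 x d0) big1 // => -[].
Qed.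

Lemma in_add_dsum M X Y : in_add M X -> in_add M Y -> in_add M (dsum X Y).
Proof.
move=> [I [f [g [fH gH gf]]]] [J [f' [g' [f'H g'H gf']]]].
have [i [j [p [q [[iH jH] [pH qH] [iE jE] [pE qE]]]]]] := dsum_maps X Y.
exists (I + J)%type,
  (fun k => match k with inl a => (f a \o p)%VF | inr b => (f' b \o q)%VF end),
  (fun k => match k with inl a => (i \o g a)%VF | inr b => (j \o g' b)%VF end).
split=> [[a|b]|[a|b]|x]; try exact: hom_comp.
rewrite big_sumType /=.
have -> : \sum_a (i \o g a)%VF ((f a \o p)%VF x) = i (p x).
  by rewrite -[p x]gf linear_sum; apply: eq_bigr => a _; rewrite !comp_lfunE.
have -> : \sum_b (j \o g' b)%VF ((f' b \o q)%VF x) = j (q x).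
  by rewrite -[q x]gf' linear_sum; apply: eq_bigr => b _; rewrite !comp_lfunE.
by rewrite iE jE pE qE; case: x => x y; congr (_, _); rewrite /= ?addr0 ?add0r.
Qed.

Lemma in_add_trans M N X : in_add M N -> in_add N X -> in_add M X.
Proof.
move=> [I [f [g [fH gH gf]]]] [J [f' [g' [f'H g'H gf']]]].
exists (J * I)%type, (fun k => f k.2 \o f' k.1)%VF, (fun k => g' k.1 \o g k.2)%VF.
split=> [k|k|x]; try exact: hom_comp.
rewrite -(pair_bigA _ (fun j i => (g' j \o g i)%VF ((f i \o f' j)%VF x))) /=.
rewrite -[RHS]gf'; apply: eq_bigr => j _.
by rewrite -[f' j x in RHS]gf linear_sum; apply: eq_bigr => i _; rewrite !comp_lfunE.
Qed.

Lemma add_in_add M X : add M X -> in_add M X.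
Proof.
elim=> {X} [X /iso0_dim d0|X Y Z XM _ IH ZXY]; first exact: in_add0.
apply: in_add_iso (iso_sym ZXY) _; apply: in_add_dsum => //.
exact: summand_in_add.
Qed.

Lemma in_add_indec M X : indecomposable X -> in_add M X -> summand X M.
Proof.
move=> Xi [I [f [g [fH gH gf]]]].
have [||i] := @indec_local_sum X I (index_enum I) (fun i => g i \o f i)%VF Xi.
- by move=> i; apply: hom_comp.
- exists id => x; rewrite sum_lfunE -[RHS]gf; apply: eq_bigr => i _;
    by rewrite comp_lfunE.
by apply: bij_comp_summand.
Qed.

Lemma in_add_add M X : in_add M X -> add M X.
Proof.
have [n] := ubnP (dim X); elim: n X => // n IH X ltn XM.
have [d0|X0] := posnP (dim X); first exact/add_nil/dim0_iso.
have [Y Yi [Z XYZ]] := exists_indec_summand X0.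
apply: (add_cons (X := Y) (Y := Z)) => //.
  by apply: in_add_indec => //; apply: in_add_summand XM; exists Z.
apply: IH; last first.
  apply: in_add_summand XM; apply: summand_trans (summand_dsumr Y Z) _.
  exact/iso_summand/iso_sym.
rewrite ltnS in ltn; apply: leq_trans ltn.
by rewrite (iso_dim XYZ) dim_dsum -add1n leq_add2r indec_nonzero.
Qed.

Lemma addP M X : add M X <-> in_add M X.
Proof. by split; [apply: add_in_add | apply: in_add_add]. Qed.

(* A common summand of P and Q of maximal dimension is all of P. *)
Lemma basic_summand P Q : basic P -> in_add Q P -> summand P Q.
Proof.
move=> Pb QP.
pose S d := exists X P' Q', [/\ iso P (dsum X P'), iso Q (dsum X Q') & dim X = d].
have [||d [[X [P' [Q' [PX QX dX]]]] dmax]] := @nat_max S (dim P).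
- exists 0%N, (rmod0 A), P, Q; split; last by rewrite /dim.
  + have [i [j [p [q [_ [pH qH] _ [pE qE]]]]]] := dsum_maps (rmod0 A) P.
    apply: iso_sym; exists q => //; apply: limg_full_dim_bij.
      by apply/limg_fullP=> y; exists (0, y); rewrite qE.
    by rewrite dim_dsum.
  + have [i [j [p [q [_ [pH qH] _ [pE qE]]]]]] := dsum_maps (rmod0 A) Q.
    apply: iso_sym; exists q => //; apply: limg_full_dim_bij.
      by apply/limg_fullP=> y; exists (0, y); rewrite qE.
    by rewrite dim_dsum.
- by move=> _ [X [P' [Q' [PX _ <-]]]]; rewrite (iso_dim PX) leq_addr.
have [P'0|P'0] := posnP (dim P').
  have XP : iso X P.
    apply: summand_dim_iso; first by exists P'.
    by rewrite (iso_dim PX) dim_dsum P'0 addn0.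
  by apply: summand_trans (iso_summand (iso_sym XP)) _; exists Q'.
have [Y Yi [Z P'YZ]] := exists_indec_summand P'0.
have YP : summand Y P.
  apply: summand_trans (iso_summand (iso_sym PX)).
  by apply: summand_trans (summand_dsumr X P'); exists Z.
have YQ : summand Y Q by apply: in_add_indec => //; apply: in_add_summand QP.
have := summand_trans YQ (iso_summand QX).
case/(indec_summand_dsum Yi)=> [YX | [W Q'YW]].
  case: Pb; exists Y => //; apply: summand_trans (iso_summand (iso_sym PX)).
  by apply: dsum_summand => //; exists Z.
have: (dim (dsum X Y) <= d)%N.
  apply: dmax; exists (dsum X Y), Z, W; split=> //.
    apply: iso_trans PX _; apply: iso_trans (dsumA _ _ _).
    by apply: dsum_iso => //; apply: iso_refl.
  apply: iso_trans QX _; apply: iso_trans (dsumA _ _ _).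
  by apply: dsum_iso => //; apply: iso_refl.
rewrite dim_dsum dX -[X in (_ <= X)%N]addn0 leq_add2l.
by rewrite leqNgt indec_nonzero.
Qed.

Lemma basic_add_iso P Q : basic P -> basic Q -> in_add Q P -> in_add P Q -> iso P Q.
Proof.
move=> Pb Qb QP PQ; apply: summand_dim_iso; first exact: basic_summand.
exact/summand_dim/basic_summand.
Qed.

(** If P were N + N + Y with N indecomposable, then N + Y would have the same additive closure and
    smaller dimension. Basic representatives are thus found by minimising the dimension. *)
Lemma basic_of_minimal P : (forall Q, in_add P Q -> in_add Q P ->
  (dim P <= dim Q)%N) -> basic P.
Proof.
move=> Pmin [N Ni [Y PNY]].
have NNY := iso_trans PNY (iso_sym (dsumA N N Y)).
have: (dim P <= dim (dsum N Y))%N.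
  apply: Pmin.
    apply: summand_in_add; apply: summand_trans (iso_summand (iso_sym NNY)).
    exact: summand_dsumr.
  apply: in_add_iso (iso_sym NNY) _; apply: in_add_dsum; apply: summand_in_add.
    exact: summand_dsuml.
  exact/iso_summand/iso_refl.
rewrite (iso_dim NNY) dim_dsum -[X in (_ <= X)%N]add0n leq_add2r.
by rewrite leqNgt indec_nonzero.
Qed.

End KrullSchmidt.

(** * Extensions and Fac *)

Section ExtAndTrace.
Variables (K : fieldType) (A : fdalg K).
Implicit Types M N X Y Z P U W : rmod A.

(** Together with [section_ext1_zero], this trades the equivalence with the split extension for a
    section, the only form used afterwards. *)
Lemma ext1_zero_section P X Y (f : 'Hom(X, Y)) (g : 'Hom(Y, P)) :
  ext1_zero P X -> ses f g ->
  exists2 s : 'Hom(P, Y), is_hom s & forall x, g (s x) = x.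
Proof.
move=> PX fg; have [phi phiH [phif phig]] := PX _ _ _ fg.
have [fH gH _ _ gS] := fg.
have [i [j [p [q [_ [pH qH] _ [pE qE]]]]]] := dsum_maps X P.
have [|||s sH sE] := @hom_factor _ _ _ _ _ g (\1 - (f \o (p \o phi)))%VF gH.
- by apply: hom_sub; [exact: hom_id | do !apply: hom_comp].
- exact: gS.
- move=> y /(ses_ker fg)[x <-].
  by rewrite add_lfunE opp_lfunE !comp_lfunE id_lfunE phif pE subrr.
exists s => // z; have [y <-] := ses_surj z fg.
rewrite sE add_lfunE opp_lfunE !comp_lfunE id_lfunE linearB /=.
by rewrite (ses_comp0 _ fg) subr0.
Qed.

Lemma section_ext1_zero P X :
  (forall Y (f : 'Hom(X, Y)) (g : 'Hom(Y, P)), ses f g ->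
     exists2 s : 'Hom(P, Y), is_hom s & forall x, g (s x) = x) ->
  ext1_zero P X.
Proof.
move=> sec Y f g fg; have [s sH gs] := sec _ _ _ fg.
have [fH gH _ _ _] := fg.
have [||r rH rE] := ses_lift (h := (\1 - (s \o g))%VF) fg.
- by apply: hom_sub; [exact: hom_id | exact: hom_comp].
- move=> y; rewrite add_lfunE opp_lfunE comp_lfunE id_lfunE linearB /=.
  by rewrite gs subrr.
have [phi phiH phiE] := hom_col rH gH; exists phi => //; split=> [x|y].
  rewrite phiE (ses_comp0 _ fg); congr (_, _); apply: (ses_inj fg).
  rewrite rE add_lfunE opp_lfunE comp_lfunE id_lfunE (ses_comp0 _ fg).
  by rewrite linear0 subr0.
by rewrite phiE.
Qed.

(** The pullback [E] of the sequence along [h] is an extension of P by X; a section of it, followed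
    by the projection to Y, is the lift. *)
Lemma ext1_zero_lift P X Y Z (f : 'Hom(X, Y)) (g : 'Hom(Y, Z)) (h : 'Hom(P, Z)) :
  ext1_zero P X -> ses f g -> is_hom h ->
  exists2 l : 'Hom(P, Y), is_hom l & forall x, g (l x) = h x.
Proof.
move=> PX fg hH; have [fH gH _ _ _] := fg.
have [i [j [p [q [_ [pH qH] _ [pE qE]]]]]] := dsum_maps Y P.
have dH : is_hom ((g \o p)%VF - (h \o q)%VF).
  by apply: hom_sub; apply: hom_comp.
have [E [e [eH e0 eI]]] := submodule (lker_stable dH).
have eE z : g (p (e z)) = h (q (e z)).
  have: e z \in limg e by rewrite memv_img ?memvf.
  rewrite eI memv_ker add_lfunE opp_lfunE !comp_lfunE subr_eq0.
  by move/eqP.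
have [f1 f1H f1E] := hom_col fH (@hom_0 _ _ X P).
have [|f' f'H f'E] := hom_corestrict eH f1H e0.
  rewrite eI; apply/subvP=> _ /memv_imgP[x _ ->].
  rewrite memv_ker add_lfunE opp_lfunE !comp_lfunE pE qE f1E /=.
  by rewrite zero_lfunE linear0 subr0 (ses_comp0 _ fg).
have fg' : ses f' (q \o e)%VF.
  split=> //; first exact: hom_comp.
  - apply: lker0_eq0 => x f'x; apply: (ses_inj fg).
    by have := f'E x; rewrite f'x f1E linear0 => -[<-]; rewrite linear0.
  - apply/vspaceP=> z; rewrite memv_ker comp_lfunE.
    apply/memv_imgP/eqP => [[x _ ->]|qez].
      by rewrite f'E f1E qE zero_lfunE.
    have [x fx] : exists x, f x = p (e z).
      by apply: (ses_ker fg); rewrite eE qez linear0.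
    exists x; rewrite ?memvf //; apply: (proj1 (lker0_injP e) e0).
    rewrite f'E f1E fx zero_lfunE pE -qez qE.
    by case: (e z).
  - apply/limg_fullP=> x; have [y gy] := ses_surj (h x) fg.
    have: (y, x) \in limg e.
      by rewrite eI memv_ker add_lfunE opp_lfunE !comp_lfunE pE qE gy subrr.
    by case/memv_imgP=> z _ ez; exists z; rewrite comp_lfunE -ez qE.
have [s sH sE] := ext1_zero_section PX fg'.
exists (p \o (e \o s))%VF; first by do !apply: hom_comp.
by move=> x; rewrite !comp_lfunE eE -[in RHS](sE x) comp_lfunE.
Qed.

Lemma ext1_zero_in_add M P X : ext1_zero M X -> in_add M P -> ext1_zero P X.
Proof.
move=> MX [I [f [g [fH gH gf]]]]; apply: section_ext1_zero => Y u v uv.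
have /fin_all_exists[l lP] i :
    exists l : 'Hom(M, Y), is_hom l /\ forall x, v (l x) = g i x.
  by have [l lH lE] := ext1_zero_lift MX uv (gH i); exists l.
exists (\sum_i (l i \o f i)%VF).
  by apply: hom_sum => i; apply: hom_comp => //; apply: (lP i).1.
move=> x; rewrite sum_lfunE linear_sum -[RHS]gf /=; apply: eq_bigr => i _.
by rewrite comp_lfunE (lP i).2.
Qed.

Lemma ext1_zero_iso P X X' : iso X X' -> ext1_zero P X -> ext1_zero P X'.
Proof.
case=> h hH hB PX; apply: section_ext1_zero => Y f g [fH gH f0 e gS].
apply: (ext1_zero_section (f := (f \o h)%VF) PX); split=> //.
- exact: hom_comp.
- apply: lker0_eq0 => x; rewrite comp_lfunE => fhx.
  apply: (bij_inj hB); apply: (proj1 (lker0_injP f) f0).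
  by rewrite fhx !linear0.
- by rewrite limg_comp bij_limg.
Qed.

(** * Traces, approximations by additive closures, and the classes [Fac U] *)

Definition trace M X : {vspace X} :=
  (\sum_(i < \dim (homs M X)) limg (vbasis (homs M X))`_i)%VS.

Lemma limg_trace M X (f : 'Hom(M, X)) : is_hom f -> (limg f <= trace M X)%VS.
Proof.
move=> /homsP fH; apply/subvP=> _ /memv_imgP[v _ ->].
rewrite (coord_vbasis fH) sum_lfunE; apply: memv_sumr => i _.
by rewrite scale_lfunE memvZ // memv_img ?memvf.
Qed.

Lemma vbasis_hom M X i : is_hom (vbasis (homs M X))`_i.
Proof.
apply/homsP; have [ltis|leis] := ltnP i (\dim (homs M X)).
  by apply/vbasis_mem/mem_nth; rewrite size_tuple.
by rewrite nth_default ?mem0v ?size_tuple.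
Qed.

Lemma trace_sub M X (V : {vspace X}) :
  (forall f : 'Hom(M, X), is_hom f -> (limg f <= V)%VS) -> (trace M X <= V)%VS.
Proof. by move=> fV; apply/subv_sumP => i _; apply/fV/vbasis_hom. Qed.

Lemma trace_map M X Y (h : 'Hom(X, Y)) : is_hom h ->
  (h @: trace M X <= trace M Y)%VS.
Proof.
move=> hH; rewrite limg_sum; apply/subv_sumP => i _; rewrite -limg_comp.
by apply: limg_trace; apply: hom_comp => //; apply: vbasis_hom.
Qed.

Lemma mact_lin_linE X (a : A) (V : {vspace X}) v :
  (v \in (mact_lin X a @^-1: V)%VS) = (v *> a \in V).
Proof. by rewrite -memv_preim mact_linE. Qed.

Lemma trace_stable M X v (a : A) : v \in trace M X -> v *> a \in trace M X.
Proof.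
rewrite -mact_lin_linE; apply: subvP; apply: trace_sub => f fH.
apply/subvP=> x /memv_imgP[u _ ->]; rewrite mact_lin_linE -fH.
by apply: (subvP (limg_trace fH)); rewrite memv_img ?memvf.
Qed.

Lemma row_maps M X (s : seq 'Hom(M, X)) : (forall h, h \in s -> is_hom h) ->
  exists Y (p : 'Hom(Y, X)), [/\ in_add M Y, is_hom p,
    forall h, h \in <<s>>%VS ->
      exists2 l : 'Hom(M, Y), is_hom l & forall x, p (l x) = h x
    & exists (I : finType) (h : I -> 'Hom(M, X)) (r : I -> 'Hom(Y, M)),
      [/\ forall i, h i \in s, forall i, is_hom (r i)
        & forall y, p y = \sum_i h i (r i y)]].
Proof.
elim: s => [_|h0 s IH sH].
  exists (rmod0 A), 0; split; [exact: in_add0 | exact: hom_0 | |].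
    move=> h; rewrite span_nil memv0 => /eqP->.
    by exists 0 => [|x]; [exact: hom_0 | rewrite !zero_lfunE].
  exists void, (fun=> 0), (fun=> 0); split=> [[]|[]|y].
  by rewrite zero_lfunE big1 // => -[].
have [|Y [p [YM pH pl [I [h [r [hs rH pE]]]]]]] := IH.
  by move=> h hs; apply: sH; rewrite inE hs orbT.
have h0H : is_hom h0 by apply: sH; rewrite inE eqxx.
have [i [j [p1 [p2 [[iH jH] [p1H p2H] [iE jE] [p1E p2E]]]]]] := dsum_maps M Y.
have [q qH qE] := hom_row h0H pH.
exists (dsum M Y), q; split=> //.
- by apply: in_add_dsum => //; apply: in_add_refl.
- move=> k; rewrite span_cons => /memv_addP[_ /vlineP[c ->] [k' /pl[l lH lE] ->]].
  exists (c *: i + (j \o l)%VF).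
    by apply: hom_add; [apply: hom_scale | apply: hom_comp].
  move=> x; rewrite !add_lfunE !scale_lfunE comp_lfunE linearD linearZ /= iE jE.
  by rewrite !qE /= !linear0 addr0 add0r lE.
- exists (unit + I)%type,
    (fun k => match k with inl _ => h0 | inr b => h b end),
    (fun k => match k with inl _ => p1 | inr b => (r b \o p2)%VF end).
  split=> [[a|b]|[a|b]|y] //=.
  + by rewrite inE eqxx.
  + by rewrite inE hs orbT.
  + exact: hom_comp.
  + rewrite big_sumType /= big_const card_unit /= addr0 qE p1E; congr (_ + _).
    by rewrite pE; apply: eq_bigr => b _; rewrite comp_lfunE p2E.
Qed.

Lemma col_maps M X (s : seq 'Hom(X, M)) : (forall h, h \in s -> is_hom h) ->
  exists Y (c : 'Hom(X, Y)), [/\ in_add M Y, is_hom c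
    & forall h, h \in <<s>>%VS ->
      exists2 l : 'Hom(Y, M), is_hom l & forall x, l (c x) = h x].
Proof.
elim: s => [_|h0 s IH sH].
  exists (rmod0 A), 0; split; [exact: in_add0 | exact: hom_0 |].
  move=> h; rewrite span_nil memv0 => /eqP->.
  by exists 0 => [|x]; [exact: hom_0 | rewrite !zero_lfunE].
have [|Y [c [YM cH cl]]] := IH.
  by move=> h hs; apply: sH; rewrite inE hs orbT.
have h0H : is_hom h0 by apply: sH; rewrite inE eqxx.
have [i [j [p1 [p2 [[iH jH] [p1H p2H] [iE jE] [p1E p2E]]]]]] := dsum_maps M Y.
have [q qH qE] := hom_col h0H cH.
exists (dsum M Y), q; split=> //.
  by apply: in_add_dsum => //; apply: in_add_refl.
move=> k; rewrite span_cons => /memv_addP[_ /vlineP[b ->] [k' /cl[l lH lE] ->]].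
exists (b *: p1 + (l \o p2)%VF).
  by apply: hom_add; [apply: hom_scale | apply: hom_comp].
by move=> x; rewrite !add_lfunE !scale_lfunE comp_lfunE p1E p2E qE /= lE.
Qed.

Lemma right_add_approx M X : exists Y (p : 'Hom(Y, X)),
  [/\ in_add M Y, is_hom p, limg p = trace M X
    & forall h : 'Hom(M, X), is_hom h ->
      exists2 l : 'Hom(M, Y), is_hom l & forall x, p (l x) = h x].
Proof.
have [|Y [p [YM pH pl [I [h [r [hs rH pE]]]]]]] :=
    @row_maps M X (vbasis (homs M X)).
  by move=> h /vbasis_mem/homsP.
have pl' (h' : 'Hom(M, X)) : is_hom h' ->
    exists2 l : 'Hom(M, Y), is_hom l & forall x, p (l x) = h' x.
  by move/homsP=> h'H; apply: pl; rewrite (span_basis (vbasisP _)).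
exists Y, p; split=> //; apply/eqP; rewrite eqEsubv; apply/andP; split.
  apply/subvP=> _ /memv_imgP[y _ ->]; rewrite pE; apply: memv_suml => i _.
  have /homsP hH := vbasis_mem (hs i).
  by apply: (subvP (limg_trace hH)); rewrite memv_img ?memvf.
apply: trace_sub => f /pl'[l lH lE]; apply/subvP=> _ /memv_imgP[x _ ->].
by rewrite -lE memv_img ?memvf.
Qed.

Lemma left_add_approx M X : exists Y (c : 'Hom(X, Y)),
  [/\ in_add M Y, is_hom c
    & forall h : 'Hom(X, M), is_hom h ->
      exists2 l : 'Hom(Y, M), is_hom l & forall x, l (c x) = h x].
Proof.
have [|Y [c [YM cH cl]]] := @col_maps M X (vbasis (homs X M)).
  by move=> h /vbasis_mem/homsP.
exists Y, c; split=> // h /homsP hH.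
by apply: cl; rewrite (span_basis (vbasisP _)).
Qed.

Lemma in_add_trace M X : in_add M X -> trace M X = fullv.
Proof.
move=> [I [f [g [fH gH gf]]]]; apply/eqP; rewrite eqEsubv subvf.
apply/subvP=> x _; rewrite -(gf x); apply: memv_suml => i _.
by apply: (subvP (limg_trace (gH i))); rewrite memv_img ?memvf.
Qed.

(** With this criterion, closure of [Fac] under quotients and its transitivity reduce to
    functoriality of the trace. *)
Lemma FacP M X : Fac M X <-> trace M X = fullv.
Proof.
split=> [[Y [f [/addP YM fH fS]]]|Xt].
  apply/eqP; rewrite eqEsubv subvf -fS -(in_add_trace YM).
  exact: trace_map.
have [Y [p [YM pH pI _]]] := right_add_approx M X.
by exists Y, p; split=> //; [apply/addP | rewrite pI].
Qed.

Lemma in_add_Fac M X : in_add M X -> Fac M X.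
Proof. by move=> XM; apply/FacP/in_add_trace. Qed.

Lemma Fac_self M : Fac M M.
Proof. exact/in_add_Fac/in_add_refl. Qed.

Lemma Fac_quot M X Y (g : 'Hom(X, Y)) : Fac M X -> is_hom g -> limg g = fullv ->
  Fac M Y.
Proof.
move=> /FacP Xt gH gS; apply/FacP/eqP; rewrite eqEsubv subvf -gS -Xt.
exact: trace_map.
Qed.

Lemma Fac_iso M X Y : iso X Y -> Fac M X -> Fac M Y.
Proof. by case=> f fH /bij_limg fS XM; apply: Fac_quot XM fH fS. Qed.

Lemma Fac_trans M N X : Fac M N -> Fac N X -> Fac M X.
Proof.
move=> /FacP Nt /FacP Xt; apply/FacP/eqP; rewrite eqEsubv subvf -Xt.
by apply: trace_sub => f fH; rewrite -Nt trace_map.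
Qed.

(** Every map U -> Z lifts to Y, so the trace of U in Y maps onto Z; it also contains the image of
    X, hence it is all of Y. *)
Lemma Fac_ext U X Y Z (f : 'Hom(X, Y)) (g : 'Hom(Y, Z)) : ses f g ->
  ext1_zero U X -> Fac U X -> Fac U Z -> Fac U Y.
Proof.
move=> fg UX /FacP Xt /FacP Zt; have [fH gH _ e gS] := fg.
have gt : (trace U Z <= g @: trace U Y)%VS.
  apply: trace_sub => h /(ext1_zero_lift UX fg)[l lH lE].
  apply/subvP=> _ /memv_imgP[u _ ->]; rewrite -lE memv_img //.
  by apply: (subvP (limg_trace lH)); rewrite memv_img ?memvf.
apply/FacP/eqP; rewrite eqEsubv subvf; apply/subvP=> y _.
have: g y \in (g @: trace U Y)%VS by apply: (subvP gt); rewrite Zt memvf.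
case/memv_imgP=> t tt gyt; rewrite -(subrK t y) memvD //.
have [x <-] : exists x, f x = y - t.
  by apply: (ses_ker fg); rewrite linearB /= gyt subrr.
by apply: (subvP (trace_map U fH)); rewrite memv_img // Xt memvf.
Qed.

(** The Auslander-Smalo form of tau-rigidity; the equivalence is [tau_rigidP]. *)
Definition ext_rigid U : Prop := forall X, Fac U X -> ext1_zero U X.

Lemma torsion_class_Fac U : ext_rigid U ->
  torsion_class (Fac U).
Proof.
move=> Uext; split=> // [X Y|X Y Z f g [_ _ _ fg]]; first exact: Fac_iso.
split=> [XU|YU].
  by apply: Fac_ext fg (Uext _ XU) XU.
by case: fg => _ gH _ _ gS; apply: Fac_quot YU gH gS.
Qed.

Lemma trace_module U X : exists (S : rmod A) (i : 'Hom(S, X)),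
  [/\ is_hom i, lker i = 0%VS, limg i = trace U X & Fac U S].
Proof.
have [S [i [iH i0 iI]]] := submodule (@trace_stable U X).
exists S, i; split=> //; apply/FacP/eqP; rewrite eqEsubv subvf /=.
rewrite -(limg_ker0 (f := i)) ?i0 // iI; apply: trace_sub => f fH.
have [|h hH hE] := hom_corestrict iH fH i0; first by rewrite iI limg_trace.
apply/subvP=> _ /memv_imgP[u _ ->]; rewrite -hE memv_img //.
by apply: (subvP (limg_trace hH)); rewrite memv_img ?memvf.
Qed.

Lemma Fac_limg U X Y (f : 'Hom(X, Y)) : Fac U X -> is_hom f ->
  (limg f <= trace U Y)%VS.
Proof. by move=> /FacP Xt fH; rewrite -Xt trace_map. Qed.

(** * Projective modules and functorial finiteness of [Fac U] *)

Lemma reg_hom M (v : M) :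
  exists2 l : 'Hom(rmod_reg A, M), is_hom l & forall a, l a = v *> a.
Proof.
have [|l lE] := @lfun_of_linear _ (rmod_reg A) M (fun a => v *> a).
  by move=> k a b; rewrite mact_addr mact_scaler.
by exists l => // a b; rewrite !lE /= mact_assoc.
Qed.

Lemma projective_lift P X Y (g : 'Hom(X, Y)) (h : 'Hom(P, Y)) :
  projective P -> is_hom g -> limg g = fullv -> is_hom h ->
  exists2 l : 'Hom(P, X), is_hom l & forall x, g (l x) = h x.
Proof.
move=> Pp gH gS hH; have [l lH e] := Pp _ _ _ _ gH gS hH.
by exists l => // x; rewrite -e comp_lfunE.
Qed.

Lemma projective_reg : projective (rmod_reg A).
Proof.
move=> X Y g h gH /limg_fullP gS hH; have [x gx] := gS (h aone).
have [l lH lE] := reg_hom x; exists l => //; apply/lfunP=> a.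
by rewrite comp_lfunE lE gH gx -hH /= amul_1l.
Qed.

Lemma projective_in_add M P : projective M -> in_add M P -> projective P.
Proof.
move=> Mp [I [f [g [fH gH gf]]]] X Y p h pH pS hH.
have /fin_all_exists[l lP] i :
    exists l : 'Hom(M, X), is_hom l /\ forall x, p (l x) = h (g i x).
  have [l lH lE] := projective_lift Mp pH pS (hom_comp (gH i) hH).
  by exists l; split=> // x; rewrite lE comp_lfunE.
exists (\sum_i (l i \o f i)%VF).
  by apply: hom_sum => i; apply: hom_comp => //; apply: (lP i).1.
apply/lfunP=> x; rewrite comp_lfunE sum_lfunE linear_sum -[in RHS](gf x) linear_sum /=.
by apply: eq_bigr => i _; rewrite comp_lfunE (lP i).2.
Qed.

Lemma Fac_reg M : Fac (rmod_reg A) M.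
Proof.
apply/FacP/eqP; rewrite eqEsubv subvf; apply/subvP=> v _.
have [l lH lE] := reg_hom v; apply: (subvP (limg_trace lH)).
by rewrite -(mact_1 v) -lE memv_img ?memvf.
Qed.

Lemma projective_cover_reg M : exists P (p : 'Hom(P, M)),
  [/\ in_add (rmod_reg A) P, projective P, is_hom p & limg p = fullv].
Proof.
have [P [p [/addP Pr pH pS]]] := Fac_reg M.
exists P, p; split=> //; exact: projective_in_add projective_reg Pr.
Qed.

Lemma projective_in_add_reg P : projective P -> in_add (rmod_reg A) P.
Proof.
move=> Pp; have [Q [p [Qr _ pH pS]]] := projective_cover_reg P.
have [l lH lE] := projective_lift Pp pH pS (@hom_id _ _ P).
apply: in_add_summand Qr; apply/summandP; exists l, p; split=> // x.
by rewrite lE id_lfunE.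
Qed.

(** A map from P to a quotient of a module in add U lifts to that module, so a left add
    U-approximation of P already approximates P by Fac U. *)
Lemma left_Fac_approx_projective U P : projective P ->
  exists Y (c : 'Hom(P, Y)), [/\ in_add U Y, is_hom c
    & forall X (h : 'Hom(P, X)), Fac U X -> is_hom h ->
      exists2 l : 'Hom(Y, X), is_hom l & forall x, l (c x) = h x].
Proof.
move=> Pp; have [Y [c [YU cH cl]]] := left_add_approx U P.
exists Y, c; split=> // X h [Z [p [/addP [I [f [g [fH gH gf]]]] pH pS]]] hH.
have [k kH kE] := projective_lift Pp pH pS hH.
have /fin_all_exists[l lP] i :
    exists l : 'Hom(Y, U), is_hom l /\ forall x, l (c x) = f i (k x).
  have [l lH lE] := cl _ (hom_comp kH (fH i)).
  by exists l; split=> // x; rewrite lE comp_lfunE.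
exists (p \o \sum_i (g i \o l i)%VF)%VF.
  apply: hom_comp => //; apply: hom_sum => i; apply: hom_comp => //.
  exact: (lP i).1.
move=> x; rewrite comp_lfunE sum_lfunE -kE -[in RHS](gf (k x)).
by congr (p _); apply: eq_bigr => i _; rewrite comp_lfunE (lP i).2.
Qed.

(** The trace of U is a right approximation. A left one is the pushout, along a projective cover map
    P -> M, of the left approximation of P. *)
Lemma functorially_finite_Fac U : functorially_finite (Fac U).
Proof.
move=> M; split.
  have [S [i [iH i0 iI SU]]] := trace_module U M; exists S, i; split=> //.
  move=> X f XU fH; have [|h hH hE] := hom_corestrict iH fH i0.
    by rewrite iI; apply: Fac_limg.
  by exists h => //; apply/lfunP=> x; rewrite comp_lfunE.
have [P [p [_ Pp pH pS]]] := projective_cover_reg M.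
have [Y [c [YU cH cl]]] := left_Fac_approx_projective U Pp.
have [Q [q [qH qS qK]]] := quotient_module (limg_comp_stable cH (lker_stable pH)).
have [|m mH mE] := hom_factor pH (hom_comp cH qH) pS.
  move=> x px; apply/eqP; rewrite comp_lfunE -memv_ker qK memv_img //.
  by rewrite memv_ker px.
exists Q, m; split=> //.
  by apply: Fac_quot qH qS; apply: in_add_Fac.
move=> X h XU hH; have [l lH lE] := cl _ _ XU (hom_comp pH hH).
have [|l' l'H l'E] := hom_factor qH lH qS.
  move=> y /eqP; rewrite -memv_ker qK => /memv_imgP[x xp ->].
  by rewrite lE comp_lfunE; move: xp; rewrite memv_ker => /eqP->; rewrite linear0.
exists l' => //; apply/lfunP=> z; have [x <-] := proj1 (limg_fullP p) pS z.
by rewrite comp_lfunE mE comp_lfunE l'E lE comp_lfunE.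
Qed.

Lemma f_tors_Fac U : ext_rigid U -> f_tors (Fac U).
Proof.
by move/torsion_class_Fac; split=> //; apply: functorially_finite_Fac.
Qed.

End ExtAndTrace.

(** * The Auslander-Reiten translation *)

Section Presentations.
Variables (K : fieldType) (A : fdalg K).
Implicit Types M N X Y Z P U W : rmod A.

(** A projective of least dimension mapping onto M is a cover. If p h is onto, lifting p along it
    gives [s] with p h s = p; the Fitting summand of h s is projective and still maps onto M, so by
    minimality it is all of P, and h is onto. *)
Lemma projective_cover M : exists P (p : 'Hom(P, M)),
  [/\ projective P, is_hom p, limg p = fullv & essential p].
Proof.
pose S d := exists P (p : 'Hom(P, M)),
  [/\ projective P, is_hom p, limg p = fullv & dim P = d].
have [|d [[P [p [Pp pH pS dP]]] dmin]] := @nat_min S.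
  have [P [p [_ Pp pH pS]]] := projective_cover_reg M.
  by exists (dim P), P, p.
exists P, p; split=> // Y h hH; rewrite pS => phS.
have [s sH sE] := projective_lift Pp (hom_comp hH pH) phS pH.
have uH := hom_comp sH hH.
have pu n x : p (iter n (h \o s)%VF x) = p x.
  by elim: n => //= n <-; rewrite comp_lfunE -comp_lfunE sE.
have [n [Z [i [r [iH rH ri [iterZ Ziter]]]]]] := fitting uH.
have Zp : projective Z.
  apply: projective_in_add Pp _; apply/summand_in_add/summandP.
  by exists i, r.
have iB : bijective i.
  apply: lker0_dim_bij; first by apply/lker0_injP; apply: can_inj ri.
  rewrite dP; apply: dmin; exists Z, (p \o i)%VF; split=> //.
    exact: hom_comp.
  apply/limg_fullP=> m; have [x <-] := proj1 (limg_fullP p) pS m.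
  by have [z e] := iterZ x; exists z; rewrite comp_lfunE -e pu.
apply/limg_fullP => x; have [i' _ i'K] := iB; have [y e] := Ziter (i' x).
exists (s (iter n (h \o s)%VF y)).
by move: e; rewrite i'K iterS comp_lfunE.
Qed.

Lemma exists_min_proj_presentation M :
  exists P1 P0 (p1 : 'Hom(P1, P0)) (p0 : 'Hom(P0, M)),
    min_proj_presentation p1 p0.
Proof.
have [P0 [p0 [P0p p0H p0S p0e]]] := projective_cover M.
have [O [i [iH i0 iI]]] := submodule (lker_stable p0H).
have [P1 [q [P1p qH qS qe]]] := projective_cover O.
exists P1, P0, (i \o q)%VF, p0; split=> //.
- by split=> //; apply: hom_comp.
- by rewrite limg_comp qS iI.
- split=> // Y h hH e; apply: qe => //; apply/eqP.
  rewrite -(@eq_limg_ker0 _ _ _ i) ?i0 //.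
  by rewrite -!limg_comp comp_lfunA e.
Qed.

(** Dual to [ext1_zero_lift]: the pushout [E] along [h] is an extension of P by Z, and its splitting
    retracts it onto Z. *)
Lemma ext1_zero_extend P X Y Z (f : 'Hom(X, Y)) (g : 'Hom(Y, P)) (h : 'Hom(X, Z)) :
  ext1_zero P Z -> ses f g -> is_hom h ->
  exists2 k : 'Hom(Y, Z), is_hom k & forall x, k (f x) = h x.
Proof.
move=> PZ fg hH; have [fH gH f0 e gS] := fg.
have [i [j [p [q [[iH jH] [pH qH] [iE jE] [pE qE]]]]]] := dsum_maps Z Y.
have [d dH dE] := hom_col (hom_opp hH) fH.
have [E [c [cH cS cK]]] := quotient_module (limg_stable dH).
have c0 z y : c (z, y) = 0 -> exists x, z = - h x /\ y = f x.
  move/eqP; rewrite -memv_ker cK => /memv_imgP[x _].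
  by rewrite dE opp_lfunE => -[-> ->]; exists x.
have cd x : c (h x, 0) = c (0, f x).
  apply/eqP; rewrite -subr_eq0 -linearB -memv_ker cK.
  have -> : ((h x, 0) : dsum Z Y) - (0, f x) = d (- x).
    by rewrite dE opp_lfunE !linearN opprK; congr (_, _); rewrite /= ?subr0 ?sub0r.
  by rewrite memv_img ?memvf.
have [|g' g'H g'E] := hom_factor cH (hom_comp qH gH) cS.
  move=> [z y] /c0[x [_ ->]]; rewrite comp_lfunE qE.
  exact: ses_comp0 fg.
have fg' : ses (c \o i)%VF g'.
  split=> //; first exact: hom_comp.
  - apply: lker0_eq0 => z; rewrite comp_lfunE iE => /c0[x [-> ex]].
    have -> : x = 0 by apply: (ses_inj fg); rewrite linear0 -ex.
    by rewrite linear0 oppr0.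
  - apply/vspaceP=> w; rewrite memv_ker.
    have [[z y] <-] := proj1 (limg_fullP c) cS w.
    rewrite g'E comp_lfunE qE; apply/memv_imgP/eqP => [[z' _]|/= gy].
      rewrite comp_lfunE iE => /eqP; rewrite -subr_eq0 -linearB => /eqP/c0.
      by case=> x [_]; rewrite /= subr0 => ->; rewrite (ses_comp0 _ fg).
    have [x fx] := ses_ker fg gy; exists (z + h x); rewrite ?memvf //.
    rewrite comp_lfunE iE -fx.
    have -> : ((z, f x) : dsum Z Y) = (z, 0) + (0, f x).
      by congr (_, _); rewrite /= ?addr0 ?add0r.
    rewrite linearD /= -cd -linearD /=; congr (c _).
    by congr (_, _); rewrite /= ?addr0.
  - apply/limg_fullP=> x; have [y gy] := ses_surj x fg.
    by exists (c (0, y)); rewrite g'E comp_lfunE qE.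
have [phi phiH [phif phig]] := PZ _ _ _ fg'.
have [i' [j' [p' [q' [_ [p'H q'H] _ [p'E q'E]]]]]] := dsum_maps Z P.
exists (p' \o (phi \o (c \o j)))%VF; first by do !apply: hom_comp.
move=> x; have := phif (h x); rewrite comp_lfunE iE => phih.
by rewrite !comp_lfunE jE -cd phih p'E.
Qed.

(** For a minimal projective presentation of M this amounts to Hom(X, tau M) = 0. The same predicate
    expresses the approximation property of a left approximation [p1]. *)
Definition pres_surj P1 P0 (p1 : 'Hom(P1, P0)) X : Prop :=
  forall h : 'Hom(P1, X), is_hom h ->
    exists2 k : 'Hom(P0, X), is_hom k & forall x, k (p1 x) = h x.

Lemma pres_surj_quot P1 P0 (p1 : 'Hom(P1, P0)) X Y (q : 'Hom(X, Y)) :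
  projective P1 -> is_hom q -> limg q = fullv ->
  pres_surj p1 X -> pres_surj p1 Y.
Proof.
move=> P1p qH qS Xs h hH; have [l lH lE] := projective_lift P1p qH qS hH.
have [k kH kE] := Xs l lH; exists (q \o k)%VF; first exact: hom_comp.
by move=> x; rewrite comp_lfunE kE lE.
Qed.

Lemma pres_surj_in_add P1 P0 (p1 : 'Hom(P1, P0)) M X :
  is_hom p1 -> in_add M X -> pres_surj p1 M -> pres_surj p1 X.
Proof.
move=> p1H [I [f [g [fH gH gf]]]] Ms h hH.
have /fin_all_exists[l lP] i :
    exists l : 'Hom(P0, M), is_hom l /\ forall x, l (p1 x) = f i (h x).
  have [l lH lE] := Ms _ (hom_comp hH (fH i)).
  by exists l; split=> // x; rewrite lE comp_lfunE.
exists (\sum_i (g i \o l i)%VF).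
  by apply: hom_sum => i; apply: hom_comp => //; apply: (lP i).1.
move=> x; rewrite sum_lfunE -[RHS]gf; apply: eq_bigr => i _.
by rewrite comp_lfunE (lP i).2.
Qed.

Lemma pres_surj_Fac P1 P0 M X (p1 : 'Hom(P1, P0)) (p0 : 'Hom(P0, M)) U :
  min_proj_presentation p1 p0 -> Fac U X -> pres_surj p1 U -> pres_surj p1 X.
Proof.
case=> [[P1p _] [p1H _] _ _ _] [Y [q [/addP YU qH qS]]] Us.
by apply: pres_surj_quot qH qS _ => //; apply: pres_surj_in_add Us.
Qed.

(** Lift [p0] to the extension. The obstruction to descending to M is a map P1 -> X, and extending
    it to P0 removes it. [P0] is only asked to satisfy Ext^1(P0, X) = 0, so that cokernels of left
    approximations are covered as well. *)
Lemma coker_ext1_zero P1 P0 M X (p1 : 'Hom(P1, P0)) (p0 : 'Hom(P0, M)) :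
  is_hom p1 -> is_hom p0 -> limg p1 = lker p0 -> limg p0 = fullv ->
  ext1_zero P0 X -> pres_surj p1 X -> ext1_zero M X.
Proof.
move=> p1H p0H e p0S P0X Xs; apply: section_ext1_zero => Y f g fg.
have [fH gH _ _ gS] := fg; have [l lH lE] := ext1_zero_lift P0X fg p0H.
have [||h hH hE] := ses_lift (h := (l \o p1)%VF) fg.
- exact: hom_comp.
- move=> x; rewrite comp_lfunE lE; apply/eqP.
  by rewrite -memv_ker -e memv_img ?memvf.
have [k kH kE] := Xs h hH.
have [||s sH sE] := @hom_factor _ _ _ _ _ p0 (l - (f \o k)%VF) p0H _ p0S.
- by apply: hom_sub => //; apply: hom_comp.
- move=> x /eqP; rewrite -memv_ker -e => /memv_imgP[y _ ->].
  by rewrite add_lfunE opp_lfunE comp_lfunE kE hE comp_lfunE subrr.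
exists s => // m; have [x <-] := proj1 (limg_fullP p0) p0S m.
rewrite sE add_lfunE opp_lfunE comp_lfunE linearB /= lE.
by rewrite (ses_comp0 _ fg) subr0.
Qed.

Lemma projective_ext1_zero P X : projective P -> ext1_zero P X.
Proof.
move=> Pp; apply: section_ext1_zero => Y f g [fH gH _ _ gS].
have [s sH sE] := projective_lift Pp gH gS (@hom_id _ _ P).
by exists s => // x; rewrite sE id_lfunE.
Qed.

Lemma pres_surj_ext P1 P0 M X (p1 : 'Hom(P1, P0)) (p0 : 'Hom(P0, M)) :
  min_proj_presentation p1 p0 -> pres_surj p1 X -> ext1_zero M X.
Proof.
case=> [[_ P0p] [p1H p0H] e p0S _].
by apply: coker_ext1_zero p1H p0H e p0S _; apply: projective_ext1_zero.
Qed.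

(* Every h : P1 -> X can be corrected by a map factoring through p1 so that its
   image shrinks into h (ker p1), which is a proper subspace of the image of h,
   because p1 is essential, unless h = 0. *)
Lemma ext_pres_surj P1 P0 M U (p1 : 'Hom(P1, P0)) (p0 : 'Hom(P0, M)) :
  min_proj_presentation p1 p0 -> (forall X, Fac U X -> ext1_zero M X) ->
  forall X, Fac U X -> pres_surj p1 X.
Proof.
case=> [[P1p P0p] [p1H p0H] e p0S [p1e _]] Mext X XU h.
have [n] := ubnP (\dim (limg h)); elim: n h => // n IH h ltn hH.
pose V := (h @: lker p1)%VS.
have Vstable := limg_comp_stable hH (lker_stable p1H).
have [Q [q [qH qS qK]]] := quotient_module Vstable.
have [O [i [iH i0 iI]]] := submodule (lker_stable p0H).
have ip0 : ses i p0 by split.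
have [|r rH rE] := ses_lift (h := p1) ip0 p1H.
  by move=> x; apply/eqP; rewrite -memv_ker -e memv_img ?memvf.
have rS : limg r = fullv.
  apply/limg_fullP=> o; have: i o \in limg p1 by rewrite e -iI memv_img ?memvf.
  by case/memv_imgP=> x _ io; exists x; apply: (ses_inj ip0); rewrite rE.
have [|h' h'H h'E] := hom_factor rH (hom_comp hH qH) rS.
  move=> x rx; apply/eqP; rewrite comp_lfunE -memv_ker qK memv_img //.
  by rewrite memv_ker -rE rx linear0.
have [k kH kE] := ext1_zero_extend (Mext _ (Fac_quot XU qH qS)) ip0 h'H.
have [k' k'H k'E] := projective_lift P0p qH qS kH.
pose h2 : 'Hom(P1, X) := h - (k' \o p1)%VF.
have h2H : is_hom h2 by apply: hom_sub => //; apply: hom_comp.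
have h2V : (limg h2 <= V)%VS.
  apply/subvP=> _ /memv_imgP[x _ ->].
  rewrite /V -qK memv_ker add_lfunE opp_lfunE comp_lfunE linearB /= k'E.
  by rewrite -rE kE h'E comp_lfunE subrr.
have Vh : (V <= limg h)%VS by apply: limgS; apply: subvf.
have [hV|hV] := boolP (limg h <= V)%VS.
  have [Y [j [jH j0 jI]]] := submodule (lker_stable hH).
  have jS : limg j = fullv.
    apply: p1e => //; apply/eqP; rewrite eqEsubv; apply/andP; split.
      by rewrite limg_comp limgS ?subvf.
    apply/subvP=> _ /memv_imgP[x _ ->].
    have: h x \in V by rewrite (subvP hV) // memv_img ?memvf.
    case/memv_imgP=> y yk hxy.
    have: x - y \in limg j by rewrite jI memv_ker linearB /= hxy subrr.
    case/memv_imgP=> z _ ez; apply/memv_imgP; exists z; rewrite ?memvf //.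
    by move: yk; rewrite memv_ker comp_lfunE -ez linearB /= => /eqP->; rewrite subr0.
  exists 0 => [|x]; first exact: hom_0.
  have: x \in limg j by rewrite jS memvf.
  by rewrite jI memv_ker zero_lfunE => /eqP->.
have [|k2 k2H k2E] := IH h2 _ h2H.
  rewrite ltnS in ltn; apply: leq_trans ltn.
  apply: leq_ltn_trans (dimvS h2V) _.
  by rewrite ltn_neqAle dimvS // andbT; apply: contra hV => /eqP dE;
     rewrite -(eqP (_ : V == limg h)) // eqEdim Vh dE /=.
exists (k2 + k'); first exact: hom_add.
by move=> x; rewrite add_lfunE k2E add_lfunE opp_lfunE comp_lfunE subrK.
Qed.

(** * Duality between Hom(X, tau M) and the cokernel of Hom(P0, X) -> Hom(P1, X) *)

Definition rmul M (x : M) : 'Hom(rmod_reg A, M) :=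
  linfun (fun a : rmod_reg A => x *> a).

Lemma rmulE M (x : M) a : rmul x a = x *> a.
Proof.
rewrite /rmul linfun_linearE // => k b c.
by rewrite mact_addr mact_scaler.
Qed.

Lemma rmul_hom M (x : M) : is_hom (rmul x).
Proof. by move=> a b; rewrite !rmulE /= mact_assoc. Qed.

Lemma star_hom M (s : star M) : @is_hom K A M (rmod_reg A) (vsval s).
Proof. exact/homsP/(valP (s : star_space M)). Qed.

Lemma star_map_hom M N (p : 'Hom(M, N)) : is_hom p -> is_hom (star_map p).
Proof.
move=> pH s a; apply/val_inj/lfunP => v.
by rewrite /= (star_actE (star_map p s)) !star_mapE // star_actE.
Qed.

Definition to_star M (f : 'Hom(M, rmod_reg A)) : star M :=
  vsproj (homs M (rmod_reg A)) f.

Lemma to_starE M (f : 'Hom(M, rmod_reg A)) : is_hom f -> vsval (to_star f) = f.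
Proof. by move=> /homsP fH; rewrite vsprojK. Qed.

Lemma exists_transpose M : is_transpose M (tr M).
Proof.
rewrite /tr; apply: epsilon_spec.
have [P1 [P0 [p1 [p0 p10]]]] := exists_min_proj_presentation M.
have [_ [p1H _] _ _ _] := p10.
have [N [q [qH qS qK]]] := quotient_module (limg_stable (star_map_hom p1H)).
by exists N, P1, P0, p1, p0, q.
Qed.

Lemma dual_basis P : projective P ->
  exists (I : finType) (e : I -> P) (phi : I -> 'Hom(P, rmod_reg A)),
    (forall i, is_hom (phi i)) /\ forall x, \sum_i e i *> phi i x = x.
Proof.
case/projective_in_add_reg=> I [f [g [fH gH gf]]].
exists I, (fun i => g i aone), f; split=> // x.
rewrite -[RHS]gf; apply: eq_bigr => i _; rewrite -gH /=.
by rewrite amul_1l.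
Qed.

Lemma star_sum_dual_basis P I (r : seq I) (e : I -> P)
    (phi : I -> 'Hom(P, rmod_reg A)) (s : star P) :
  (forall i, is_hom (phi i)) -> (forall x, \sum_(i <- r) e i *> phi i x = x) ->
  \sum_(i <- r) to_star (phi i) *> (vsval s (e i) : aopp A) = s.
Proof.
move=> phiH ephi; apply/val_inj/lfunP => v; rewrite -[in RHS](ephi v).
rewrite (linear_sum (@vsval _ _ _)) sum_lfunE linear_sum /=.
apply: eq_bigr => i _; rewrite star_actE to_starE // star_hom.
by [].
Qed.

(* The pairing X x P1^* -> Hom(P1, X) sending (x, s) to x s(-) identifies the
   K-dual of Hom(X, tau M) with the cokernel of Hom(P0, X) -> Hom(P1, X). *)
Lemma pres_surj_hom_zero P1 P0 M X (p1 : 'Hom(P1, P0)) (p0 : 'Hom(P0, M))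
    (N : rmod (aopp A)) (q : 'Hom(star P1, N)) :
  min_proj_presentation p1 p0 ->
  is_hom q -> limg (star_map p1) = lker q -> limg q = fullv ->
  pres_surj p1 X -> hom_zero X (dual N).
Proof.
case=> [[P1p P0p] [p1H p0H] _ _ _] qH qK /limg_fullP qS Xs f fH.
have [I [e [phi [phiH ephi]]]] := dual_basis P1p.
have [J [e' [psi [psiH epsi]]]] := dual_basis P0p.
apply/lfunP=> x; rewrite zero_lfunE; apply/lfunP=> n; rewrite zero_lfunE.
have [s <-] := qS n.
have fact y a t : f (y *> a) (q t) = f y (q (t *> (a : aopp A))).
  by rewrite fH /= comp_lfunE mact_linE qH.
have [g gH gE] := Xs _ (hom_comp (star_hom s) (rmul_hom x)).
have gE' i : x *> vsval s (e i) = \sum_j g (e' j) *> psi j (p1 (e i)).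
  have := gE (e i); rewrite comp_lfunE rmulE => <-.
  rewrite -[in LHS](epsi (p1 (e i))) linear_sum; apply: eq_bigr => j _.
  by rewrite /= gH.
rewrite -(star_sum_dual_basis s phiH ephi) linear_sum linear_sum /=.
transitivity (\sum_i \sum_j
    f (g (e' j)) (q (to_star (phi i) *> (psi j (p1 (e i)) : aopp A)))).
  apply: eq_bigr => i _; rewrite -fact gE' linear_sum sum_lfunE.
  by apply: eq_bigr => j _; rewrite /= fact.
rewrite exchange_big big1 //= => j _.
rewrite -linear_sum -linear_sum /=.
have -> : \sum_i to_star (phi i) *> (psi j (p1 (e i)) : aopp A) =
    star_map p1 (to_star (psi j)).
  rewrite -[RHS](star_sum_dual_basis _ phiH ephi); apply: eq_bigr => i _.
  by rewrite star_mapE // to_starE.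
have : star_map p1 (to_star (psi j)) \in lker q by rewrite -qK memv_img ?memvf.
by rewrite memv_ker => /eqP->; rewrite linear0.
Qed.

(** If [h] did not extend to P0, some functional [b] would vanish on all maps that do, but not on
    [h]. Sending x to the functional q s |-> b (x s(-)) is well defined, because q s = q t means
    that s - t comes from P0, and it is a homomorphism X -> D N, hence zero. By the dual basis, [h]
    is a sum of maps x s(-), so b h = 0. *)
Lemma hom_zero_pres_surj P1 P0 M X (p1 : 'Hom(P1, P0)) (p0 : 'Hom(P0, M))
    (N : rmod (aopp A)) (q : 'Hom(star P1, N)) :
  min_proj_presentation p1 p0 ->
  is_hom q -> limg (star_map p1) = lker q -> limg q = fullv ->
  hom_zero X (dual N) -> pres_surj p1 X.
Proof.
case=> [[P1p P0p] [p1H p0H] _ _ _] qH qK qS X0 h hH.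
have [||W WP] := @vspace_of_pred _ 'Hom(P1, X)
    (fun h => exists2 k : 'Hom(P0, X), is_hom k & forall x, k (p1 x) = h x).
- by exists 0 => [|x]; [exact: hom_0 | rewrite !zero_lfunE].
- move=> c u v [k kH kE] [l lH lE]; exists (c *: k + l).
    by apply: hom_add => //; apply: hom_scale.
  by move=> x; rewrite !add_lfunE !scale_lfunE kE lE.
apply/WP; apply: contraT => /separating_functional[b bh bW].
pose q' := (q^-1)%VF.
have q'K n : q (q' n) = n by apply: limg_lfunVK; rewrite qS memvf.
pose m (x : X) (s : star P1) : 'Hom(P1, X) := (rmul x \o vsval s)%VF.
have mE x s v : m x s v = x *> vsval s v by rewrite comp_lfunE rmulE.
have mlin x k s t : m x (k *: s + t) = k *: m x s + m x t.
  apply/lfunP=> v; rewrite add_lfunE scale_lfunE !mE linearP.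
  by rewrite add_lfunE scale_lfunE mact_addr mact_scaler.
have mker x s t : q s = q t -> b (m x s) = b (m x t).
  move/eqP; rewrite -subr_eq0 -linearB -memv_ker -qK => /memv_imgP[u _ stu].
  apply/eqP; rewrite -subr_eq0 -linearB; apply/eqP/bW/WP.
  exists (rmul x \o vsval u)%VF; first exact: hom_comp (star_hom u) (rmul_hom x).
  move=> v; rewrite comp_lfunE rmulE add_lfunE opp_lfunE !mE.
  rewrite -star_mapE // -stu (linearB (@vsval _ _ _)) add_lfunE opp_lfunE.
  by rewrite mact_addr -[- vsval t v]scaleN1r mact_scaler scaleN1r.
pose F x : 'Hom(N, K^o) := linfun (fun n => b (m x (q' n))).
have FE x n : F x n = b (m x (q' n)).
  by rewrite /F linfun_linearE // => k u v; rewrite linearP mlin linearP.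
have [|f fE] := @lfun_of_linear _ X (dual N) F.
  move=> k u v; apply/lfunP=> n; rewrite add_lfunE scale_lfunE !FE -linearP.
  congr (b _); apply/lfunP=> z; rewrite add_lfunE scale_lfunE !mE.
  by rewrite mact_addl mact_scalel.
have fH : is_hom f.
  move=> x a; rewrite !fE; apply/lfunP=> n; rewrite /= comp_lfunE mact_linE !FE.
  have -> : m (x *> a) (q' n) = m x (q' n *> (a : aopp A)).
    by apply/lfunP=> v; rewrite !mE star_actE mact_assoc.
  by apply: mker; rewrite qH !q'K.
have bm x s : b (m x s) = 0.
  rewrite (mker x s (q' (q s))) ?q'K // -FE -fE (X0 f fH).
  by rewrite !zero_lfunE.
have [I [e [phi [phiH ephi]]]] := dual_basis P1p.
case/eqP: bh; have -> : h = \sum_i m (h (e i)) (to_star (phi i)).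
  apply/lfunP=> v; rewrite sum_lfunE -[in LHS](ephi v) linear_sum.
  by apply: eq_bigr => i _; rewrite mE to_starE // -hH.
by rewrite linear_sum big1 // => i _; apply: bm.
Qed.

Lemma tau_rigidP M : is_tau_rigid M <-> ext_rigid M.
Proof.
have [P1 [P0 [p1 [p0 [q [p10 [qH qK qS]]]]]]] := exists_transpose M.
split=> [M0 X XM | Mext].
  apply: (pres_surj_ext p10); apply: (pres_surj_Fac p10 XM).
  exact: hom_zero_pres_surj p10 qH qK qS M0.
apply: (pres_surj_hom_zero p10 qH qK qS).
exact: ext_pres_surj p10 Mext _ (Fac_self M).
Qed.

End Presentations.

(** * Torsion classes and Ext-progenerators *)

Section TorsionClasses.
Variables (K : fieldType) (A : fdalg K).
Implicit Types (M N X Y Z P Q U W : rmod A) (C D T : subcat A).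

(** [progen] is chosen by [epsilon] from the class itself, so classes with the same objects are made
    equal in order to share their progenerator. *)
Lemma subcat_ext C D : eq_subcat C D -> C = D.
Proof.
move=> CD; apply: functional_extensionality => X.
exact/propositional_extensionality/CD.
Qed.

Lemma torsion_quot T X Y (g : 'Hom(X, Y)) : torsion_class T -> T X -> is_hom g ->
  limg g = fullv -> T Y.
Proof.
case=> _ _ Tc TX gH gS; have [Z [f fg]] := kernel_ses gH gS.
by have [|_] := Tc _ _ _ f g; [split | apply].
Qed.

Lemma torsion_ext T X Y Z (f : 'Hom(X, Y)) (g : 'Hom(Y, Z)) : torsion_class T ->
  ses f g -> T X -> T Z -> T Y.
Proof. by case=> _ _ Tc fg; have [|] := Tc _ _ _ f g; first by split. Qed.

Lemma torsion_iso T X Y : torsion_class T -> iso X Y -> T X -> T Y.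
Proof. by case=> Ti _ _; apply: Ti. Qed.

Lemma torsion0 T X : torsion_class T -> T X -> T (rmod0 A).
Proof.
move=> Tt TX; apply: (torsion_quot (g := 0 : 'Hom(X, rmod0 A))) Tt TX _ _.
  exact: hom_0.
by apply/limg_fullP=> v; exists 0; rewrite linear0 [RHS]dim0_eq0.
Qed.

Lemma ses_dsum X Y : exists (i : 'Hom(X, dsum X Y)) (q : 'Hom(dsum X Y, Y)), ses i q.
Proof.
have [i [j [p [q [[iH jH] [pH qH] [iE jE] [pE qE]]]]]] := dsum_maps X Y.
exists i, q; split=> //.
- by apply: lker0_eq0 => x; rewrite iE => -[].
- apply/vspaceP=> -[x y]; rewrite memv_ker qE; apply/memv_imgP/eqP.
    by case=> z _; rewrite iE => -[].
  by move=> /= ->; exists x; rewrite ?memvf ?iE.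
- by apply/limg_fullP=> y; exists (0, y); rewrite qE.
Qed.

Lemma torsion_dsum T X Y : torsion_class T -> T X -> T Y -> T (dsum X Y).
Proof. by move=> Tt; have [i [q]] := ses_dsum X Y; apply: torsion_ext. Qed.

Lemma torsion_summand T X Y : torsion_class T -> summand X Y -> T Y -> T X.
Proof.
move=> Tt /summandP[f [g [fH gH gf]]] TY; apply: torsion_quot Tt TY gH _.
by apply/limg_fullP=> x; exists (f x).
Qed.

Lemma torsion_in_add T M X : torsion_class T -> T M -> in_add M X -> T X.
Proof.
move=> Tt TM /addP; elim=> {X} [X X0|X Y Z XM _ TY ZXY].
  exact: torsion_iso Tt (iso_sym X0) (torsion0 Tt TM).
apply: torsion_iso (Tt) (iso_sym ZXY) _; apply: torsion_dsum => //.
exact: (torsion_summand Tt XM TM).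
Qed.

Lemma torsion_Fac T M X : torsion_class T -> T M -> Fac M X -> T X.
Proof.
move=> Tt TM [Y [p [/addP YM pH pS]]]; apply: (torsion_quot Tt _ pH pS).
exact: torsion_in_add YM.
Qed.

Lemma ext1_zero_dsum P Q X : ext1_zero P X -> ext1_zero Q X ->
  ext1_zero (dsum P Q) X.
Proof.
move=> PX QX; apply: section_ext1_zero => Y f g fg; have [_ gH _ _ _] := fg.
have [i [j [p [q [[iH jH] [pH qH] [iE jE] [pE qE]]]]]] := dsum_maps P Q.
have [s sH sE] := ext1_zero_lift PX fg iH.
have [t tH tE] := ext1_zero_lift QX fg jH.
have [h hH hE] := hom_row sH tH; exists h => // -[x y].
rewrite hE linearD /= sE tE iE jE.
by congr (_, _); rewrite /= ?addr0 ?add0r.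
Qed.

(** For an approximation of least dimension, the image of an endomorphism fixing it still carries an
    approximation, so the endomorphism is onto. *)
Lemma minimal_left_approx T : f_tors T ->
  exists (T0 : rmod A) (t : 'Hom(rmod_reg A, T0)), [/\ T T0, is_hom t,
    forall X (h : 'Hom(rmod_reg A, X)), T X -> is_hom h ->
      exists2 l : 'Hom(T0, X), is_hom l & forall x, l (t x) = h x
    & forall g : 'End(T0), is_hom g -> (forall x, g (t x) = t x) -> bijective g].
Proof.
move=> [Tt Tff].
pose S d := exists (T0 : rmod A) (t : 'Hom(rmod_reg A, T0)), [/\ T T0, is_hom t,
    forall X (h : 'Hom(rmod_reg A, X)), T X -> is_hom h ->
      exists2 l : 'Hom(T0, X), is_hom l & forall x, l (t x) = h x
    & dim T0 = d].
have [|d [[T0 [t [TT0 tH tl dT]]] dmin]] := @nat_min S.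
  have [_ [T0 [t [TT0 tH tl]]]] := Tff (rmod_reg A).
  exists (dim T0), T0, t; split=> // X h TX hH.
  by have [l lH e] := tl _ _ TX hH; exists l => // x; rewrite -e comp_lfunE.
exists T0, t; split=> // g gH gt.
have [Z [p [i [pH iH pS i0 [iI ip]]]]] := image_factor gH.
apply: limg_full_endo_bij; apply/eqP; rewrite eqEdim subvf -iI.
rewrite limg_dim_eq ?i0 ?capv0 // !dimvf dT dmin //.
exists Z, (p \o t)%VF; split=> //.
- exact: torsion_quot pH pS.
- exact: hom_comp.
- move=> X h TX hH; have [l lH lE] := tl _ _ TX hH.
  exists (l \o i)%VF; first exact: hom_comp.
  by move=> x; rewrite !comp_lfunE ip gt.
Qed.

(** Ext-vanishing follows from minimality for T0 and passes to the cokernel T1. The harder point is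
    that the kernel [Y] of a right add P-approximation of X lies in T; this is shown by proving that
    a right T-approximation of [Y] is onto. *)
Lemma exists_ext_progenerator T : f_tors T -> exists P, ext_progenerator T P.
Proof.
move=> Tf; have [Tt Tff] := Tf.
have [T0 [t [TT0 tH tl tmin]]] := minimal_left_approx Tf.
have T0ext X : T X -> ext1_zero T0 X.
  move=> TX; apply: section_ext1_zero => E f g fg.
  have TE := torsion_ext Tt fg TX TT0; have [_ gH _ _ gS] := fg.
  (* The approximation lifts to [E], which is in T, and so extends over T0; by minimality the
     resulting map T0 -> E -> T0 is bijective. *)
  have [s sH sE] := projective_lift (@projective_reg _ A) gH gS tH.
  have [l lH lE] := tl _ _ TE sH.
  have [|k [kH kK k'K]] := hom_inv (hom_comp lH gH).
    apply: tmin => [|x]; first exact: hom_comp.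
    by rewrite comp_lfunE lE sE.
  exists (l \o k)%VF; first exact: hom_comp.
  by move=> x; have := k'K x; rewrite !comp_lfunE.
have [T1 [c [cH cS cK]]] := quotient_module (limg_stable tH).
have TT1 : T T1 by apply: torsion_quot cH cS.
have T1ext X : T X -> ext1_zero T1 X.
  move=> TX; apply: (coker_ext1_zero tH cH) => //; first exact: T0ext.
  by move=> h hH; apply: tl.
pose P := dsum T0 T1.
have TP : T P by apply: torsion_dsum.
exists P; split=> // [X TX|X TX].
  by apply: ext1_zero_dsum; [apply: T0ext | apply: T1ext].
have [P' [p [P'P pH pI pl]]] := right_add_approx P X.
have TP' := torsion_in_add Tt TP P'P.
have [i [j [p1 [p2 [[iH jH] [p1H p2H] [iE jE] [p1E p2E]]]]]] := dsum_maps T0 T1.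
have pS : limg p = fullv.
  apply/eqP; rewrite eqEsubv subvf pI; apply/subvP=> x _.
  have [h hH hE] := reg_hom x; have [l lH lE] := tl _ _ TX hH.
  apply: (subvP (limg_trace (hom_comp p1H lH))).
  apply/memv_imgP; exists (t aone, 0); first exact: memvf.
  by rewrite comp_lfunE p1E lE hE mact_1.
have [Y [f fp]] := kernel_ses pH pS; exists Y, P', f, p.
split; [exact/addP | split=> //].
have [fH _ f0 fI _] := fp.
(* [E] is P' modulo the image of the approximation [r] of Y, so that the kernel of e : E -> X is Y /
   r(S); the aim is that it vanishes. *)
have [[S [r [TS rH rl]]] _] := Tff Y.
have [E [q [qH qS qK]]] := quotient_module (limg_comp_stable fH (limg_stable rH)).
have qfr s : q (f (r s)) = 0.
  by apply/eqP; rewrite -memv_ker qK !memv_img ?memvf.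
have TE : T E := torsion_quot Tt TP' qH qS.
have [|e eH eE] := hom_factor qH pH qS.
  move=> x /eqP; rewrite -memv_ker qK => /memv_imgP[y _ ->].
  exact: ses_comp0 fp.
have [V [v [vH v0 vI]]] := submodule (lker_stable qH).
have vq : ses v q by split.
have TV : T V.
  have [|w wH wE] := ses_lift vq (hom_comp rH fH).
    by move=> s; rewrite comp_lfunE.
  apply: torsion_quot TS wH _ => //; apply/limg_fullP=> z.
  have: v z \in lker q by rewrite -vI memv_img ?memvf.
  rewrite qK => /memv_imgP[_ /memv_imgP[s _ ->] e1]; exists s.
  by apply: (ses_inj vq); rewrite wE comp_lfunE.
(* T0 has no maps to the torsion-free kernel of e. *)
have T0e (m : 'Hom(T0, E)) : is_hom m -> (forall x, e (m x) = 0) ->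
    forall x, m x = 0.
  move=> mH em x; have [m1 m1H m1E] := ext1_zero_lift (T0ext _ TV) vq mH.
  have [|m2 m2H m2E] := ses_lift fp m1H.
    by move=> z; rewrite -eE m1E em.
  have [k kH kE] := rl _ _ TT0 m2H.
  by rewrite -m1E -m2E -kE comp_lfunE qfr.
have e0 z : e z = 0 -> z = 0.
  (* The map a |-> z a extends to [l] on T0. As e l vanishes on t(A), it factors through T1, and
     this factor lifts to P'. Subtracting the lift from [l] leaves a map into the kernel of e, which
     is zero; so [l] factors through [c] and z = l (t 1) = 0. *)
  move=> ez; have [h hH hE] := reg_hom z; have [l lH lE] := tl _ _ TE hH.
  have [||k kH kE] := @hom_factor _ _ _ _ _ c (e \o l)%VF cH _ cS.
  - exact: hom_comp.
  - move=> x /eqP; rewrite -memv_ker cK => /memv_imgP[a _ ->].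
    by rewrite comp_lfunE lE hE eH ez mact0l.
  have [k' k'H k'E] := pl _ (hom_comp p2H kH).
  have lq x : l x = q (k' (0, c x)).
    pose d : 'Hom(T0, E) := l - (q \o (k' \o (j \o c)))%VF.
    have dE y : d y = l y - q (k' (0, c y)).
      by rewrite add_lfunE opp_lfunE !comp_lfunE jE.
    apply/eqP; rewrite -subr_eq0 -dE; apply/eqP/T0e.
      by apply: hom_sub => //; do !apply: hom_comp.
    move=> y; rewrite dE linearB /= eE k'E.
    by rewrite comp_lfunE p2E kE comp_lfunE subrr.
  have: l (t aone) = z by rewrite lE hE mact_1.
  rewrite lq => <-; have -> : c (t aone) = 0.
    by apply/eqP; rewrite -memv_ker cK memv_img ?memvf.
  by rewrite !linear0.
apply: torsion_quot TS rH _ => //; apply/limg_fullP=> y.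
have: f y \in lker q.
  by rewrite memv_ker; apply/eqP/e0; rewrite eE (ses_comp0 _ fp).
rewrite qK => /memv_imgP[_ /memv_imgP[s _ ->] fy].
by exists s; apply: (ses_inj fp).
Qed.

Lemma ext_progenerator_in_add T P Q : torsion_class T -> in_add P Q ->
  in_add Q P -> ext_progenerator T P -> ext_progenerator T Q.
Proof.
move=> Tt PQ QP [TP Pext Pcov]; split=> [|X TX|X TX].
- exact: torsion_in_add PQ.
- by apply: ext1_zero_in_add PQ; apply: Pext.
- have [Y [P' [f [g [/addP PP' fg]]]]] := Pcov X TX.
  exists Y, P', f, g; split=> //; apply/addP; exact: in_add_trans PP'.
Qed.

Lemma exists_basic_ext_progenerator T : f_tors T ->
  exists P, basic P /\ ext_progenerator T P.
Proof.
move=> Tf; have [Tt _] := Tf.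
pose S d := exists P, ext_progenerator T P /\ dim P = d.
have [|d [[P [Pp dP]] dmin]] := @nat_min S.
  by have [P Pp] := exists_ext_progenerator Tf; exists (dim P), P.
exists P; split=> //; apply: basic_of_minimal => Q PQ QP.
rewrite dP; apply: dmin; exists Q; split=> //.
exact: ext_progenerator_in_add Pp.
Qed.

Lemma progen_spec T : f_tors T ->
  basic (progen T) /\ ext_progenerator T (progen T).
Proof. by move/exists_basic_ext_progenerator; apply: epsilon_spec. Qed.

(** A conflation covering Q by add P has its kernel in C, hence splits. Uniqueness of basic
    progenerators and the inclusion of U in add P(Fac U) both come from here. *)
Lemma ext_progenerator_covers C P Q : ext_progenerator C P -> C Q ->
  (forall X, C X -> ext1_zero Q X) -> in_add P Q.
Proof.
move=> [_ _ Pcov] CQ Qext; have [Y [P' [f [g [/addP PP' [CY _ _ fg]]]]]] := Pcov Q CQ.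
have [s sH sE] := ext1_zero_section (Qext _ CY) fg; have [_ gH _ _ _] := fg.
by apply: in_add_summand PP'; apply/summandP; exists s, g.
Qed.

Lemma basic_ext_progenerator_iso C P Q : basic P -> basic Q ->
  ext_progenerator C P -> ext_progenerator C Q -> iso P Q.
Proof.
move=> Pb Qb Pp Qp; have [CP Pext _] := Pp; have [CQ Qext _] := Qp.
apply: basic_add_iso => //; first exact: ext_progenerator_covers Qp CP Pext.
exact: ext_progenerator_covers Pp CQ Qext.
Qed.

Lemma progen_iso T P : f_tors T -> basic P -> ext_progenerator T P ->
  iso (progen T) P.
Proof.
by move=> Tf Pb Pp; have [? ?] := progen_spec Tf; apply: basic_ext_progenerator_iso Pp.
Qed.

Lemma Fac_ext_progenerator T P : torsion_class T -> ext_progenerator T P ->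
  eq_subcat (Fac P) T.
Proof.
move=> Tt [TP _ Pcov] X; split=> [|TX]; first exact: torsion_Fac.
have [Y [P' [f [g [PP' [_ _ _ [_ gH _ _ gS]]]]]]] := Pcov X TX.
by exists P', g.
Qed.

Lemma T1_torsion T : torsion_class T -> eq_subcat (T1 T) T.
Proof. by move=> Tt X; split=> [T1X | TX T' _]; [apply: T1X | apply]. Qed.

Lemma torsion_twofold T : torsion_class T -> twofold_torsion_class T.
Proof.
move=> Tt; exists T => //; split=> // [X Y|X Y Z f g [_ _ _ fg]].
  exact: torsion_iso.
split; first exact: (torsion_ext Tt fg).
by case: fg => _ gH _ _ gS TY; apply: torsion_quot gH gS.
Qed.

Lemma f_tors_fL2 T : f_tors T -> fL2_tors_star T.
Proof.
move=> Tf; have [Tt _] := Tf; split; first exact: torsion_twofold.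
  by rewrite (subcat_ext (T1_torsion Tt)).
move=> X P f TX [+ _ _] _; rewrite (subcat_ext (T1_torsion Tt)) => /addP.
by have [_ [TP _ _]] := progen_spec Tf; apply: torsion_in_add.
Qed.

End TorsionClasses.

(** * The classes [cok1 U] *)

Section Cokernels.
Variables (K : fieldType) (A : fdalg K).
Implicit Types (M N X Y Z P Q U W : rmod A).

(** The image of M1 -> M0 is an arbitrary member of Fac U. Closure properties of [cok1 U] thereby
    reduce to those of the torsion class Fac U, applied to kernels. *)
Lemma cok1P U X : cok1 U X <-> exists M Z (i : 'Hom(Z, M)) (g : 'Hom(M, X)),
  [/\ in_add U M, Fac U Z & ses i g].
Proof.
split=> [[M1 [M0 [f [g [[/addP UM1 /addP UM0] [fH gH] e gS]]]]]|].
  have [Z [p [i [pH iH pS i0 [iI ip]]]]] := image_factor fH.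
  exists M0, Z, i, g; split=> //; last by split=> //; rewrite iI.
  by apply: Fac_quot pH pS; apply: in_add_Fac.
move=> [M [Z [i [g [UM [Y [p [UY pH pS]]] [iH gH i0 e gS]]]]]].
exists Y, M, (i \o p)%VF, g; split=> //; first by split=> //; apply/addP.
  by split=> //; apply: hom_comp.
by rewrite limg_comp pS.
Qed.

Lemma cok1_Fac U X : cok1 U X -> Fac U X.
Proof.
case/cok1P=> M [Z [i [g [UM _ [_ gH _ _ gS]]]]].
by apply: Fac_quot gH gS; apply: in_add_Fac.
Qed.

Lemma cok1_iso U X Y : iso X Y -> cok1 U X -> cok1 U Y.
Proof.
move=> [h hH hB] /cok1P[M [Z [i [g [UM UZ [iH gH i0 e gS]]]]]]; apply/cok1P.
exists M, Z, i, (h \o g)%VF; split=> //; split=> //.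
- exact: hom_comp.
- rewrite e; apply/vspaceP=> m; rewrite !memv_ker comp_lfunE.
  apply/eqP/eqP=> [-> | hg]; first by rewrite linear0.
  by apply: (bij_inj hB); rewrite hg linear0.
- by rewrite limg_comp gS bij_limg.
Qed.

Lemma cok1_in_add U X : in_add U X -> cok1 U X.
Proof.
move=> UX; apply/cok1P; exists X, (rmod0 A), 0, \1%VF; split=> //.
  by apply: in_add_Fac; apply: in_add0.
split; [exact: hom_0 | exact: hom_id | | |].
- by apply: lker0_eq0 => v _; apply: dim0_eq0.
- apply/vspaceP=> v; rewrite memv_ker id_lfunE; apply/memv_imgP/eqP=> [[x _ ->]|->].
    by rewrite zero_lfunE.
  by exists 0; rewrite ?memvf ?linear0.
- by apply/limg_fullP=> x; exists x; rewrite id_lfunE.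
Qed.

(** Horseshoe argument: the cover of M lifts to Y because Ext^1(MM, X) = 0, and the kernel of MX +
    MM -> Y is an extension of ZM by ZX. *)
Lemma cok1_ext U X Y M (f : 'Hom(X, Y)) (g : 'Hom(Y, M)) :
  ext_rigid U ->
  ses f g -> cok1 U X -> cok1 U M -> cok1 U Y.
Proof.
move=> Uext fg UX; have {}XU := cok1_Fac UX; have [fH gH _ _ _] := fg.
case/cok1P: UX => MX [ZX [iX [gX [UMX UZX sX]]]].
case/cok1P=> MM [ZM [iM [gM [UMM UZM sM]]]].
have [iXH gXH _ _ _] := sX; have [iMH gMH _ _ _] := sM.
have MMX : ext1_zero MM X by apply: ext1_zero_in_add UMM; apply: Uext.
have [l lH lE] := ext1_zero_lift MMX fg gMH.
have [h hH hE] := hom_row (hom_comp gXH fH) lH.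
have gh a b : g (h (a, b)) = gM b.
  by rewrite hE linearD /= comp_lfunE (ses_comp0 _ fg) add0r lE.
have hS : limg h = fullv.
  apply/limg_fullP=> y; have [b gMb] := ses_surj (g y) sM.
  have [|x fx] := ses_ker (y := y - l b) fg; first by rewrite linearB /= lE gMb subrr.
  have [a gXa] := ses_surj x sX; exists (a, b).
  by rewrite hE comp_lfunE /= gXa fx subrK.
have [Z [j jh]] := kernel_ses hH hS; have [jH _ _ _ _] := jh.
apply/cok1P; exists (dsum MX MM), Z, j, h; split=> //; first exact: in_add_dsum.
have [i1 [i2 [p [q [[i1H i2H] [pH qH] [i1E i2E] [pE qE]]]]]] := dsum_maps MX MM.
have [|w wH wE] := ses_lift sM (hom_comp jH qH).
  move=> z; rewrite comp_lfunE qE -(gh (j z).1).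
  by case: (j z) (ses_comp0 z jh) => a b /= ->; rewrite linear0.
have [|u uH uE] := ses_lift jh (hom_comp iXH i1H).
  move=> z; rewrite comp_lfunE i1E hE comp_lfunE /= (ses_comp0 _ sX).
  by rewrite !linear0 addr0.
have uw : ses u w.
  split=> //.
  - apply: lker0_eq0 => z uz; apply: (ses_inj sX); rewrite linear0.
    by have := uE z; rewrite uz linear0 comp_lfunE i1E => -[].
  - apply/vspaceP=> z; rewrite memv_ker; apply/memv_imgP/eqP=> [[x _ ->]|wz].
      by apply: (ses_inj sM); rewrite wE linear0 comp_lfunE uE comp_lfunE i1E qE.
    have jz2 : (j z).2 = 0 by rewrite -qE -comp_lfunE -wE wz linear0.
    have [|x ix] := ses_ker (y := (j z).1) sX.
      apply: (ses_inj fg); rewrite linear0.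
      by have := ses_comp0 z jh; rewrite hE jz2 linear0 addr0 comp_lfunE.
    exists x; rewrite ?memvf //; apply: (ses_inj jh).
    by rewrite uE comp_lfunE i1E ix -jz2; case: (j z).
  - apply/limg_fullP=> z; have [|x fx] := ses_ker (y := l (iM z)) fg.
      by rewrite lE (ses_comp0 _ sM).
    have [a gXa] := ses_surj x sX.
    have [|v jv] := ses_ker (y := ((- a, iM z) : dsum MX MM)) jh.
      by rewrite hE comp_lfunE /= !linearN /= gXa fx addNr.
    exists v; apply: (ses_inj sM).
    by rewrite wE comp_lfunE jv qE.
exact: (Fac_ext uw (Uext _ UZX) UZX UZM).
Qed.

(** The cover MY of Y also covers M, with kernel an extension of X by the kernel ZY of MY -> Y. *)
Lemma cok1_quot U X Y M (f : 'Hom(X, Y)) (g : 'Hom(Y, M)) :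
  ext_rigid U ->
  ses f g -> Fac U X -> cok1 U Y -> cok1 U M.
Proof.
move=> Uext fg XU /cok1P[MY [ZY [iY [gY [UMY UZY sY]]]]].
have [fH gH _ _ gS] := fg; have [iYH gYH _ _ gYS] := sY.
have ggH := hom_comp gYH gH.
have ggS : limg (g \o gY)%VF = fullv by rewrite limg_comp gYS.
have [Z [j jg]] := kernel_ses ggH ggS; have [jH _ _ _ _] := jg.
apply/cok1P; exists MY, Z, j, (g \o gY)%VF; split=> //.
have [|v vH vE] := ses_lift fg (hom_comp jH gYH).
  by move=> z; rewrite comp_lfunE; have := ses_comp0 z jg; rewrite comp_lfunE.
have [|u uH uE] := ses_lift jg iYH.
  by move=> z; rewrite comp_lfunE (ses_comp0 _ sY) linear0.
have uv : ses u v.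
  split=> //.
  - apply: lker0_eq0 => z uz; apply: (ses_inj sY).
    by rewrite -uE uz !linear0.
  - apply/vspaceP=> z; rewrite memv_ker; apply/memv_imgP/eqP=> [[x _ ->]|vz].
      by apply: (ses_inj fg); rewrite vE linear0 comp_lfunE uE (ses_comp0 _ sY).
    have [|x ix] := ses_ker (y := j z) sY.
      by rewrite -comp_lfunE -vE vz linear0.
    by exists x; rewrite ?memvf //; apply: (ses_inj jg); rewrite uE.
  - apply/limg_fullP=> x; have [m gYm] := ses_surj (f x) sY.
    have [|z jz] := ses_ker (y := m) jg.
      by rewrite comp_lfunE gYm (ses_comp0 _ fg).
    by exists z; apply: (ses_inj fg); rewrite vE comp_lfunE jz.
exact: (Fac_ext uv (Uext _ UZY) UZY XU).
Qed.

Lemma T1_cok1 U : ext_rigid U ->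
  eq_subcat (Fac U) (T1 (cok1 U)).
Proof.
move=> Uext X; split=> [XU T Tt UT | ].
  by apply: torsion_Fac XU => //; apply/UT/cok1_in_add/in_add_refl.
by apply; [exact: torsion_class_Fac | move=> Y; apply: cok1_Fac].
Qed.

(** For the condition on approximations, take a cover M -> X by add U with kernel in Fac U. It
    factors through [f], as U lies in add P(Fac U), and [f] lifts to M by Ext-vanishing. Minimality
    makes the composite P -> M -> P bijective, so P is in add U. *)
Lemma cok1_fL2 U : ext_rigid U -> fL2_tors_star (cok1 U).
Proof.
move=> Uext; have Uf := f_tors_Fac Uext.
have T1E := subcat_ext (T1_cok1 Uext); split; last 1 first.
- move=> X P f UX [/addP PP fH fl] fmin; apply: cok1_in_add.
  move: fl PP; rewrite -T1E => fl PP.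
  have [_ Pg] := progen_spec Uf; have [PU Pext _] := Pg.
  case/cok1P: UX => M [Z [i [g [UM UZ s]]]]; have [iH gH _ _ gS] := s.
  have PM : in_add (progen (Fac U)) M.
    apply: in_add_trans UM; apply: ext_progenerator_covers Pg _ Uext.
    exact: Fac_self.
  have [a aH ga] := fl _ _ (proj2 (addP _ _) PM) gH.
  have PZ : ext1_zero P Z by apply: ext1_zero_in_add PP; apply: Pext.
  have [b bH gb] := ext1_zero_lift PZ s fH.
  have abB : bijective (a \o b)%VF.
    apply: fmin; first exact: hom_comp.
    by apply/lfunP=> x; rewrite comp_lfunA ga comp_lfunE gb.
  by apply: in_add_summand UM; apply: bij_comp_summand abB.
- exists (Fac U); first by case: Uf.
  split; [exact: cok1_iso | exact: cok1_Fac |].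
  move=> X Y M f g [XU YU MU fg]; split; first exact: (cok1_ext Uext fg).
  exact: (cok1_quot Uext fg XU).
- by rewrite -T1E.
Qed.

Lemma cok1_ext_progenerator U : ext_progenerator (Fac U) U ->
  eq_subcat (cok1 U) (Fac U).
Proof.
case=> _ _ Ucov X; split; first exact: cok1_Fac.
move=> /Ucov[Y [P [f [g [/addP UP [YU _ _ fg]]]]]].
by apply/cok1P; exists P, Y, f, g.
Qed.

Lemma Fac_co_bongartz U : ext_rigid U ->
  eq_subcat (Fac (co_bongartz U)) (Fac U).
Proof.
move=> Uext; have Uf := f_tors_Fac Uext; have [_ Pg] := progen_spec Uf.
by apply: Fac_ext_progenerator Pg; case: Uf.
Qed.

End Cokernels.

(** * Counting indecomposable summands *)

Section HomDimensions.
Variables (K : fieldType) (A : fdalg K).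
Implicit Types M N X Y Z P Q U W : rmod A.

Definition hom_dim M X : nat := \dim (homs M X).

Definition precompl M N X (p : 'Hom(M, N)) : 'Hom('Hom(N, X), 'Hom(M, X)) :=
  linfun (fun f : 'Hom(N, X) => (f \o p)%VF).

Definition postcompl P Y Z (e : 'Hom(Y, Z)) : 'Hom('Hom(P, Y), 'Hom(P, Z)) :=
  linfun (fun f : 'Hom(P, Y) => (e \o f)%VF).

Lemma precomplE M N X (p : 'Hom(M, N)) (f : 'Hom(N, X)) :
  precompl X p f = (f \o p)%VF.
Proof.
rewrite /precompl linfun_linearE // => k u v.
by rewrite comp_lfunDl -comp_lfunZl.
Qed.

Lemma postcomplE P Y Z (e : 'Hom(Y, Z)) (f : 'Hom(P, Y)) :
  postcompl P e f = (e \o f)%VF.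
Proof.
rewrite /postcompl linfun_linearE // => k u v.
by rewrite comp_lfunDr -comp_lfunZr.
Qed.

(** Rank-nullity for the map Hom(P0, X) -> Hom(P1, X), whose kernel is Hom(M, X). *)
Lemma hom_dim_right_exact P1 P0 M X (p1 : 'Hom(P1, P0)) (p0 : 'Hom(P0, M)) :
  is_hom p1 -> is_hom p0 -> limg p1 = lker p0 -> limg p0 = fullv ->
  pres_surj p1 X -> hom_dim P0 X = (hom_dim M X + hom_dim P1 X)%N.
Proof.
move=> p1H p0H e p0S Xs.
rewrite /hom_dim -(limg_ker_dim (precompl X p1) (homs P0 X)).
have -> : (precompl X p1 @: homs P0 X)%VS = homs P1 X.
  apply/vspaceP=> h; apply/memv_imgP/idP=> [[k /homsP kH ->]|/homsP hH].
    by apply/homsP; rewrite precomplE; apply: hom_comp.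
  have [k kH kE] := Xs h hH; exists k; first exact/homsP.
  by rewrite precomplE; apply/lfunP=> x; rewrite comp_lfunE kE.
congr addn.
have p0_0 : lker (precompl X p0) = 0%VS.
  apply: lker0_eq0 => f; rewrite precomplE => fp; apply/lfunP=> m.
  have [x <-] := proj1 (limg_fullP p0) p0S m.
  by rewrite -comp_lfunE fp !zero_lfunE.
rewrite -(limg_dim_eq (f := precompl X p0) (U := homs M X)) ?p0_0 ?capv0 //.
congr (\dim _); apply/vspaceP=> k; rewrite memv_cap memv_ker precomplE.
apply/andP/memv_imgP=> [[/homsP kH /eqP kp1]|[f /homsP fH ->]].
  have [|f fH fE] := hom_factor p0H kH p0S.
    move=> x /eqP; rewrite -memv_ker -e => /memv_imgP[y _ ->].
    by rewrite -comp_lfunE kp1 zero_lfunE.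
  exists f; first exact/homsP.
  by apply/lfunP=> x; rewrite precomplE comp_lfunE fE.
rewrite precomplE; split; first by apply/homsP; apply: hom_comp.
apply/eqP/lfunP=> x; rewrite !comp_lfunE zero_lfunE.
have: p1 x \in lker p0 by rewrite -e memv_img ?memvf.
by rewrite memv_ker => /eqP->; rewrite linear0.
Qed.

Lemma hom_dim_ses P X Y Z (f : 'Hom(X, Y)) (g : 'Hom(Y, Z)) :
  ses f g -> ext1_zero P X -> hom_dim P Y = (hom_dim P X + hom_dim P Z)%N.
Proof.
move=> fg PX; have [fH gH f0 e gS] := fg.
rewrite /hom_dim -(limg_ker_dim (postcompl P g) (homs P Y)); congr addn.
  have pf0 : lker (postcompl P f) = 0%VS.
    apply: lker0_eq0 => h; rewrite postcomplE => fh; apply/lfunP=> x.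
    apply: (ses_inj fg); rewrite -comp_lfunE fh !zero_lfunE.
    by rewrite linear0.
  rewrite -(limg_dim_eq (f := postcompl P f) (U := homs P X)) ?pf0 ?capv0 //.
  congr (\dim _); apply/vspaceP=> k; rewrite memv_cap memv_ker postcomplE.
  apply/andP/memv_imgP=> [[/homsP kH /eqP gk]|[h /homsP hH ->]].
    have [|h hH hE] := ses_lift fg kH.
      by move=> x; rewrite -comp_lfunE gk zero_lfunE.
    exists h; first exact/homsP.
    by apply/lfunP=> x; rewrite postcomplE comp_lfunE hE.
  rewrite postcomplE; split; first by apply/homsP; apply: hom_comp.
  by apply/eqP/lfunP=> x; rewrite !comp_lfunE zero_lfunE (ses_comp0 _ fg).
congr (\dim _).
apply/vspaceP=> h; apply/memv_imgP/idP=> [[k /homsP kH ->]|/homsP hH].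
  by apply/homsP; rewrite postcomplE; apply: hom_comp.
have [k kH kE] := ext1_zero_lift PX fg hH; exists k; first exact/homsP.
by rewrite postcomplE; apply/lfunP=> x; rewrite comp_lfunE kE.
Qed.

(** [e] may have a kernel, as long as no nonzero map from P lands in it; [rigid_num_indec_leq]
    relies on this generality. *)
Lemma hom_dim_lift_eq P Y Z (e : 'Hom(Y, Z)) : is_hom e ->
  (forall m : 'Hom(P, Y), is_hom m -> (forall x, e (m x) = 0) ->
     forall x, m x = 0) ->
  (forall u : 'Hom(P, Z), is_hom u ->
     exists2 l : 'Hom(P, Y), is_hom l & forall x, e (l x) = u x) ->
  hom_dim P Y = hom_dim P Z.
Proof.
move=> eH e0 el; rewrite /hom_dim -(limg_dim_eq (f := postcompl P e)); last first.
  apply/eqP; rewrite -subv0; apply/subvP=> m; rewrite memv_cap memv_ker postcomplE.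
  case/andP=> /homsP mH /eqP em; rewrite memv0; apply/eqP/lfunP=> x.
  by rewrite zero_lfunE e0 // => y; rewrite -comp_lfunE em zero_lfunE.
congr (\dim _).
apply/vspaceP=> h; apply/memv_imgP/idP=> [[k /homsP kH ->]|/homsP hH].
  by apply/homsP; rewrite postcomplE; apply: hom_comp.
have [k kH kE] := el h hH; exists k; first exact/homsP.
by rewrite postcomplE; apply/lfunP=> x; rewrite comp_lfunE kE.
Qed.

Lemma hom_dim_nonlift_lt P Y Z (e : 'Hom(Y, Z)) (u : 'Hom(P, Z)) : is_hom e ->
  (forall m : 'Hom(P, Y), is_hom m -> (forall x, e (m x) = 0) ->
     forall x, m x = 0) ->
  is_hom u -> (forall l : 'Hom(P, Y), is_hom l -> ~ forall x, e (l x) = u x) ->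
  (hom_dim P Y < hom_dim P Z)%N.
Proof.
move=> eH e0 uH ul; rewrite /hom_dim -(limg_dim_eq (f := postcompl P e)); last first.
  apply/eqP; rewrite -subv0; apply/subvP=> m; rewrite memv_cap memv_ker postcomplE.
  case/andP=> /homsP mH /eqP em; rewrite memv0; apply/eqP/lfunP=> x.
  by rewrite zero_lfunE e0 // => y; rewrite -comp_lfunE em zero_lfunE.
have sub : (postcompl P e @: homs P Y <= homs P Z)%VS.
  apply/subvP=> _ /memv_imgP[k /homsP kH ->].
  by apply/homsP; rewrite postcomplE; apply: hom_comp.
rewrite ltn_neqAle dimvS // andbT; apply/negP=> /eqP dE.
have: u \in homs P Z by apply/homsP.
have /eqP <- : (postcompl P e @: homs P Y)%VS == homs P Z by rewrite eqEdim sub dE /=.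
case/memv_imgP=> l /homsP lH; rewrite postcomplE => ue.
by case: (ul l lH) => x; rewrite ue comp_lfunE.
Qed.

Lemma hom_dim0 P X : dim P = 0%N -> hom_dim P X = 0%N.
Proof.
move=> d0; apply/eqP; rewrite dimv_eq0 -subv0; apply/subvP=> f _.
by rewrite memv0; apply/eqP/lfunP=> x; rewrite (dim0_eq0 x d0) !linear0.
Qed.

Lemma hom_dim_dsum M N X : hom_dim (dsum M N) X = (hom_dim M X + hom_dim N X)%N.
Proof.
have [i [j [p [q [[iH jH] [pH qH] [iE jE] [pE qE]]]]]] := dsum_maps M N.
rewrite addnC; apply: (hom_dim_right_exact iH qH).
- apply/vspaceP=> -[x y]; rewrite memv_ker qE; apply/memv_imgP/eqP.
    by case=> z _; rewrite iE => -[].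
  by move=> /= ->; exists x; rewrite ?memvf ?iE.
- by apply/limg_fullP=> y; exists (0, y); rewrite qE.
- move=> h hH; exists (h \o p)%VF; first exact: hom_comp.
  by move=> x; rewrite comp_lfunE pE iE.
Qed.

Lemma hom_dim_iso M N X : iso M N -> hom_dim M X = hom_dim N X.
Proof.
case=> f fH fB; have f0 := bij_lker0 fB.
rewrite (hom_dim_right_exact (@hom_0 _ _ (rmod0 A) M) fH _ (bij_limg fB)).
- by rewrite (@hom_dim0 (rmod0 A)) ?addn0.
- by rewrite f0 lim0g.
- move=> h hH; exists 0; first exact: hom_0.
  by move=> x; rewrite (@dim0_eq0 _ _ (rmod0 A) x) ?linear0.
Qed.

Lemma hom_dim_expand m (N : 'I_m -> rmod A) M Y :
  (forall X, indecomposable X -> summand X M -> exists i, iso X (N i)) ->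
  in_add M Y ->
  exists a : 'I_m -> nat, forall X, hom_dim Y X = (\sum_i a i * hom_dim (N i) X)%N.
Proof.
move=> NM; have [n] := ubnP (dim Y); elim: n Y => // n IH Y ltn YM.
have [d0|Y0] := posnP (dim Y).
  by exists (fun=> 0%N) => X; rewrite hom_dim0 // big1.
have [Z Zi [Y' YZ]] := exists_indec_summand Y0.
have ZM : in_add M Z by apply: in_add_summand YM; exists Y'.
have [i Zi'] := NM _ Zi (in_add_indec Zi ZM).
have [||a aE] := IH Y'.
- rewrite ltnS in ltn; apply: leq_trans ltn.
  by rewrite (iso_dim YZ) dim_dsum -add1n leq_add2r indec_nonzero.
- apply: in_add_summand YM; apply: summand_trans (summand_dsumr Z Y') _.
  exact/iso_summand/iso_sym.
exists (fun k => (k == i) + a k)%N => X.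
rewrite (hom_dim_iso X YZ) hom_dim_dsum aE (hom_dim_iso X Zi').
under [RHS]eq_bigr => k _ do rewrite mulnDl.
rewrite big_split /=; congr addn.
rewrite (bigD1 i) //= eqxx mul1n big1 ?addn0 // => k /negbTE->.
by rewrite mul0n.
Qed.

(** * Comparing numbers of indecomposable summands through hom dimensions *)

Lemma diag_rank_leq (m n : nat) (G : 'M[rat]_(m, n)) (D : 'M[rat]_(n, m)) :
  (forall k i, k != i -> (G *m D) k i = 0) ->
  (forall i, (G *m D) i i != 0) -> (m <= n)%N.
Proof.
move=> off diag; have e : G *m D = diag_mx (\row_i (G *m D) i i).
  apply/matrixP=> k i; rewrite [RHS]mxE [in RHS]mxE.
  by have [->|ki] := eqVneq k i; rewrite ?mulr1n // mulr0n off.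
have : G *m D \in unitmx.
  rewrite e unitmxE det_diag unitfE; apply/prodf_neq0 => i _.
  by rewrite mxE.
rewrite -row_free_unit => /eqP <-.
exact: leq_trans (mxrankM_maxl _ _) (rank_leq_col _).
Qed.

(* The matrix of the differences a - b maps the vector of hom dimensions over Q
   to that over N, and the pairs (X i, Y i) show that it has rank m. *)
Lemma hom_dim_count m n (N : 'I_m -> rmod A) (Q : 'I_n -> rmod A) (T : subcat A) :
  (forall i, exists a b : 'I_n -> nat, forall X, T X ->
     (hom_dim (N i) X + \sum_j b j * hom_dim (Q j) X =
      \sum_j a j * hom_dim (Q j) X)%N) ->
  (forall i, exists X Y, [/\ T X, T Y,
     forall k, k != i -> hom_dim (N k) X = hom_dim (N k) Y
     & (hom_dim (N i) Y < hom_dim (N i) X)%N]) -> (m <= n)%N.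
Proof.
move=> /fin_all_exists[a] /fin_all_exists[b ab] /fin_all_exists[X].
move=> /fin_all_exists[Y XY].
pose G : 'M[rat]_(m, n) := \matrix_(i, j) ((a i j)%:R - (b i j)%:R).
pose D : 'M[rat]_(n, m) :=
  \matrix_(j, i) ((hom_dim (Q j) (X i))%:R - (hom_dim (Q j) (Y i))%:R).
have GDE k i : (G *m D) k i =
    (hom_dim (N k) (X i))%:R - (hom_dim (N k) (Y i))%:R.
  have hE Z : T Z -> (hom_dim (N k) Z)%:R =
      \sum_j ((a k j)%:R - (b k j)%:R) * (hom_dim (Q j) Z)%:R :> rat.
    move=> TZ; have /(congr1 (fun d : nat => d%:R : rat)) := ab k Z TZ.
    rewrite /= natrD !natr_sum => /(canRL (addrK _))->.
    rewrite -sumrB; apply: eq_bigr => j _.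
    by rewrite !natrM mulrBl.
  have [TX TY _ _] := XY i; rewrite mxE hE // hE // -sumrB.
  by apply: eq_bigr => j _; rewrite !mxE mulrBr.
apply: (@diag_rank_leq _ _ G D) => [k i ki|i]; rewrite GDE.
  by have [_ _ e _] := XY i; rewrite (e k ki) subrr.
have [_ _ _ lt] := XY i; rewrite subr_eq0 Num.Theory.eqr_nat.
by rewrite eq_sym (ltn_eqF lt).
Qed.

(** [r] is a right approximation of N by radical maps from add M. The space [W] consists of the maps
    h : M -> N with no h s bijective; it is closed under addition because End(N) is local. *)
Lemma radical_map M N : indecomposable N ->
  exists (R : rmod A) (r : 'Hom(R, N)), [/\ in_add M R, is_hom r,
    forall N' (u : 'Hom(N', N)), indecomposable N' -> summand N' M ->
      is_hom u -> ~ bijective u ->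
      exists2 l : 'Hom(N', R), is_hom l & forall x, r (l x) = u x
    & forall s : 'Hom(N, R), is_hom s -> ~ bijective (r \o s)%VF].
Proof.
move=> Ni.
have [||W WP] := @vspace_of_pred _ 'Hom(M, N)
    (fun h => is_hom h /\ forall s : 'Hom(N, M), is_hom s -> ~ bijective (h \o s)%VF).
- split=> [|s sH]; first exact: hom_0.
  rewrite comp_lfun0l => /bij_lker0 e0; have := indec_nonzero Ni.
  rewrite -dimvf lt0n => /negP[]; rewrite dimv_eq0 -subv0 -e0.
  by apply/subvP=> v _; rewrite memv_ker zero_lfunE.
- move=> k u v [uH ur] [vH vr]; split.
    by apply: hom_add => //; apply: hom_scale.
  move=> s sH; rewrite comp_lfunDl -comp_lfunZl comp_lfunZr => B.
  have ksH : is_hom (k *: s) by apply: hom_scale.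
  have [||b|b] := indec_local Ni _ _ B; try exact: hom_comp.
    by apply: ur ksH _.
  by apply: vr sH _.
have [|R [r [RM rH rl [I [h [q [hs qH rE]]]]]]] := @row_maps _ _ M N (vbasis W).
  by move=> h /vbasis_mem/WP[].
exists R, r; split=> // [N' u N'i /summandP[f [g [fH gH gf]]] uH ub|s sH rs].
  have [|l lH lE] := rl (u \o g)%VF.
    rewrite (span_basis (vbasisP W)); apply/WP; split; first exact: hom_comp.
    move=> s sH; rewrite -comp_lfunA => b.
    by have [] := bij_comp_indec Ni N'i (hom_comp sH gH) uH b.
  exists (l \o f)%VF; first exact: hom_comp.
  by move=> x; rewrite comp_lfunE lE comp_lfunE gf.
have [||i] := @indec_local_sum _ _ N I (index_enum I) (fun i => h i \o (q i \o s))%VF Ni.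
- by move=> i; have [] := proj1 (WP _) (vbasis_mem (hs i)) => *; do !apply: hom_comp.
- have -> // : \sum_i (h i \o (q i \o s))%VF = (r \o s)%VF.
  apply/lfunP=> x; rewrite sum_lfunE comp_lfunE rE; apply: eq_bigr => i _.
  by rewrite !comp_lfunE.
by have [_ hr] := proj1 (WP _) (vbasis_mem (hs i)); apply: hr; apply: hom_comp.
Qed.

(** The test pair for N i is (N i, Y), with Y the source R of the radical map [r] modulo the trace
    of M in ker r. Maps N k -> N i with k != i factor through [r], hence through Y, while the
    identity of N i does not. *)
Lemma rigid_num_indec_leq M m n :
  ext_rigid M ->
  num_indec M m -> num_indec (rmod_reg A) n -> (m <= n)%N.
Proof.
move=> Mext [N [Nprop Ninj Nall]] [Q [_ _ Qall]].
have NM i : in_add M (N i) by apply: summand_in_add; case: (Nprop i).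
apply: (@hom_dim_count _ _ N Q (Fac M)) => i.
  have [P1 [P0 [p1 [p0 p10]]]] := exists_min_proj_presentation (N i).
  have [[P1p P0p] [p1H p0H] e p0S _] := p10.
  have [a aE] := hom_dim_expand Qall (projective_in_add_reg P0p).
  have [b bE] := hom_dim_expand Qall (projective_in_add_reg P1p).
  exists a, b => X XM; rewrite -aE -bE; apply/esym.
  apply: hom_dim_right_exact p1H p0H e p0S _.
  apply: (ext_pres_surj p10 _ XM) => Y YM.
  by apply: ext1_zero_in_add (NM i); apply: Mext.
have [Ni NiM] := Nprop i.
have [R [r [RM rH rl rs]]] := radical_map M Ni.
(* The image of [r] would not do in place of Y, since [r] may be onto. Dividing only by the trace
   [S] lets maps N k -> Y lift to R, as Ext^1(N k, S) = 0; a lift that lands in ker r has its image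
   in S, so no nonzero map from N k reaches the kernel of e. *)
have [Z [z [zH z0 zI]]] := submodule (lker_stable rH).
have [S [s [sH s0 sI SM]]] := trace_module M Z.
have wH := hom_comp sH zH.
have [Y [q [qH qS qK]]] := quotient_module (limg_stable wH).
have wq : ses (z \o s)%VF q.
  split=> //; apply: lker0_eq0 => x; rewrite comp_lfunE => zsx.
  apply: (proj1 (lker0_injP s) s0); apply: (proj1 (lker0_injP z) z0).
  by rewrite zsx !linear0.
have rz v : r (z v) = 0.
  by apply/eqP; rewrite -memv_ker -zI memv_img ?memvf.
have [|e eH eE] := hom_factor qH rH qS.
  move=> x /eqP; rewrite -memv_ker qK => /memv_imgP[y _ ->].
  by rewrite comp_lfunE rz.
have e0 k (m' : 'Hom(N k, Y)) : is_hom m' -> (forall x, e (m' x) = 0) ->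
    forall x, m' x = 0.
  move=> mH em x.
  have [|l lH lE] := ext1_zero_lift _ wq mH.
    by apply: ext1_zero_in_add (NM k); apply: Mext.
  have [|l' l'H l'E] := hom_corestrict zH lH z0.
    rewrite zI; apply/subvP=> _ /memv_imgP[y _ ->].
    by rewrite memv_ker -eE lE em.
  have: l' x \in trace M Z.
    by rewrite (subvP (Fac_limg (in_add_Fac (NM k)) l'H)) // memv_img ?memvf.
  rewrite -sI => /memv_imgP[y _ ly].
  by rewrite -lE -l'E ly; have := ses_comp0 y wq; rewrite comp_lfunE.
exists (N i), Y; split.
- exact: in_add_Fac.
- by apply: Fac_quot qH qS; apply: in_add_Fac.
- move=> k ki; apply/esym/(hom_dim_lift_eq eH (e0 k)) => u uH.
  have [Nk NkM] := Nprop k.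
  have [|l lH lE] := rl _ u Nk NkM uH.
    by move=> ub; case/eqP: ki; apply: Ninj; exists u.
  exists (q \o l)%VF; first exact: hom_comp.
  by move=> x; rewrite comp_lfunE eE lE.
- apply: (hom_dim_nonlift_lt eH (e0 i) (@hom_id _ _ _)) => l lH el.
  have [|l' l'H l'E] := ext1_zero_lift _ wq lH.
    by apply: ext1_zero_in_add (NM i); apply: Mext.
  apply: (rs l' l'H); exists id => x;
    by rewrite comp_lfunE -eE l'E el id_lfunE.
Qed.

(** The image of [r] is the radical of Q i. For a nonzero g : Q i -> M, which sincerity provides,
    the test pair is X = M / g(rad Q i) and Y = M / g(Q i): the two differ by the simple top of Q i,
    which only Q i detects. *)
Lemma sincere_num_indec_leq M m n :
  ext_progenerator (Fac M) M ->
  (forall Q, indecomposable Q -> summand Q (rmod_reg A) -> ~ hom_zero Q M) ->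
  num_indec M m -> num_indec (rmod_reg A) n -> (n <= m)%N.
Proof.
move=> Mp Msin [N [_ _ Nall]] [Q [Qprop Qinj _]].
have Qp i : projective (Q i).
  apply: projective_in_add (@projective_reg _ A) _.
  by apply: summand_in_add; case: (Qprop i).
have [_ Mext _] := Mp.
apply: (@hom_dim_count _ _ Q N (Fac M)) => i.
  have [Y [c [YM cH cl]]] := left_Fac_approx_projective M (Qp i).
  have [C [d [dH dS dK]]] := quotient_module (limg_stable cH).
  have cs X : Fac M X -> pres_surj c X by move=> XM h hH; apply: cl.
  have CM : in_add M C.
    apply: ext_progenerator_covers Mp _ _.
      by apply: Fac_quot dH dS; apply: in_add_Fac.
    move=> X XM; apply: (coker_ext1_zero cH dH) => //; last exact: cs.
    by apply: ext1_zero_in_add YM; apply: Mext.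
  have [a aE] := hom_dim_expand Nall YM.
  have [b bE] := hom_dim_expand Nall CM.
  exists a, b => X XM; rewrite -aE -bE addnC; apply/esym.
  by apply: (hom_dim_right_exact cH dH) => //; apply: cs.
have [Qi QiA] := Qprop i.
have [R [r [RA rH rl rs]]] := radical_map (rmod_reg A) Qi.
have [g [gH g0]] : exists g : 'Hom(Q i, M), is_hom g /\ g <> 0.
  apply: NNPP => nex; case: (Msin _ Qi QiA) => g gH.
  by apply: NNPP => g0; apply: nex; exists g.
have [G [p [j [pH jH pS j0 [jI jp]]]]] := image_factor gH.
have [G' [p' [j' [p'H j'H p'S j'0 [j'I j'p']]]]] := image_factor (hom_comp rH gH).
have jinj := proj1 (lker0_injP j) j0.
have [|t tH tE] := hom_corestrict jH j'H j0.
  by rewrite j'I jI limg_comp limgS ?subvf.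
have tinj : injective t.
  by move=> x y e; apply: (proj1 (lker0_injP j') j'0); rewrite -!tE e.
have t0 P (m' : 'Hom(P, G')) : is_hom m' -> (forall x, t (m' x) = 0) ->
    forall x, m' x = 0.
  by move=> _ tm x; apply: tinj; rewrite tm linear0.
have [X [q' [q'H q'S q'K]]] := quotient_module (limg_stable j'H).
have [Y [q [qH qS qK]]] := quotient_module (limg_stable jH).
have sX : ses j' q' by split.
have sY : ses j q by split.
have dE k : (hom_dim (Q k) G' + hom_dim (Q k) X =
             hom_dim (Q k) G + hom_dim (Q k) Y)%N.
  by rewrite -(hom_dim_ses sX) ?(hom_dim_ses sY) //; apply: projective_ext1_zero.
exists X, Y; split.
- exact: Fac_quot (Fac_self M) q'H q'S.
- exact: Fac_quot (Fac_self M) qH qS.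
- move=> k ki; apply/eqP; rewrite -(eqn_add2l (hom_dim (Q k) G')) dE eqn_add2r.
  rewrite eq_sym; apply/eqP; apply: (hom_dim_lift_eq tH (t0 _)) => u uH.
  have [u' u'H u'E] := projective_lift (Qp k) pH pS uH.
  have [Qk QkA] := Qprop k.
  have [|l lH lE] := rl _ u' Qk QkA u'H.
    by move=> ub; case/eqP: ki; apply: Qinj; exists u'.
  exists (p' \o l)%VF; first exact: hom_comp.
  move=> x; apply: jinj.
  by rewrite tE comp_lfunE j'p' comp_lfunE lE -jp u'E.
- have lt : (hom_dim (Q i) G' < hom_dim (Q i) G)%N.
    apply: (hom_dim_nonlift_lt tH (t0 _) pH) => l lH el.
    have [l' l'H l'E] := projective_lift (Qp i) p'H p'S lH.
    have gl x : g x = g (r (l' x)).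
      by rewrite -jp -el tE -l'E j'p' comp_lfunE.
    have rlH := hom_comp l'H rH.
    (* Nakayama's argument: g = g r l', and End(Q i) is local. If 1 - r l' is bijective then g = 0;
       that r l' is bijective is excluded by the choice of [r]. *)
    have [|||b|b] := @indec_local _ _ _ (\1%VF - (r \o l')%VF) (r \o l')%VF Qi.
    + by apply: hom_sub => //; apply: hom_id.
    + exact: rlH.
    + by rewrite subrK; exists id => x; rewrite id_lfunE.
    + apply: g0; apply/lfunP=> x; rewrite zero_lfunE.
      have [y <-] := proj1 (limg_fullP _) (bij_limg b) x.
      by rewrite add_lfunE opp_lfunE comp_lfunE id_lfunE linearB /= -gl subrr.
    + exact: rs l' l'H b.
  by rewrite -(ltn_add2l (hom_dim (Q i) G)) -dE ltn_add2r.
Qed.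

Lemma exists_num_indec M : exists m, num_indec M m.
Proof.
have [n] := ubnP (dim M); elim: n M => // n IH M ltn.
have [d0|M0] := posnP (dim M).
  exists 0%N, (fun=> M); split=> [[]|[]|X Xi XM] //.
  by have := leq_trans (indec_nonzero Xi) (summand_dim XM); rewrite d0.
have [X Xi [Y MXY]] := exists_indec_summand M0.
have YM : summand Y M.
  apply: summand_trans (summand_dsumr X Y) _; exact/iso_summand/iso_sym.
have [|m [N [Nprop Ninj Nall]]] := IH Y.
  rewrite ltnS in ltn; apply: leq_trans ltn.
  by rewrite (iso_dim MXY) dim_dsum -add1n leq_add2r indec_nonzero.
have Msum Z : indecomposable Z -> summand Z M -> iso Z X \/ exists i, iso Z (N i).
  move=> Zi ZM; have := summand_trans ZM (iso_summand MXY).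
  case/(indec_summand_dsum Zi)=> [ZX|ZY]; last by right; apply: Nall.
  by left; apply: indec_summand_iso ZX => //; apply: indec_nonzero.
have NM i : indecomposable (N i) /\ summand (N i) M.
  by have [Ni NiY] := Nprop i; split=> //; apply: summand_trans NiY YM.
have [[i XN]|nX] := classic (exists i, iso X (N i)).
  exists m, N; split=> // Z Zi /(Msum _ Zi)[ZX|//].
  by exists i; apply: iso_trans XN.
pose N' (k : 'I_m.+1) := if unlift ord0 k is Some i then N i else X.
have N'0 : N' ord0 = X by rewrite /N' unlift_none.
have N'S i : N' (lift ord0 i) = N i by rewrite /N' liftK.
exists m.+1, N'; split=> [k|k l|Z Zi /(Msum _ Zi)[ZX|[i ZN]]].
- have [i ->|->] := unliftP ord0 k; rewrite ?N'0 ?N'S //; split=> //.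
  by exists Y.
- have [i ->|->] := unliftP ord0 k; have [i' ->|->] := unliftP ord0 l;
    rewrite ?N'0 ?N'S // => e.
  + by rewrite (Ninj _ _ e).
  + by case: nX; exists i; apply: iso_sym.
  + by case: nX; exists i'.
- by exists ord0; rewrite N'0.
- by exists (lift ord0 i); rewrite N'S.
Qed.

Lemma in_add_of_indec M N :
  (forall X, indecomposable X -> summand X N -> in_add M X) -> in_add M N.
Proof.
have [n] := ubnP (dim N); elim: n N => // n IH N ltn NM.
have [d0|N0] := posnP (dim N); first exact: in_add0.
have [X Xi [Y NXY]] := exists_indec_summand N0.
apply: in_add_iso (iso_sym NXY) _; apply: in_add_dsum.
  by apply: NM => //; exists Y.
apply: IH => [|Z Zi ZY].
  rewrite ltnS in ltn; apply: leq_trans ltn.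
  by rewrite (iso_dim NXY) dim_dsum -add1n leq_add2r indec_nonzero.
apply: NM => //; apply: summand_trans ZY _; apply: summand_trans (summand_dsumr X Y) _.
exact/iso_summand/iso_sym.
Qed.

(** Matching the indecomposable summands of M with those of N is injective, hence onto by
    cardinality. *)
Lemma in_add_num_indec M N m n : in_add N M -> num_indec M m -> num_indec N n ->
  (n <= m)%N -> in_add M N.
Proof.
move=> MN [F [Fprop Finj _]] [G [_ Ginj Gall]] lenm.
have /fin_all_exists[s sE] i : exists j, iso (F i) (G j).
  have [Fi FM] := Fprop i; apply: Gall => //; apply: in_add_indec => //.
  exact: in_add_summand FM MN.
have sinj : injective s.
  move=> i i' e; apply: Finj; apply: iso_trans (sE i) _.
  by rewrite e; apply: iso_sym.
apply: in_add_of_indec => X Xi XN; have [j Xj] := Gall X Xi XN.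
have /codomP[i ji] : j \in codom s.
  by apply: (inj_card_onto sinj); rewrite !card_ord.
apply: in_add_iso (iso_sym Xj) _; rewrite ji.
apply: in_add_iso (sE i) _; apply: summand_in_add; by case: (Fprop i).
Qed.

End HomDimensions.

(** * Quotients by idempotent ideals *)

Section QuotientAlgebra.
Variables (K : fieldType) (L : fdalg K).
Implicit Types (a b e x y : L).

Lemma amul0l a : (0 : L) ** a = 0.
Proof. exact: (@mact0l _ _ (rmod_reg L)). Qed.

Lemma amul0r a : a ** (0 : L) = 0.
Proof. exact: (@mact0r _ _ (rmod_reg L)). Qed.

Lemma amulBl x y a : (x - y) ** a = x ** a - y ** a.
Proof. exact: (@mactB _ _ (rmod_reg L)). Qed.

Lemma amulBr x y a : a ** (x - y) = a ** x - a ** y.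
Proof. by rewrite -!lmulE linearB. Qed.

Lemma amul_suml I (r : seq I) (F : I -> L) a :
  (\sum_(i <- r) F i) ** a = \sum_(i <- r) (F i ** a).
Proof. exact: (@mact_sum _ _ (rmod_reg L)). Qed.

Lemma amul_sumr I (r : seq I) (F : I -> L) a :
  a ** (\sum_(i <- r) F i) = \sum_(i <- r) (a ** F i).
Proof. by rewrite -lmulE linear_sum; apply: eq_bigr => i _; rewrite /= lmulE. Qed.

Lemma ideal_gen_mem e a b : in_ideal_gen e (a ** e ** b).
Proof. by exists [:: (a, b)]; rewrite big_seq1. Qed.

Lemma ideal_gen_self e : in_ideal_gen e e.
Proof. by have := ideal_gen_mem e aone aone; rewrite amul_1l amul_1r. Qed.

Lemma ideal_gen0 e : in_ideal_gen e 0.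
Proof. by exists [::]; rewrite big_nil. Qed.

Lemma ideal_gen_linear e k x y :
  in_ideal_gen e x -> in_ideal_gen e y -> in_ideal_gen e (k *: x + y).
Proof.
move=> [s ->] [t ->]; exists ([seq (k *: q.1, q.2) | q <- s] ++ t).
rewrite big_cat big_map scaler_sumr; congr (_ + _).
by apply: eq_bigr => q _; rewrite !amul_scalel.
Qed.

Lemma ideal_gen_mull e a x : in_ideal_gen e x -> in_ideal_gen e (a ** x).
Proof.
move=> [s ->]; exists [seq (a ** q.1, q.2) | q <- s].
by rewrite amul_sumr big_map; apply: eq_bigr => q _; rewrite !amul_assoc.
Qed.

Lemma ideal_gen_mulr e a x : in_ideal_gen e x -> in_ideal_gen e (x ** a).
Proof.
move=> [s ->]; exists [seq (q.1, q.2 ** a) | q <- s].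
by rewrite amul_suml big_map; apply: eq_bigr => q _; rewrite amul_assoc.
Qed.

Lemma ideal_gen_sub e e' x : in_ideal_gen e' e -> in_ideal_gen e x ->
  in_ideal_gen e' x.
Proof.
move=> ee' [s ->]; elim: s => [|q s IH]; first by rewrite big_nil; apply: ideal_gen0.
rewrite big_cons -[q.1 ** e ** q.2]scale1r; apply: ideal_gen_linear => //.
by apply: ideal_gen_mulr; apply: ideal_gen_mull.
Qed.

Lemma ideal_gen_vspace e :
  exists W : {vspace L}, forall x, x \in W <-> in_ideal_gen e x.
Proof.
apply: vspace_of_pred; first exact: ideal_gen0.
by move=> k u v; apply: ideal_gen_linear.
Qed.

Lemma exists_quotient e :
  exists (B : fdalg K) (p : alg_hom L B), is_quotient_by e p.
Proof.
have [W WP] := ideal_gen_vspace e.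
have [Q [p [s [sK p0]]]] := quotient_space W.
have peq x y : in_ideal_gen e (x - y) -> p x = p y.
  by move/WP/p0/eqP; rewrite linearB subr_eq0 => /eqP.
have sp x : in_ideal_gen e (s (p x) - x).
  by apply/WP/p0; rewrite linearB /= sK subrr.
have pl x y : p (s (p x) ** y) = p (x ** y).
  by apply: peq; rewrite -amulBl; apply: ideal_gen_mulr.
have pr x y : p (x ** s (p y)) = p (x ** y).
  by apply: peq; rewrite -amulBr; apply: ideal_gen_mull.
pose m (u v : Q) := p (s u ** s v).
have mDl u v w : m (u + v) w = m u w + m v w.
  by rewrite /m linearD amul_addl linearD.
have mDr u v w : m u (v + w) = m u v + m u w.
  by rewrite /m linearD amul_addr linearD.
have mZl k u v : m (k *: u) v = k *: m u v.
  by rewrite /m linearZ amul_scalel linearZ.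
have mZr k u v : m u (k *: v) = k *: m u v.
  by rewrite /m linearZ amul_scaler linearZ.
have mA u v w : m u (m v w) = m (m u v) w.
  by rewrite /m pl pr amul_assoc.
have m1l u : m (p aone) u = u by rewrite /m pl amul_1l sK.
have m1r u : m u (p aone) = u by rewrite /m pr amul_1r sK.
pose B := @FdAlg K Q m (p aone) mDl mDr mZl mZr mA m1l m1r.
have pM x y : p (x ** y) = m (p x) (p y) by rewrite /m pl pr.
exists B, (@AlgHom K L B p erefl pM); split.
  by apply/limg_fullP=> q; exists (s q); rewrite sK.
by move=> x; split=> [/p0/WP|/WP/p0].
Qed.

End QuotientAlgebra.

(** * Modules over L/<e> as the L-modules killed by e *)

Section Restriction.
Variables (K : fieldType) (L B : fdalg K) (e : L) (p : alg_hom L B).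
Hypotheses (ee : e ** e = e) (pq : is_quotient_by e p).
Implicit Types (M X Y Z : rmod L) (N P V W : rmod B).

Definition killed_by (a : L) M : Prop := forall v : M, v *> a = 0.

Lemma quotient_gen0 : p e = 0.
Proof. by apply/(proj2 pq)/ideal_gen_self. Qed.

Lemma quotient_surj b : exists a, p a = b.
Proof. by have [/limg_fullP] := pq. Qed.

Lemma restrictE N (v : N) (a : L) : (v : restrict p N) *> a = v *> p a.
Proof. by []. Qed.

Lemma killed_restrict N : killed_by e (restrict p N).
Proof. by move=> v; rewrite restrictE quotient_gen0 mact0r. Qed.

Lemma killed_mono a X M (f : 'Hom(X, M)) : is_hom f -> lker f = 0%VS ->
  killed_by a M -> killed_by a X.
Proof.
move=> fH /lker0_injP finj Mk v; apply: finj.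
by rewrite fH Mk linear0.
Qed.

Lemma killed_epi a M X (f : 'Hom(M, X)) : is_hom f -> limg f = fullv ->
  killed_by a M -> killed_by a X.
Proof.
move=> fH /limg_fullP fS Mk x; have [v <-] := fS x.
by rewrite -fH Mk linear0.
Qed.

Lemma killed_in_add a M X : in_add M X -> killed_by a M -> killed_by a X.
Proof.
move=> [I [f [g [fH gH gf]]]] Mk x; rewrite -[x]gf mact_sum big1 // => i _.
by rewrite -gH Mk linear0.
Qed.

Lemma killed_Fac a M X : Fac M X -> killed_by a M -> killed_by a X.
Proof.
move=> [Y [f [/addP YM fH fS]]] Mk.
by apply: killed_epi fH fS _; apply: killed_in_add Mk.
Qed.

(** y e comes from X, so it is killed by e; but y e = (y e) e. This is where idempotence of [e]
    enters. *)
Lemma killed_ses X Y Z (f : 'Hom(X, Y)) (g : 'Hom(Y, Z)) : ses f g ->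
  killed_by e X -> killed_by e Z -> killed_by e Y.
Proof.
move=> fg Xk Zk y; have [fH gH _ _ _] := fg.
have [|x fx] := ses_ker (y := y *> e) fg; first by rewrite gH Zk.
by rewrite -ee mact_assoc -fx -fH Xk linear0.
Qed.

Lemma killed_ideal M (v : M) a : killed_by e M -> in_ideal_gen e a -> v *> a = 0.
Proof.
move=> Mk [s ->]; elim: s => [|q s IH]; first by rewrite big_nil mact0r.
by rewrite big_cons mact_addr IH addr0 !mact_assoc Mk mact0l.
Qed.

Lemma corestrict M : killed_by e M -> exists N, iso M (restrict p N).
Proof.
move=> Mk; have [/limg_fullP pS p0] := pq.
pose s (b : B) : L := (p^-1)%VF b.
have sK b : p (s b) = b.
  by apply: limg_lfunVK; rewrite (proj1 pq) memvf.
have eqa (v : M) a a' : p a = p a' -> v *> a = v *> a'.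
  move=> paa'; apply/eqP; rewrite -subr_eq0 -scaleN1r -mact_scaler -mact_addr.
  rewrite scaleN1r; apply/eqP/killed_ideal => //; apply/p0.
  by rewrite linearB /= paa' subrr.
pose act (v : M) (b : B) := v *> s b.
have actDl u v b : act (u + v) b = act u b + act v b by rewrite /act mact_addl.
have actDr u b b' : act u (b + b') = act u b + act u b'.
  by rewrite /act -mact_addr; apply: eqa; rewrite linearD /= !sK.
have actZl k u b : act (k *: u) b = k *: act u b by rewrite /act mact_scalel.
have actZr k u b : act u (k *: b) = k *: act u b.
  by rewrite /act -mact_scaler; apply: eqa; rewrite linearZ /= !sK.
have actA u b b' : act u (b ** b') = act (act u b) b'.
  by rewrite /act -mact_assoc; apply: eqa; rewrite alg_homM !sK.
have act1 u : act u aone = u.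
  by rewrite -[RHS]mact_1; apply: eqa; rewrite sK alg_hom1.
pose N := @RMod K B M act actDl actDr actZl actZr actA act1.
exists N, (\1%VF : 'Hom(M, restrict p N)).
  by move=> v a; rewrite !id_lfunE; apply: eqa; rewrite sK.
by exists id => v; rewrite id_lfunE.
Qed.

Lemma restrict_hom N P (f : 'Hom(N, P)) :
  @is_hom K L (restrict p N) (restrict p P) f <-> is_hom f.
Proof.
split=> fH v a; last exact: fH.
by have [x <-] := quotient_surj a; apply: fH.
Qed.

Lemma restrict_in_add N P : in_add (restrict p N) (restrict p P) <-> in_add N P.
Proof.
split=> -[I [f [g [fH gH gf]]]]; exists I, f, g; split=> // i;
  by apply/restrict_hom.
Qed.

Lemma restrict_trace N P : trace (restrict p N) (restrict p P) = trace N P.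
Proof.
apply: subv_anti; apply/andP; split.
  apply: (@trace_sub K L (restrict p N) (restrict p P)) => f /restrict_hom fH.
  exact: (limg_trace fH).
apply: (@trace_sub K B N P) => f /restrict_hom fH.
exact: (limg_trace fH).
Qed.

Lemma restrict_Fac N P : Fac (restrict p N) (restrict p P) <-> Fac N P.
Proof.
split=> /FacP tf; apply/FacP; first by rewrite -restrict_trace.
by rewrite restrict_trace.
Qed.

Lemma restrict_ses N P V (f : 'Hom(N, P)) (g : 'Hom(P, V)) :
  @ses K L (restrict p N) (restrict p P) (restrict p V) f g <-> ses f g.
Proof. by split=> -[fH gH f0 fg gS]; split=> //; apply/restrict_hom. Qed.

(** By [killed_ses], the middle term of an extension over L is again a B-module, so both algebras
    have the same extensions between B-modules. *)
Lemma restrict_ext1_zero N P :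
  ext1_zero (restrict p N) (restrict p P) <-> ext1_zero N P.
Proof.
split=> NP; apply: section_ext1_zero => Y f g fg.
  have [s sH sE] := ext1_zero_section NP (proj2 (restrict_ses f g) fg).
  by exists s => //; apply/restrict_hom.
have [fH gH f0 fI gS] := fg.
have [Y' [h hH hB]] := corestrict (killed_ses fg (@killed_restrict _) (@killed_restrict _)).
have [h' [h'H hK h'K]] := hom_inv hH hB.
have fg' : @ses K B P Y' N (h \o f)%VF (g \o h')%VF.
  apply/restrict_ses; split.
  - exact: hom_comp fH hH.
  - exact: hom_comp h'H gH.
  - apply: lker0_eq0 => x; rewrite comp_lfunE => hfx; apply: (ses_inj fg).
    by rewrite linear0 -[f x]hK hfx linear0.
  - apply/vspaceP=> y; rewrite memv_ker comp_lfunE.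
    apply/memv_imgP/eqP=> [[x _ ->]|gh].
      by rewrite comp_lfunE hK (ses_comp0 _ fg).
    have [x fx] := ses_ker fg gh; exists x; rewrite ?memvf //.
    by rewrite comp_lfunE fx h'K.
  - apply/limg_fullP=> z; have [y gy] := ses_surj z fg.
    by exists (h y); rewrite comp_lfunE hK.
have [s sH sE] := ext1_zero_section NP fg'.
exists (h' \o (s : 'Hom(restrict p N, restrict p Y')))%VF.
  by apply: hom_comp => //; apply/restrict_hom.
by move=> x; rewrite comp_lfunE -[RHS]sE comp_lfunE.
Qed.

Lemma restrict_ext_rigid N : ext_rigid (restrict p N) <-> ext_rigid N.
Proof.
split=> Nr X XN.
  by apply/restrict_ext1_zero; apply: Nr; apply/restrict_Fac.
have [X' XX'] := corestrict (killed_Fac XN (@killed_restrict N)).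
apply: ext1_zero_iso (iso_sym XX') _; apply/restrict_ext1_zero/Nr/restrict_Fac.
exact: Fac_iso XX' XN.
Qed.

Lemma restrict_ext_progenerator V N : ext_progenerator (Fac V) N ->
  ext_progenerator (Fac (restrict p V)) (restrict p N).
Proof.
move=> [NV Next Ncov]; split=> [|X XV|X XV]; first exact/restrict_Fac.
  have [X' XX'] := corestrict (killed_Fac XV (@killed_restrict V)).
  apply: ext1_zero_iso (iso_sym XX') _; apply/restrict_ext1_zero/Next/restrict_Fac.
  exact: Fac_iso XX' XV.
have [X' XX'] := corestrict (killed_Fac XV (@killed_restrict V)).
have XV' : Fac V X' by apply/restrict_Fac; apply: Fac_iso XX' XV.
have [Y [P' [f [g [/addP NP' [YV P'V _ fg]]]]]] := Ncov X' XV'.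
have [h hH hB] := iso_sym XX'.
have /restrict_ses[fH gH f0 fI gS] := fg.
exists (restrict p Y), (restrict p P'), f,
  (h \o (g : 'Hom(restrict p P', restrict p X')))%VF.
split; first exact/addP/restrict_in_add.
split; [exact/restrict_Fac | exact/restrict_Fac | by [] |].
split=> //.
- exact: hom_comp gH hH.
- rewrite fI; apply/vspaceP=> y; rewrite !memv_ker comp_lfunE.
  apply/eqP/eqP=> [-> | hg]; first by rewrite linear0.
  by apply: (bij_inj hB); rewrite hg linear0.
- by rewrite limg_comp gS bij_limg.
Qed.

End Restriction.

(** * Support tau-tilting modules *)

Section SupportTauTilting.
Variables (K : fieldType) (L : fdalg K).
Implicit Types (T U P X M : rmod L).

Lemma ext_rigid_iso (A : fdalg K) (M N : rmod A) : iso M N -> ext_rigid M ->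
  ext_rigid N.
Proof.
move=> MN Mr X XN; apply: (ext1_zero_in_add (M := M)).
  by apply: Mr; apply: Fac_trans XN; apply: Fac_iso MN (Fac_self M).
exact: in_add_iso MN (in_add_refl M).
Qed.

Lemma Fac_iso_eq (A : fdalg K) (M N : rmod A) : iso M N -> Fac M = Fac N.
Proof.
move=> MN; apply: subcat_ext => X; split; apply: Fac_trans.
  by apply: Fac_iso (iso_sym MN) (Fac_self N).
by apply: Fac_iso MN (Fac_self M).
Qed.

Lemma ext_progenerator_rigid (A : fdalg K) (M : rmod A) :
  ext_progenerator (Fac M) M -> ext_rigid M.
Proof. by case. Qed.

Lemma stau_tilt_restrict T : stau_tilt T ->
  exists (e : L) (B : fdalg K) (p : alg_hom L B) (N : rmod B),
    [/\ e ** e = e, is_quotient_by e p, ext_rigid N, iso T (restrict p N)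
      & exists n, num_indec N n /\ num_indec (rmod_reg B) n].
Proof.
case=> _ [e ee [B [p [N [pq [/tau_rigidP Nr Nn] TN]]]]].
by exists e, B, p, N.
Qed.

Lemma stau_tilt_tau_rigid T : stau_tilt T -> tau_rigid T.
Proof.
move=> Ts; have [Tb _] := Ts.
have [e [B [p [N [ee pq Nr TN _]]]]] := stau_tilt_restrict Ts.
split=> //; apply/tau_rigidP; apply: ext_rigid_iso (iso_sym TN) _.
exact/(restrict_ext_rigid ee pq).
Qed.

(** Over B, rigidity puts N in add P for an Ext-progenerator P of Fac N. Since |P| <= |B| = |N|, the
    two additive closures coincide, so N is an Ext-progenerator too; this is carried back to L by
    restriction. *)
Lemma stau_tilt_ext_progenerator T : stau_tilt T -> ext_progenerator (Fac T) T.
Proof.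
move=> Ts; have [e [B [p [N [ee pq Nr TN [n [Nn Bn]]]]]]] := stau_tilt_restrict Ts.
have Nf := f_tors_Fac Nr; have [Nt _] := Nf.
have [P Pp] := exists_ext_progenerator Nf; have [PN Pext _] := Pp.
have NP : in_add P N by apply: ext_progenerator_covers Pp (Fac_self N) Nr.
have [m Pm] := exists_num_indec P.
have lemn : (m <= n)%N.
  apply: rigid_num_indec_leq Pm Bn => X XP.
  by apply: Pext; apply: Fac_trans XP.
have PN' : in_add N P by apply: in_add_num_indec NP Nn Pm lemn.
have Np := ext_progenerator_in_add Nt NP PN' Pp.
rewrite (Fac_iso_eq TN).
apply: ext_progenerator_in_add (restrict_ext_progenerator ee pq Np).
- by have [] := f_tors_Fac (proj2 (restrict_ext_rigid ee pq N) Nr).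
- exact: in_add_iso (iso_sym TN) (in_add_refl _).
- exact: in_add_iso TN (in_add_refl _).
Qed.

Lemma reg_summand_idempotent (A : fdalg K) (Q : rmod A) (i : 'Hom(Q, rmod_reg A))
    (r : 'Hom(rmod_reg A, Q)) :
  is_hom i -> is_hom r -> (forall x, r (i x) = x) ->
  forall x, i x = i (r aone) ** i x.
Proof.
move=> iH rH ri x; have -> : i (r aone) ** i x = i (r aone) *> (i x : A) by [].
by rewrite -iH -rH /= amul_1l ri.
Qed.

(* Idempotents lift along L -> L/<e>: by Fitting's lemma a lift y of the
   idempotent f in (1-e)L splits off a summand eps L = y^n L of L, and then
   e + eps(1-e) is an idempotent generating a larger ideal. *)
Lemma extend_idempotent (B : fdalg K) (p : alg_hom L B) (e : L) (f : B) :
  e ** e = e -> is_quotient_by e p -> f ** f = f -> f <> 0 ->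
  exists e' : L, [/\ e' ** e' = e', in_ideal_gen e' e, ~ in_ideal_gen e e'
    & exists b, p e' = f ** b].
Proof.
move=> ee pq ff f0; have [/limg_fullP pS p0] := pq.
have pe : p e = 0 by apply: quotient_gen0.
have [x px] := pS f; pose y := x - e ** x.
have py : p y = f by rewrite linearB /= alg_homM px pe amul0l subr0.
have ey : e ** y = 0 by rewrite amulBr amul_assoc ee subrr.
have lH : @is_hom K L (rmod_reg L) (rmod_reg L) (lmul y).
  by move=> a b; rewrite !lmulE /= amul_assoc.
have [n [Z [i [r [iH rH ri [iterZ Ziter]]]]]] := fitting lH.
pose d := i (r aone).
have dd : d ** d = d by rewrite /d -(reg_summand_idempotent iH rH ri).
have piter a : p (iter n.+1 (lmul y) a) = f ** p a.
  elim: n {iterZ Ziter} a => [|k IH] a; first by rewrite /= lmulE alg_homM py.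
  by rewrite iterS lmulE alg_homM py IH amul_assoc ff.
have [a da] := Ziter (r aone).
have ed : e ** d = 0.
  by rewrite /d da iterS lmulE amul_assoc ey amul0l.
have pd : p d = f ** p a by rewrite /d da piter.
have pd0 : p d <> 0.
  move=> pd0; apply: f0; have [z zE] := iterZ aone.
  have := piter aone; rewrite alg_hom1 amul_1r => <-.
  by rewrite zE (reg_summand_idempotent iH rH ri) alg_homM -/d pd0 amul0l.
pose e' := e + (d - d ** e).
have ee' : e ** e' = e by rewrite amul_addr amulBr amul_assoc ee ed amul0l subrr addr0.
have ge : in_ideal_gen e' e.
  by have := ideal_gen_mem e' e aone; rewrite ee' amul_1r.
have pe' : p e' = p d.
  by rewrite linearD linearB /= alg_homM pe amul0r subr0 add0r.
have de' : d ** e' = d.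
  by rewrite amul_addr amulBr !amul_assoc dd addrC subrK.
exists e'; split=> //.
- rewrite {1}/e' amul_addl amulBl de' ee' -amul_assoc ee'.
  by [].
- by move/p0; rewrite pe'.
- by exists (p a); rewrite pe'.
Qed.

Lemma maximal_killing_idempotent P : exists e : L,
  [/\ e ** e = e, killed_by e P & forall e' : L, e' ** e' = e' ->
     killed_by e' P -> in_ideal_gen e' e -> in_ideal_gen e e'].
Proof.
pose S d := exists (e : L) (W : {vspace L}), [/\ e ** e = e, killed_by e P,
  forall x, x \in W <-> in_ideal_gen e x & \dim W = d].
have [||d [[e [W [ee Pe WE dW]]] dmax]] := @nat_max S (\dim {:L}).
- have [W WE] := ideal_gen_vspace (0 : L); exists (\dim W), 0, W; split=> //.
    exact: amul0l.
  by move=> v; rewrite mact0r.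
- by move=> _ [e [W [_ _ _ <-]]]; apply: dimvS (subvf W).
exists e; split=> // e' ee' Pe' ge; have [W' WE'] := ideal_gen_vspace e'.
have WW' : (W <= W')%VS.
  by apply/subvP=> x /WE ex; apply/WE'; apply: ideal_gen_sub ge ex.
have /eqP WeW' : W == W'.
  by rewrite eqEdim WW' dW; apply: dmax; exists e', W'.
by apply/WE; rewrite WeW'; apply/WE'/ideal_gen_self.
Qed.

(** What remains after the two bounds is sincerity of N, the module P seen over B = L/<e>. A
    projective Q = f B with Hom(Q, N) = 0 means N f = 0, and [f] would then enlarge <e> to the ideal
    of a further idempotent killing P. *)
Lemma co_bongartz_stau_tilt U : tau_rigid U -> stau_tilt (co_bongartz U).
Proof.
move=> [_ /tau_rigidP Ur]; have Uf := f_tors_Fac Ur; have [Ut _] := Uf.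
rewrite /co_bongartz; set P := progen (Fac U).
have [Pb Pp] := progen_spec Uf; split=> //.
have [e [ee Pe emax]] := maximal_killing_idempotent P.
exists e => //; have [B [p pq]] := exists_quotient e.
have Pk X : Fac U X -> killed_by e X.
  by move=> XU; apply: killed_Fac Pe; apply/(Fac_ext_progenerator Ut Pp).
have [PU _ _] := Pp.
have [V UV] := corestrict pq (Pk _ (Fac_self U)).
have [N PN] := corestrict pq Pe.
exists B, p, N; split=> //.
have Vr : ext_rigid V.
  by apply/(restrict_ext_rigid ee pq); apply: ext_rigid_iso UV Ur.
have Vf := f_tors_Fac Vr; have [Vt _] := Vf.
(* Progenerators are only transported from B to L. So one over B is restricted and compared with P
   over L; having the same additive closure as [N0], N is a progenerator as well. *)
have [N0 N0p] := exists_ext_progenerator Vf.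
have RN0p := restrict_ext_progenerator ee pq N0p.
rewrite -(Fac_iso_eq UV) in RN0p.
have [PU' Pext _] := Pp; have [N0U N0ext _] := RN0p.
have N0N : in_add N0 N.
  apply/(restrict_in_add pq); apply: in_add_iso PN _.
  exact: ext_progenerator_covers RN0p PU' Pext.
have NN0 : in_add N N0.
  apply/(restrict_in_add pq); apply: in_add_trans (_ : in_add _ P) _.
    exact: summand_in_add (iso_summand PN).
  exact: ext_progenerator_covers Pp N0U N0ext.
have NVp := ext_progenerator_in_add Vt N0N NN0 N0p.
have Np : ext_progenerator (Fac N) N.
  by rewrite (subcat_ext (Fac_ext_progenerator Vt NVp)).
have Nr := ext_progenerator_rigid Np.
have [m Nm] := exists_num_indec N.
have [n Bn] := exists_num_indec (rmod_reg B).
split; first exact/tau_rigidP.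
have lemn := rigid_num_indec_leq Nr Nm Bn.
suff lenm : (n <= m)%N.
  by exists n; split=> //; have -> : n = m by apply/eqP; rewrite eqn_leq lenm.
apply: (sincere_num_indec_leq Np _ Nm Bn) => Q Qi /summandP[i [r [iH rH ri]]] QN0.
pose f : B := i (r aone).
have ff : f ** f = f by rewrite /f -(reg_summand_idempotent iH rH ri).
have f0 : f <> 0.
  move=> f0; have := indec_nonzero Qi; rewrite -dimvf lt0n => /negP[].
  rewrite dimv_eq0 -subv0; apply/subvP=> x _; rewrite memv0 -(ri x).
  by rewrite (reg_summand_idempotent iH rH ri) -/f f0 amul0l linear0.
have Nf (v : N) : v *> f = 0.
  have /lfunP/(_ (r aone)) := QN0 _ (hom_comp iH (rmul_hom v)).
  by rewrite comp_lfunE rmulE zero_lfunE.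
have [e' [ee' ge' nge [b pe']]] := extend_idempotent ee pq ff f0.
(* [e'] kills P because p e' = f b and f annihilates N, which contradicts the maximality of [e]. *)
apply/nge/emax => //.
have [h hH /bij_lker0 h0] := PN; apply: killed_mono hH h0 _.
by move=> v; rewrite restrictE pe' mact_assoc Nf mact0l.
Qed.

End SupportTauTilting.

Theorem proposition1p9 (K : closedFieldType) (L : fdalg K) :
  [/\ forall T : rmod L, stau_tilt T -> tau_rigid T,
      forall T : subcat L, f_tors T -> fL2_tors_star T,
      forall U : rmod L, tau_rigid U -> fL2_tors_star (cok1 U),
      (forall T : rmod L, stau_tilt T -> f_tors (Fac T)) /\
        (forall U : rmod L, tau_rigid U -> f_tors (Fac U))
    & (forall U : rmod L, tau_rigid U -> stau_tilt (co_bongartz U)) /\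
        (forall C : subcat L, fL2_tors_star C -> f_tors (T1 C))] /\
  [/\ forall T : rmod L, stau_tilt T -> eq_subcat (cok1 T) (Fac T),
      forall T : rmod L, stau_tilt T -> iso (co_bongartz T) T,
      forall T : subcat L, f_tors T -> eq_subcat (T1 T) T
    & forall U : rmod L, tau_rigid U ->
        eq_subcat (Fac (co_bongartz U)) (Fac U) /\
        eq_subcat (Fac U) (T1 (cok1 U))].
Proof.
have rigid (U : rmod L) : tau_rigid U -> ext_rigid U by case=> _ /tau_rigidP.
split; split.
- exact: stau_tilt_tau_rigid.
- exact: f_tors_fL2.
- by move=> U /rigid; apply: cok1_fL2.
- split=> [T /stau_tilt_tau_rigid|U]; move/rigid; exact: f_tors_Fac.
- split=> [|C [] //]; exact: co_bongartz_stau_tilt.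
- by move=> T /stau_tilt_ext_progenerator; apply: cok1_ext_progenerator.
- move=> T Ts; have [Tb _] := Ts.
  apply: progen_iso Tb (stau_tilt_ext_progenerator Ts).
  exact/f_tors_Fac/rigid/stau_tilt_tau_rigid.
- by move=> T [Tt _]; apply: T1_torsion.
- move=> U /rigid Ur; split; first exact: Fac_co_bongartz.
  exact: T1_cok1.
Qed.
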